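(* For almost all primes $p$ and all finite extensions $K/\mathbf{Q}_p$, $\zeta^{\le}_{\mathfrak{gl}_2(\mathfrak{O}_K)}(s)=W(q_K,q_K^{-s})$, where $$W(X,Y)=\frac{N(X,Y)}{(1-X^7Y^6)(1-X^3Y^3)(1-X^2Y^2)^2(1-Y)},$$ $$\begin{aligned}N={}&-X^8Y^{10}-X^8Y^9-X^7Y^9-2X^7Y^8+X^7Y^7-X^6Y^8-X^6Y^7+2X^6Y^6-2X^5Y^7+2X^5Y^5\\&-3X^4Y^6+3X^4Y^4-2X^3Y^5+2X^3Y^3-2X^2Y^4+X^2Y^3+X^2Y^2-XY^3+2XY^2+XY+Y+1.\end{aligned}$$
   Context: $\mathfrak{gl}_2(\mathfrak{O}_K)$ is the Lie $\mathfrak{O}_K$-algebra of $2\times2$ matrices over the valuation ring $\mathfrak{O}_K$ with the commutator bracket; $q_K$ is the residue field size of $K$. For an $\mathfrak{O}_K$-algebra $\mathsf{A}$, $\zeta^{\le}_{\mathsf{A}}(s)=\sum_{\mathsf{U}}[\mathsf{A}:\mathsf{U}]^{-s}$, summing over $\mathfrak{O}_K$-subalgebras (submodules closed under the bracket) $\mathsf{U}$ with $\mathsf{A}/\mathsf{U}$ finite of cardinality $[\mathsf{A}:\mathsf{U}]$. *)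

(* Defs.v *)
From HB Require Import structures.
From mathcomp Require Import all_boot all_order all_algebra.
Set Implicit Arguments. Unset Strict Implicit. Unset Printing Implicit Defensive.
Import GRing.Theory.
Local Open Scope ring_scope.

Definition padic_int_ring (p : nat) (R : idomainType) (pi : R) : Prop :=
  [/\ pi != 0 /\ pi \isn't a GRing.unit,
      (forall x : R, x != 0 ->
         exists (u : R) (n : nat), u \is a GRing.unit /\ x = u * pi ^+ n),
      (forall n : nat, (n.+1)%:R != 0 :> R),
      (exists r : R, p%:R = pi * r)
    &
      (forall a : nat -> R,
         (forall n, exists r, a n.+1 - a n = pi ^+ n * r) ->
         exists l : R, forall n, exists r, l - a n = pi ^+ n * r)].

Definition residue_card (R : idomainType) (pi : R) (q : nat) : Prop :=
  exists f : 'I_q -> R,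
    (forall x : R, exists i, exists r, x - f i = pi * r) /\
    (forall i j, (exists r, f i - f j = pi * r) -> i = j).

Definition lie_bracket (R : comNzRingType) (x y : 'M[R]_2) : 'M[R]_2 :=
  x *m y - y *m x.

Definition gl2_subalgebra (R : comNzRingType) (U : 'M[R]_2 -> Prop) : Prop :=
  [/\ U 0,
      (forall x y, U x -> U y -> U (x + y)),
      (forall (r : R) x, U x -> U (r *: x))
    & (forall x y, U x -> U y -> U (lie_bracket x y))].

Definition has_index (R : comNzRingType) (U : 'M[R]_2 -> Prop) (n : nat) : Prop :=
  exists f : 'I_n -> 'M[R]_2,
    (forall x, exists i, U (x - f i)) /\
    (forall i j, U (f i - f j) -> i = j).

Definition card_sets (T : Type) (P : (T -> Prop) -> Prop) (c : nat) : Prop :=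
  exists f : 'I_c -> (T -> Prop),
    [/\ (forall i, P (f i)),
        (forall i j, (forall x, f i x <-> f j x) -> i = j)
      & (forall U, P U -> exists i, forall x, U x <-> f i x)].

(* ---------- The rational function W(X,Y), as polynomials in Y = T ---------- *)
Definition mono (c : int) (a b : nat) (X : int) : {poly int} :=
  (c * X ^+ a) *: 'X^b.

Definition W_num (X : int) : {poly int} :=
  mono (-1) 8 10 X + mono (-1) 8 9 X + mono (-1) 7 9 X + mono (-2) 7 8 X
  + mono 1 7 7 X + mono (-1) 6 8 X + mono (-1) 6 7 X + mono 2 6 6 X
  + mono (-2) 5 7 X + mono 2 5 5 X
  + mono (-3) 4 6 X + mono 3 4 4 X + mono (-2) 3 5 X + mono 2 3 3 X
  + mono (-2) 2 4 X + mono 1 2 3 X + mono 1 2 2 X + mono (-1) 1 3 X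
  + mono 2 1 2 X + mono 1 1 1 X + mono 1 0 1 X + mono 1 0 0 X.

Definition W_den (X : int) : {poly int} :=
  (1 - mono 1 7 6 X) * (1 - mono 1 3 3 X) * (1 - mono 1 2 2 X) ^+ 2
  * (1 - 'X).

(* Main.v *)
(** Since 2 is a unit, gl_2 is the product of its centre R and sl_2. A subalgebra of
    index q^(k+m) is determined by its projection A to sl_2, of index q^k, by the ideal
    pi^m in which it meets the centre, and by a linear map A / [A, A] -> R / pi^m. A basis
    of A that is orthogonal for the trace form diagonalizes the bracket, with structure
    constants s_1, s_2, s_3, so there are w m A = q^(sum_i min(v(s_i), m)) such maps.

    The sum of the w m A over all A is found by descent on the index. If [A, A] lies in
    pi A, then A is either pi A' or the image of A' under a similitude theta_i attached to
    a point i of the projective line over the residue field, i.e., to a Borel subalgebra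
    modulo pi; here theta_i is applied only to the A' not contained in that Borel
    subalgebra. Hence one keeps track of the number beta(A) of Borel subalgebras modulo pi
    containing A: the weights q + 1 - beta and 2 - beta are eigenvectors of this descent,
    with eigenvalues q and 1, and their difference is the constant q - 1. If exactly one
    s_i is a unit, A has a canonical overalgebra (its parent) in which it has index q, and
    the algebras with a given parent correspond to certain points of a projective plane over
    the residue field, in the main case those off a conic.
    Otherwise the norm form takes a unit value on A, and such A are counted directly. The
    resulting recurrences become linear equations between power series in T, whose solution
    is the rational function W. *)

Require Import Defs.
From HB Require Import structures.
From mathcomp Require Import all_boot all_order all_algebra.
From mathcomp Require Import boolp classical_sets.
From mathcomp Require Import ring zify.
Set Implicit Arguments. Unset Strict Implicit. Unset Printing Implicit Defensive.
Import GRing.Theory.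
Local Open Scope ring_scope.


(** * Sums over finite classes *)

(** The weight w m A depends on the valuations of s_1, s_2, s_3 and not only on the index of A, so
    counting the subalgebras of sl_2 is not enough. Descent works because A' -> pi A' and A' ->
    theta_i A' raise all three valuations by 1, so that w (m + 1) of the image is q^3 times w m of
    A'. Thus m drops together with the index, and the row m = 0, where w is 1 on both sides, needs
    equations of its own. The image lies in all q + 1 Borel subalgebras or in exactly one, whatever
    beta(A') was; a weight g(beta) is therefore carried to g(q + 1) + (q + 1 - beta) g(1). Descent
    acts on the affine functions of beta, a space of dimension 2, whence the two eigenvectors.

    An algebra with exactly one unit s_i is reached from some A' only if its parent is pi A' or
    theta_i A'. The iterated parents of the others end at a Borel subalgebra of index q, and a
    recursion along these chains gives their number.

    The bound on p is 2 because both orthogonal bases and the splitting of the centre divide by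
    2. *)

Section FiniteSums.
Variable T : choiceType.
Implicit Types (P Q : set T).

Definition fin P := exists s : seq T, uniq s /\ forall x, x \in s <-> P x.

(* Empty when [P] is infinite: [ssum] and [csize] are then 0. *)
Definition enumS P : seq T :=
  if pselect (fin P) is left h then sval (cid h) else [::].

Definition ssum P (f : T -> int) : int := \sum_(x <- enumS P) f x.

Definition csize P := size (enumS P).

Lemma enumS_uniq P : uniq (enumS P).
Proof. by rewrite /enumS; case: pselect => // h; case: cid => s []. Qed.

Lemma enumSP P : fin P -> forall x, x \in enumS P <-> P x.
Proof. by move=> fP x; rewrite /enumS; case: pselect => // h; case: cid => s []. Qed.

Lemma fin_sub P Q : fin P -> (forall x, Q x -> P x) -> fin Q.
Proof.
move=> [s [us sP]] QP; exists [seq x <- s | `[< Q x >]].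
split; first exact: filter_uniq.
move=> x; rewrite mem_filter; split=> [/andP[/asboolP]//|Qx].
by apply/andP; split; [exact/asboolP|apply/sP/QP].
Qed.

(** The classes summed over below consist of subsets of infinite modules; such a class is finite as
    soon as an invariant with finitely many values separates its members. *)
Lemma fin_inj (I : finType) (f : T -> I) P :
  (forall x y, P x -> P y -> f x = f y -> x = y) -> fin P.
Proof.
move=> injf.
pose g (i : I) : option T :=
  if pselect (exists x, P x /\ f x = i) is left h then Some (sval (cid h)) else None.
exists (undup (pmap g (enum I))); split; first exact: undup_uniq.
move=> x; rewrite mem_undup mem_pmap; split.
  case/mapP => i _; rewrite /g; case: pselect => // h [->].
  by case: (cid h) => y [].
move=> Px; apply/mapP; exists (f x); first by rewrite mem_enum.
rewrite /g; case: pselect => [h|[]]; last by exists x.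
by case: (cid h) => y [Py e] /=; congr Some; apply: injf.
Qed.

Lemma ssum_ext P f g : (forall x, P x -> f x = g x) -> ssum P f = ssum P g.
Proof.
move=> fg; rewrite /ssum; apply: eq_big_seq => x; rewrite /enumS.
by case: pselect => // h; case: cid => s [us sP] /sP /fg.
Qed.

Lemma ssum_set P Q f : (forall x, P x <-> Q x) -> ssum P f = ssum Q f.
Proof. by move=> PQ; congr ssum; apply/funext => x; apply/propext. Qed.

Lemma ssum_seq P (s : seq T) f : uniq s -> (forall x, x \in s <-> P x) ->
  ssum P f = \sum_(x <- s) f x.
Proof.
move=> us sP; have fP : fin P by exists s.
rewrite /ssum; apply: perm_big; apply: uniq_perm => //; first exact: enumS_uniq.
by move=> x; apply/idP/idP => [/(enumSP fP)/sP|/sP/(enumSP fP)].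
Qed.

Lemma csizeE P : (csize P)%:Z = ssum P (fun=> 1).
Proof. by rewrite /csize /ssum big_const_seq count_predT; elim: size => //= n <-; lia. Qed.

Lemma ssum_split P Q f : fin P ->
  ssum P f = ssum (fun x => P x /\ Q x) f + ssum (fun x => P x /\ ~ Q x) f.
Proof.
move=> fP; rewrite {1}/ssum (bigID (fun x => `[< Q x >])) /=; congr (_ + _);
rewrite -big_filter; apply/esym/ssum_seq; first (exact/filter_uniq/enumS_uniq).
- move=> x; rewrite mem_filter; split=> [/andP[/asboolP ? /enumSP]|[/enumSP Px ?]]; first by split; auto.
  by apply/andP; split; [exact/asboolP|exact: Px].
- exact/filter_uniq/enumS_uniq.
- move=> x; rewrite mem_filter; split=> [/andP[/asboolP ? /enumSP]|[/enumSP Px ?]]; first by split; auto.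
  by apply/andP; split; [exact/asboolP|exact: Px].
Qed.

Lemma ssum_mulr P f c : ssum P (fun x => f x * c) = ssum P f * c.
Proof. by rewrite /ssum mulr_suml. Qed.

Lemma ssum_mull P f c : ssum P (fun x => c * f x) = c * ssum P f.
Proof. by rewrite /ssum mulr_sumr. Qed.

Lemma ssumD P f g : ssum P (fun x => f x + g x) = ssum P f + ssum P g.
Proof. by rewrite /ssum big_split. Qed.

Lemma ssum_const P c : ssum P (fun=> c) = (csize P)%:Z * c.
Proof. by rewrite csizeE -ssum_mulr; apply: ssum_ext => x _; rewrite mul1r. Qed.

Lemma ssum_mkcond P Q f : fin P ->
  ssum (fun x => P x /\ Q x) f = ssum P (fun x => if `[< Q x >] then f x else 0).
Proof.
move=> fP; rewrite [RHS](ssum_split Q) // [X in _ = _ + X](_ : _ = 0) ?addr0.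
  by apply: ssum_ext => x [_ /asboolP ->].
by rewrite (@ssum_ext _ _ (fun=> 0)) ?ssum_const ?mulr0 // => x [_ /asboolPn/negbTE ->].
Qed.

Lemma ssum_sum P (I : finType) (f : T -> I -> int) :
  ssum P (fun x => \sum_i f x i) = \sum_i ssum P (fun x => f x i).
Proof. by rewrite /ssum exchange_big. Qed.

Lemma csize_fin P (I : finType) (A : {pred I}) (g : I -> T) :
  (forall i, i \in A -> P (g i)) ->
  (forall x, P x -> exists2 i, i \in A & x = g i) ->
  (forall i j, i \in A -> j \in A -> g i = g j -> i = j) ->
  fin P /\ csize P = #|A|.
Proof.
move=> gP gs gi.
have us : uniq [seq g i | i <- enum A].
  by rewrite map_inj_in_uniq ?enum_uniq // => i j; rewrite !mem_enum; apply: gi.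
have sP x : x \in [seq g i | i <- enum A] <-> P x.
  split; first by case/mapP => i; rewrite mem_enum => iA ->; apply: gP.
  by case/gs => i iA ->; apply/mapP; exists i; rewrite ?mem_enum.
have fP : fin P by exists [seq g i | i <- enum A].
split=> //; rewrite cardE -(size_map g); apply: perm_size.
apply: uniq_perm => //; first exact: enumS_uniq.
by move=> x; apply/idP/idP => [/(enumSP fP)/sP|/sP/(enumSP fP)].
Qed.

Lemma csize_gt0P P : (0 < csize P)%N -> exists x, P x.
Proof.
rewrite /csize /enumS; case: pselect => // h; case: cid => -[//|x s] [_ sP] _.
by exists x; apply/sP; rewrite inE eqxx.
Qed.

Lemma csize0 P : (forall x, ~ P x) -> csize P = 0%N.
Proof.
by move=> P0; apply/eqP; rewrite -leqn0 leqNgt; apply/negP => /csize_gt0P[x /P0].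
Qed.

Lemma ssum0 P f : (forall x, ~ P x) -> ssum P f = 0.
Proof. by move=> P0; rewrite (@ssum_ext _ _ (fun=> 0)) ?ssum_const ?mulr0 // => x /P0. Qed.

End FiniteSums.

Lemma csize_set (T : choiceType) (P Q : set T) : (forall x, P x <-> Q x) -> csize P = csize Q.
Proof. by move=> PQ; congr csize; apply/funext => x; apply/propext. Qed.

(** Double counting: the summand at [x] is a sum over [Q] of an indicator of [p x = y], and the two
    sums are exchanged. The main case is the parent map, whose fibres have a computable size. *)
Lemma ssum_fiber (T U : choiceType) (P : set T) (Q : set U) (p : T -> U)
    (f : T -> int) (g : U -> int) (d : U -> nat) : fin P -> fin Q ->
  (forall x, P x -> Q (p x) /\ f x = g (p x)) ->
  (forall y, Q y -> csize (fun x => P x /\ p x = y) = d y) ->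
  ssum P f = ssum Q (fun y => (d y)%:Z * g y).
Proof.
move=> fP fQ pP dQ.
have -> : ssum P f = ssum P (fun x => \sum_(y <- enumS Q) (if `[< p x = y >] then g y else 0)).
  apply: ssum_ext => x Px; have [Qpx ->] := pP x Px.
  have pxs : p x \in enumS Q by apply/enumSP.
  rewrite (big_rem _ pxs) /= asboolT // big_seq big1 ?addr0 // => y.
  by rewrite mem_rem_uniq ?enumS_uniq // inE => /andP[/eqP ne _]; rewrite asboolF // => /esym.
rewrite {1}/ssum exchange_big; apply: eq_big_seq => y /(enumSP fQ) Qy /=.
by rewrite -[LHS](ssum_mkcond (fun x => p x = y) (fun=> g y) fP) ssum_const dQ.
Qed.

Lemma ssum_reindex (T U : choiceType) (P : set T) (Q : set U) (h : U -> T)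
    (f : T -> int) : fin P -> fin Q ->
  (forall y, Q y -> P (h y)) -> (forall x, P x -> exists2 y, Q y & x = h y) ->
  (forall y z, Q y -> Q z -> h y = h z -> y = z) ->
  ssum P f = ssum Q (fun y => f (h y)).
Proof.
move=> fP fQ hP hs hi.
rewrite [RHS](_ : _ = \sum_(x <- map h (enumS Q)) f x); last by rewrite big_map.
apply: ssum_seq.
  rewrite map_inj_in_uniq ?enumS_uniq // => y z /(enumSP fQ) Qy /(enumSP fQ) Qz.
  exact: hi.
move=> x; split; first by case/mapP => y /(enumSP fQ) Qy ->; apply: hP.
by case/hs => y Qy ->; apply/mapP; exists y => //; apply/enumSP.
Qed.


(** * Submodules and their indices *)

Section Submodules.
Variables (R : comNzRingType) (V : lmodType R).
Implicit Types (A B C : set V).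

Definition submod A :=
  [/\ A 0, (forall x y, A x -> A y -> A (x + y)) & forall (r : R) x, A x -> A (r *: x)].

(** The index as the size of a transversal, so that no quotient module has to be formed. *)
Definition relidx A B n := exists f : 'I_n -> V,
  [/\ forall i, A (f i), forall x, A x -> exists i, B (x - f i)
    & forall i j, B (f i - f j) -> i = j].

Lemma submodB A x y : submod A -> A x -> A y -> A (x - y).
Proof. by case=> _ AD AZ Ax Ay; apply: AD => //; rewrite -scaleN1r; apply: AZ. Qed.

Lemma submodN A x : submod A -> A (- x) -> A x.
Proof. by case=> _ _ AZ /(AZ (-1)); rewrite scaleN1r opprK. Qed.

Lemma submodBC A x y : submod A -> A (x - y) -> A (y - x).
Proof. by move=> sA H; apply: submodN => //; rewrite opprB. Qed.

Lemma submodBB A x y z : submod A -> A (x - y) -> A (x - z) -> A (y - z).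
Proof.
by move=> sA xy xz; have := submodB sA xz xy; rewrite opprB addrC addrA subrK.
Qed.

Lemma submodDE A x y : submod A -> A (x - y) -> (A x <-> A y).
Proof.
move=> sA H; split=> [Ax|Ay]; last by rewrite -(subrK y x); case: (sA) => _ D _; apply: D.
by rewrite -(subKr x y); apply: submodB.
Qed.

Lemma relidx_fin A B (I : finType) (f : I -> V) :
  (forall i, A (f i)) -> (forall x, A x -> exists i, B (x - f i)) ->
  (forall i j, B (f i - f j) -> i = j) -> relidx A B #|I|.
Proof.
move=> fA fs fi; exists (fun i => f (enum_val i)); split=> //.
- by move=> x /fs[i Bi]; exists (enum_rank i); rewrite enum_rankK.
- by move=> i j /fi /enum_val_inj.
Qed.

Lemma relidx_leq A B n m : submod B -> relidx A B n -> relidx A B m -> (n <= m)%N.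
Proof.
move=> sB [f [fA _ fi]] [g [gA gs _]].
have /choice[h hP] : forall i, exists j, B (f i - g j) by move=> i; apply/gs/fA.
have hi : injective h.
  move=> i j e; apply: fi; apply: (@submodBB _ (g (h i))) => //; apply: submodBC => //.
  by rewrite e.
by have := leq_card h hi; rewrite !card_ord.
Qed.

Lemma relidx_uniq A B n m : submod B -> relidx A B n -> relidx A B m -> n = m.
Proof.
by move=> sB H K; apply/eqP; rewrite eqn_leq (relidx_leq sB H K) (relidx_leq sB K H).
Qed.

Lemma relidx_tower A B C n m : submod A -> submod B -> submod C ->
  (forall x, B x -> A x) -> (forall x, C x -> B x) ->
  relidx A B n -> relidx B C m -> relidx A C (n * m).
Proof.
move=> sA sB sC BA CB [f [fA fs fi]] [g [gB gs gi]].
have -> : (n * m)%N = #|{: 'I_n * 'I_m}| by rewrite card_prod !card_ord.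
apply: (@relidx_fin _ _ _ (fun p : 'I_n * 'I_m => f p.1 + g p.2)).
- by move=> [i j] /=; case: sA => _ D _; apply: D => //; apply: BA.
- by move=> x /fs[i /gs[j Cij]]; exists (i, j); rewrite /= opprD addrA.
- move=> [i j] [i' j'] /= H.
  have ii' : i = i'.
    apply: fi; apply/(submodDE (y := f i + g j - (f i' + g j')) sB); last exact: CB.
    rewrite [X in B X](_ : _ = g j' - g j); first exact: submodB.
    by rewrite (opprD (f i')) (addrACA (f i)) opprD addrA subrr add0r opprB.
  by move: H; rewrite ii' opprD addrACA subrr add0r => /gi ->.
Qed.

(** Transversals of C and of B in A are matched by a map that is injective, hence bijective. The
    representatives modulo C of some x in B and of 0 both lie in B, so they are matched with
    elements of one class modulo B and coincide. *)
Lemma relidx_eq A B C n : submod A -> submod B -> submod C -> (forall x, B x -> A x) ->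
  (forall x, C x -> B x) -> relidx A C n -> relidx A B n -> forall x, B x <-> C x.
Proof.
move=> sA sB sC BA CB [f [fA fs fi]] [g [gA gs gi]] x; split; last exact: CB.
have /choice[h hP] : forall i, exists j, C (g i - f j) by move=> i; apply/fs/gA.
have hi : injective h.
  move=> i j e; apply: gi; apply: (@submodBB _ (f (h i))) => //; apply: submodBC => //.
    exact: CB.
  by rewrite e; apply: CB.
have [k hK kK] := injF_bij hi.
move=> Bx; have [i Ci] := fs _ (BA _ Bx); have [j Cj] := fs 0 (let: And3 a _ _ := sA in a).
have Bi : B (f i) by apply/(submodDE (x := x) sB) => //; exact: CB.
have Bj : B (f j) by apply/(submodDE (x := 0) sB); [exact: CB|case: sB].
suff ij : i = j.
  by apply/(submodDE (y := f i) sC) => //; rewrite ij; apply/(submodDE (x := 0) sC) => //; case: sC.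
rewrite -(kK i) -(kK j); congr h; apply: gi.
have Bk l : B (f l) -> B (g (k l)).
  by move=> Bl; apply/(submodDE (y := f l) sB) => //; apply: CB; rewrite -{2}(kK l).
by apply: submodB => //; apply: Bk.
Qed.

Lemma relidx_full A n : submod A -> (0 < n)%N -> relidx A A n -> n = 1%N.
Proof.
move=> sA n0 H; apply: (relidx_uniq sA H).
exists (fun=> 0); split=> [_|x Ax|i j _]; first by case: sA.
  by exists ord0; rewrite subr0.
by rewrite !ord1.
Qed.

Lemma relidx_self A : submod A -> relidx A A 1.
Proof.
move=> sA; exists (fun=> 0); split=> [_|x Ax|i j _]; first by case: sA.
  by exists ord0; rewrite subr0.
by rewrite !ord1.
Qed.

Lemma submodT : submod setT.
Proof. by split. Qed.

End Submodules.

Lemma relidx_inj (R : comNzRingType) (V W : lmodType R) (h : V -> W) (A B : set V)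
    (A' B' : set W) n :
  (forall x y, h (x - y) = h x - h y) -> (forall x, A x -> A' (h x)) ->
  (forall y, A' y -> exists2 x, A x & y = h x) -> (forall x, B' (h x) <-> B x) ->
  relidx A B n -> relidx A' B' n.
Proof.
move=> hB hA hs hBB [f [fA fs fi]]; exists (fun i => h (f i)); split.
- by move=> i; apply: hA.
- by move=> y /hs[x Ax ->]; have [i Bi] := fs x Ax; exists i; rewrite -hB; apply/hBB.
- by move=> i j; rewrite -hB => /hBB /fi.
Qed.

Section ProductIndex.
Variables (R : comNzRingType) (V W : lmodType R) (U : set (V * W)%type).
Hypothesis sU : submod U.

Definition psub1 : set V := fun x => U (x, 0).
Definition pproj2 : set W := fun y => exists x, U (x, y).

Lemma psub1_submod : submod psub1.
Proof.
case: sU => U0 UD UZ; split=> // [x y Ux Uy|r x Ux].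
  by have := UD _ _ Ux Uy; rewrite /psub1 -[(0 : W) in X in _ -> X](addr0 0).
by have := UZ r _ Ux; rewrite /psub1 -[(0 : W) in X in _ -> X](scaler0 _ r).
Qed.

Lemma pproj2_submod : submod pproj2.
Proof.
case: sU => U0 UD UZ; split=> [|y y' [x Ux] [x' Ux']|r y [x Ux]]; first by exists 0.
  by exists (x + x'); apply: (UD _ _ Ux Ux').
by exists (r *: x); apply: (UZ r _ Ux).
Qed.

(** U is an extension of its projection to the second factor by its intersection with the first, and
    the index is multiplicative along this extension. *)
Lemma relidx_prod n m : relidx setT psub1 n -> relidx setT pproj2 m ->
  relidx setT U (n * m).
Proof.
move=> [f [_ fs fi]] [g [_ gs gi]].
have -> : (n * m)%N = #|{: 'I_n * 'I_m}| by rewrite card_prod !card_ord.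
apply: (@relidx_fin _ _ _ _ _ (fun p : 'I_n * 'I_m => (f p.1, g p.2))) => //.
- move=> [x y] _; have [j [x' Uj]] := gs y I; have [i Ui] := fs (x - x') I.
  exists (i, j); case: sU => _ D _; have := D _ _ Uj Ui.
  by congr U; congr pair; rewrite ?addr0 //= addrA [x' + _]addrC subrK.
- move=> [i j] [i' j'] H; have jj' : j = j' by apply: gi; exists (f i - f i').
  by move: H; rewrite jj' => H; rewrite (fi i i') // /psub1 -(subrr (g j')).
Qed.

End ProductIndex.


(** * Discrete valuation rings with finite residue field of odd characteristic *)

(** The residue field is a finite field type with a set-theoretic section [rlift] of the reduction,
    so that statements modulo pi become computations in a field. *)
Record dvr := Dvr {
  dring :> idomainType;
  unif : dring;
  resF : finFieldType;
  res : {rmorphism dring -> resF};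
  rlift : resF -> dring;
  rliftK : cancel rlift res;
  res_eq0 : forall x, res x = 0 <-> exists r, x = unif * r;
  unif_neq0 : unif != 0;
  dvrP : forall x, x != 0 -> exists (u : dring) n, u \is a GRing.unit /\ x = u * unif ^+ n;
  two_res : (2%:R : resF) != 0
}.

Section Dvr.
Variable D : dvr.
Local Notation pi := (unif D).
Local Notation F := (resF D).
Local Notation q := #|resF D|.
Implicit Types (x y r u : D).

Definition pdvd n x := exists r, x = pi ^+ n * r.

Lemma res_unif : res D pi = 0.
Proof. by apply/res_eq0; exists 1; rewrite mulr1. Qed.

Lemma resP x : (res D x = 0) <-> pdvd 1 x.
Proof. by rewrite res_eq0 /pdvd expr1. Qed.

Lemma unit_resE x : (x \is a GRing.unit) = (res D x != 0).
Proof.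
apply/idP/idP => [ux|].
  apply/eqP => x0; have := rmorph1 (res D); rewrite -(divrr ux) rmorphM /= x0 mul0r.
  by move/eqP; rewrite eq_sym oner_eq0.
have [->|x0] := eqVneq x 0; first by rewrite rmorph0 eqxx.
have [u [[|n] [uu ->]]] := dvrP x0; first by rewrite mulr1.
by rewrite exprS mulrCA rmorphM /= res_unif mul0r eqxx.
Qed.

Lemma two_unit : (2%:R : D) \is a GRing.unit.
Proof. by rewrite unit_resE rmorph_nat two_res. Qed.

Lemma two_neq0 : (2%:R : D) != 0.
Proof. by apply/eqP => e; have := two_unit; rewrite e unitr0. Qed.

Lemma pow_unif_neq0 n : pi ^+ n != 0.
Proof. by rewrite expf_neq0 // unif_neq0. Qed.

Lemma pdvd0 n : pdvd n 0.
Proof. by exists 0; rewrite mulr0. Qed.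

Lemma pdvd_pow n : pdvd n (pi ^+ n).
Proof. by exists 1; rewrite mulr1. Qed.

Lemma pdvd_0n x : pdvd 0 x.
Proof. by exists x; rewrite mul1r. Qed.

Lemma pdvdD n x y : pdvd n x -> pdvd n y -> pdvd n (x + y).
Proof. by move=> [r ->] [s ->]; exists (r + s); rewrite mulrDr. Qed.

Lemma pdvdM n r x : pdvd n x -> pdvd n (r * x).
Proof. by move=> [s ->]; exists (r * s); rewrite mulrCA. Qed.

Lemma pdvdMr n r x : pdvd n x -> pdvd n (x * r).
Proof. by rewrite mulrC; apply: pdvdM. Qed.

Lemma pdvdN n x : pdvd n x -> pdvd n (- x).
Proof. by move=> [s ->]; exists (- s); rewrite mulrN. Qed.

Lemma pdvdB n x y : pdvd n x -> pdvd n y -> pdvd n (x - y).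
Proof. by move=> ? /pdvdN; apply: pdvdD. Qed.

Lemma pdvd_leq n m x : (n <= m)%N -> pdvd m x -> pdvd n x.
Proof. by move=> nm [r ->]; exists (pi ^+ (m - n) * r); rewrite mulrA -exprD subnKC. Qed.

Lemma pdvdMM n m x y : pdvd n x -> pdvd m y -> pdvd (n + m) (x * y).
Proof. by move=> [r ->] [s ->]; exists (r * s); rewrite exprD mulrACA. Qed.

Lemma pdvd_mulI n m x : pdvd (n + m) (pi ^+ n * x) -> pdvd m x.
Proof.
move=> [r]; rewrite exprD -mulrA => /(mulfI (pow_unif_neq0 n)) ->.
by exists r.
Qed.

Lemma pdvd_unitM u n x : u \is a GRing.unit -> pdvd n (u * x) <-> pdvd n x.
Proof.
move=> uu; split=> [/(pdvdM u^-1)|/(pdvdM u)//].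
by rewrite mulrA mulVr // mul1r.
Qed.

Lemma pdvd_unit u n m : u \is a GRing.unit -> pdvd m (u * pi ^+ n) -> (m <= n)%N.
Proof.
move=> uu /(pdvd_unitM _ _ uu) H; rewrite leqNgt; apply/negP => nm.
have : pdvd (n + 1) (pi ^+ n * 1) by rewrite mulr1; apply: pdvd_leq H; rewrite addn1.
by move/pdvd_mulI/resP; rewrite rmorph1 => /eqP; rewrite oner_eq0.
Qed.

Lemma submod_idl n : submod (pdvd n : set D^o).
Proof. by split=> [|x y|r x]; [exact: pdvd0|exact: pdvdD|exact: pdvdM]. Qed.

Lemma one_sub_pow n : (0 < n)%N -> (1 - pi ^+ n) \is a GRing.unit.
Proof.
by case: n => // n _; rewrite unit_resE rmorphB rmorph1 rmorphXn /= res_unif expr0n subr0 oner_eq0.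
Qed.

(** Among x, pi x, ..., pi^n x two are congruent modulo U, and their difference is the unit 1 -
    pi^(j-i) times pi^i x. The exponent n is crude but suffices. *)
Lemma relidx_pow (V : lmodType D) (U : set V) n : submod U -> relidx setT U n ->
  forall x : V, U (pi ^+ n *: x).
Proof.
move=> sU [f [_ fs fi]] x; have [_ _ UZ] := sU.
have /choice[h hP] : forall i : 'I_n.+1, exists j, U (pi ^+ i *: x - f j) by move=> i; apply: fs.
have [i [j [ij eij]]] : exists i j : 'I_n.+1, (i < j)%N /\ h i = h j.
  apply: contrapT => H; have hi : injective h.
    move=> i j eij; apply/val_inj; case: (ltngtP i j) => // lt; case: H.
      by exists i, j.
    by exists j, i.
  by have := leq_card h hi; rewrite !card_ord ltnn.
have : U ((1 - pi ^+ (j - i)) *: (pi ^+ i *: x)).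
  rewrite scalerA mulrBl mul1r -exprD subnK ?(ltnW ij) // scalerBl.
  by apply: (@submodBB _ _ _ (f (h i))) => //; apply: submodBC; rewrite // eij.
move/(UZ (1 - pi ^+ (j - i))^-1); rewrite scalerA mulVr ?scale1r ?one_sub_pow ?subn_gt0 //.
move/(UZ (pi ^+ (n - i))); rewrite scalerA -exprD subnK //.
by have := ltn_ord i; rewrite ltnS.
Qed.

Lemma relidx_unif n : relidx (pdvd n : set D^o) (pdvd n.+1) q.
Proof.
apply: (@relidx_fin D D^o (pdvd n) (pdvd n.+1) (resF D) (fun a => pi ^+ n * rlift a : D^o)) => [a|x [r ->]|a b].
- by exists (rlift a).
- exists (res D r); have /resP[s e] : res D (r - rlift (res D r)) = 0.
    by rewrite rmorphB /= rliftK subrr.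
  by exists s; rewrite -mulrBr e expr1 exprSr mulrA.
- rewrite -mulrBr -addn1 => /pdvd_mulI /resP /eqP.
  by rewrite rmorphB /= !rliftK subr_eq0 => /eqP.
Qed.

Lemma relidx_idl n : relidx setT (pdvd n : set D^o) (q ^ n).
Proof.
elim: n => [|n IH].
  have -> : (pdvd 0 : set D^o) = setT by apply/funext => x; apply/propext; split=> // _; exact: pdvd_0n.
  exact: relidx_self (submodT _).
rewrite expnSr; apply: relidx_tower (IH) (relidx_unif n) => //; try exact: submod_idl; try exact: submodT.
by move=> x; apply: pdvd_leq.
Qed.

Lemma ideal_class (I : set D^o) N : submod I -> I (pi ^+ N) ->
  exists k, forall x, I x <-> pdvd k x.
Proof.
move=> sI IN; have [_ ID IZ] := sI.
have [k] : exists k, I (pi ^+ k) /\ forall j, I (pi ^+ j) -> (k <= j)%N.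
  have ex : exists k, `[< I (pi ^+ k) >] by exists N; apply/asboolP.
  by case: (ex_minnP ex) => k /asboolP Ik mk; exists k; split=> // j Ij; apply: mk; apply/asboolP.
case=> Ik mk; exists k => x; split; last first.
  by move=> [r ->]; rewrite mulrC; apply: IZ.
have [->|x0] := eqVneq x 0; first by move=> _; exact: pdvd0.
have [u [n [uu ->]]] := dvrP x0.
move/(IZ u^-1); rewrite /GRing.scale /= mulrA mulVr // mul1r => /mk kn.
by apply: pdvdM; apply: pdvd_leq kn (pdvd_pow n).
Qed.

End Dvr.

(** * The Lie algebra of traceless matrices in coordinates *)

(* The triple [(a, b, c)] stands for [a e + b h + c f]. *)
Definition sl2 (R : comNzRingType) : Type := (R^o * R^o * R^o)%type.
HB.instance Definition _ (R : comNzRingType) := GRing.Lmodule.on (sl2 R).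

Section Coordinates.
Variable R : comNzRingType.
Implicit Types x y : sl2 R.

Lemma sl2P x y : x.1.1 = y.1.1 -> x.1.2 = y.1.2 -> x.2 = y.2 -> x = y.
Proof. by case: x y => [[x1 x2] x3] [[y1 y2] y3] /= -> -> ->. Qed.

Lemma add1 x y : (x + y).1.1 = x.1.1 + y.1.1 :> R.
Proof. by []. Qed.
Lemma add2 x y : (x + y).1.2 = x.1.2 + y.1.2 :> R.
Proof. by []. Qed.
Lemma add3 x y : (x + y).2 = x.2 + y.2 :> R.
Proof. by []. Qed.
Lemma opp1 x : (- x).1.1 = - x.1.1 :> R.
Proof. by []. Qed.
Lemma opp2 x : (- x).1.2 = - x.1.2 :> R.
Proof. by []. Qed.
Lemma opp3 x : (- x).2 = - x.2 :> R.
Proof. by []. Qed.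
Lemma scl1 r x : (r *: x).1.1 = r * x.1.1 :> R.
Proof. by []. Qed.
Lemma scl2 r x : (r *: x).1.2 = r * x.1.2 :> R.
Proof. by []. Qed.
Lemma scl3 r x : (r *: x).2 = r * x.2 :> R.
Proof. by []. Qed.
Lemma zero1 : (0 : sl2 R).1.1 = 0 :> R.
Proof. by []. Qed.
Lemma zero2 : (0 : sl2 R).1.2 = 0 :> R.
Proof. by []. Qed.
Lemma zero3 : (0 : sl2 R).2 = 0 :> R.
Proof. by []. Qed.

End Coordinates.

(* Rewriting the coordinates of linear combinations by conversion is much faster
   than rewriting with the equations above. *)
Ltac chg t e := match type of e with @eq _ _ ?r => change t with r end.
Ltac crd := repeat match goal with
  | |- context [fst (fst (@Algebra.add ?M ?x ?y))] => let t := constr:(fst (fst (@Algebra.add M x y))) in let e := constr:(add1 x y) in chg t e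
  | |- context [snd (fst (@Algebra.add ?M ?x ?y))] => let t := constr:(snd (fst (@Algebra.add M x y))) in let e := constr:(add2 x y) in chg t e
  | |- context [snd (@Algebra.add ?M ?x ?y)] => let t := constr:(snd (@Algebra.add M x y)) in let e := constr:(add3 x y) in chg t e
  | |- context [fst (fst (@Algebra.opp ?M ?x))] => let t := constr:(fst (fst (@Algebra.opp M x))) in let e := constr:(opp1 x) in chg t e
  | |- context [snd (fst (@Algebra.opp ?M ?x))] => let t := constr:(snd (fst (@Algebra.opp M x))) in let e := constr:(opp2 x) in chg t e
  | |- context [snd (@Algebra.opp ?M ?x)] => let t := constr:(snd (@Algebra.opp M x)) in let e := constr:(opp3 x) in chg t e
  | |- context [fst (fst (@GRing.scale ?S ?M ?r ?x))] => let t := constr:(fst (fst (@GRing.scale S M r x))) in let e := constr:(scl1 r x) in chg t e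
  | |- context [snd (fst (@GRing.scale ?S ?M ?r ?x))] => let t := constr:(snd (fst (@GRing.scale S M r x))) in let e := constr:(scl2 r x) in chg t e
  | |- context [snd (@GRing.scale ?S ?M ?r ?x)] => let t := constr:(snd (@GRing.scale S M r x)) in let e := constr:(scl3 r x) in chg t e
  | |- context [fst (fst (@Algebra.zero ?M))] => let e := constr:(zero1 _ : fst (fst (@Algebra.zero M)) = _) in chg (fst (fst (@Algebra.zero M))) e
  | |- context [snd (fst (@Algebra.zero ?M))] => let e := constr:(zero2 _ : snd (fst (@Algebra.zero M)) = _) in chg (snd (fst (@Algebra.zero M))) e
  | |- context [snd (@Algebra.zero ?M)] => let e := constr:(zero3 _ : snd (@Algebra.zero M) = _) in chg (snd (@Algebra.zero M)) e
  end.

Ltac vec := apply: sl2P; crd; rewrite /=; ring.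

(** * Hermite bases of submodules of sl_2 *)

Section TriangularBasis.
Variable D : dvr.
Local Notation pi := (unif D).
Local Notation q := #|resF D|.
Local Notation L := (sl2 D).

Definition span3 (v1 v2 v3 : L) : set L :=
  fun x => exists r1 r2 r3 : D, x = r1 *: v1 + r2 *: v2 + r3 *: v3.

Lemma span3_submod v1 v2 v3 : submod (span3 v1 v2 v3).
Proof.
split.
- by exists 0, 0, 0; rewrite !scale0r !addr0.
- move=> x y [a1 [a2 [a3 ->]]] [b1 [b2 [b3 ->]]]; exists (a1 + b1), (a2 + b2), (a3 + b3).
  by rewrite !scalerDl (addrACA (_ + _)) (addrACA (_ *: _)).
- move=> r x [a1 [a2 [a3 ->]]]; exists (r * a1), (r * a2), (r * a3).
  by rewrite !scalerDr !scalerA.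
Qed.

Lemma submod_span3 (A : set L) v1 v2 v3 x : submod A -> A v1 -> A v2 -> A v3 ->
  span3 v1 v2 v3 x -> A x.
Proof. by move=> sA A1 A2 A3 [r1 [r2 [r3 ->]]]; case: sA => _ AD AZ; do 2?[apply: (AD)]; apply: AZ. Qed.

Definition det3 (x y z : L) : D :=
  x.1.1 * (y.1.2 * z.2 - y.2 * z.1.2) - x.1.2 * (y.1.1 * z.2 - y.2 * z.1.1)
  + x.2 * (y.1.1 * z.1.2 - y.1.2 * z.1.1).

(** Hermite normal form: A is filtered by its coordinates, and each graded piece is an ideal
    generated by a power of pi. The hypothesis is on pi^n L instead of the index, so that the lemma
    applies to preimages and parents whose index is still to be found. *)
Lemma triangular_basis_pow (A : set L) n : submod A -> (forall x, A (pi ^+ n *: x)) ->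
  exists k v1 v2 v3, [/\ relidx setT A (q ^ k), det3 v1 v2 v3 = pi ^+ k
    & forall x, A x <-> span3 v1 v2 v3 x].
Proof.
move=> sA Api; have [A0 AD AZ] := sA.
pose A1 := psub1 (A : set ((D^o * D^o) * D^o)%type).
have sA1 : submod A1 := psub1_submod sA.
pose A2 := pproj2 (A : set ((D^o * D^o) * D^o)%type).
have sA2 : submod A2 := pproj2_submod sA.
have [l lP] : exists l, forall x, A2 x <-> pdvd l x.
  apply: (@ideal_class D A2 n) => //; exists (0, 0).
  have := Api (0, 0, 1); congr A; congr pair; last exact: mulr1.
  by congr pair; exact: mulr0.
have sB1 : submod (psub1 A1) := psub1_submod sA1.
have sB2 : submod (pproj2 A1) := pproj2_submod sA1.
have [j jP] : exists j, forall x, pproj2 A1 x <-> pdvd j x.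
  apply: (@ideal_class D _ n) => //; exists 0.
  have := Api (0, 1, 0); rewrite /A1 /psub1; congr A.
  by congr pair; [congr pair; [exact: mulr0|exact: mulr1]|exact: mulr0].
have [i iP] : exists i, forall x, psub1 A1 x <-> pdvd i x.
  apply: (@ideal_class D _ n) => //.
  have := Api (1, 0, 0); rewrite /A1 /psub1; congr A.
  by congr pair; [congr pair; [exact: mulr1|exact: mulr0]|exact: mulr0].
have [w wP] := (lP (pi ^+ l)).2 (pdvd_pow D l).
have [x xP] := (jP (pi ^+ j)).2 (pdvd_pow D j).
have zP := (iP (pi ^+ i)).2 (pdvd_pow D i).
have eqset (T : Type) (P Q : set T) : (forall x, P x <-> Q x) -> P = Q.
  by move=> PQ; apply/funext => y; apply/propext.
exists (i + j + l)%N, (pi ^+ i, 0, 0), (x, pi ^+ j, 0), (w, pi ^+ l); split.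
- rewrite expnD; apply: relidx_prod => //; last first.
    by rewrite (_ : pproj2 _ = (pdvd l : set D^o)) //; [exact: relidx_idl|exact: eqset].
  rewrite expnD; apply: relidx_prod => //.
    by rewrite (_ : psub1 _ = (pdvd i : set D^o)) //; [exact: relidx_idl|exact: eqset].
  by rewrite (_ : pproj2 _ = (pdvd j : set D^o)) //; [exact: relidx_idl|exact: eqset].
- by rewrite /det3 /= !exprD; ring.
move=> [y y3]; split; last first.
  by apply: submod_span3.
move=> Ay; have [r3 e3] := (lP y3).1 (ex_intro _ y Ay).
have := submodB sA Ay (AZ r3 _ wP).
have -> : ((y, y3) : L) - r3 *: ((w, pi ^+ l) : L) = (y - r3 *: w, 0) :> L.
  by congr pair; rewrite /= e3 /GRing.scale /= mulrC subrr.
case ez: (y - r3 *: w) => [z1 z2] Az.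
have [r2 e2] := (jP z2).1 (ex_intro _ z1 Az).
have := submodB sA Az (AZ r2 _ xP).
have -> : ((z1, z2, 0) : L) - r2 *: ((x, pi ^+ j, 0) : L) = (z1 - r2 * x, 0, 0) :> L.
  congr pair; first congr pair; rewrite /GRing.scale /=.
    by rewrite /= e2 mulrC subrr.
  by rewrite scaler0 subr0.
move=> Az1; have [r1 e1] := (iP _).1 Az1.
exists r1, r2, r3.
have ey : y = (z1, z2) + r3 *: w by rewrite -ez subrK.
have e1' : z1 = pi ^+ i * r1 + r2 * x by rewrite -e1 subrK.
by apply: sl2P; crd; rewrite /= ?ey /= ?e3 ?e2 ?e1' /GRing.scale /=; ring.
Qed.

Lemma triangular_basis (A : set L) n : submod A -> relidx setT A n ->
  exists k v1 v2 v3, [/\ n = (q ^ k)%N, det3 v1 v2 v3 = pi ^+ k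
    & forall x, A x <-> span3 v1 v2 v3 x].
Proof.
move=> sA iA; have [k [v1 [v2 [v3 [iA' d Av]]]]] := triangular_basis_pow sA (relidx_pow sA iA).
by exists k, v1, v2, v3; split=> //; apply: relidx_uniq iA iA'.
Qed.

End TriangularBasis.


(** * The bracket, the trace form and the norm *)

Section LieBracket.
Variable R : comNzRingType.
Implicit Types (x y z : sl2 R) (r : R).

Definition br x y : sl2 R :=
  (2%:R * (x.1.2 * y.1.1 - x.1.1 * y.1.2), x.1.1 * y.2 - x.2 * y.1.1,
   2%:R * (x.2 * y.1.2 - x.1.2 * y.2)).

(* The trace form and minus the determinant: [Bf] is the polar form of [Nm]. *)
Definition Bf x y : R := x.1.1 * y.2 + x.2 * y.1.1 + 2%:R * (x.1.2 * y.1.2).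
Definition Nm x : R := x.1.1 * x.2 + x.1.2 ^+ 2.

Lemma NmD x y : Nm (x + y) = Nm x + Nm y + Bf x y.
Proof. by rewrite /Nm /Bf; crd; ring. Qed.
Lemma NmZ r x : Nm (r *: x) = r ^+ 2 * Nm x.
Proof. by rewrite /Nm; crd; ring. Qed.
Lemma Bfxx x : Bf x x = 2%:R * Nm x.
Proof. by rewrite /Nm /Bf; ring. Qed.
Lemma BfC x y : Bf x y = Bf y x.
Proof. by rewrite /Bf; ring. Qed.
Lemma BfDl x y z : Bf (x + y) z = Bf x z + Bf y z.
Proof. by rewrite /Bf; crd; ring. Qed.
Lemma BfZl r x z : Bf (r *: x) z = r * Bf x z.
Proof. by rewrite /Bf; crd; ring. Qed.
Lemma BfDr x y z : Bf z (x + y) = Bf z x + Bf z y.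
Proof. by rewrite /Bf; crd; ring. Qed.
Lemma BfZr r x z : Bf z (r *: x) = r * Bf z x.
Proof. by rewrite /Bf; crd; ring. Qed.
Definition BfE := (BfDl, BfZl, BfDr, BfZr).
Lemma brDl x y z : br (x + y) z = br x z + br y z.
Proof. by rewrite /br; vec. Qed.
Lemma brZl r x z : br (r *: x) z = r *: br x z.
Proof. by rewrite /br; vec. Qed.
Lemma brDr x y z : br z (x + y) = br z x + br z y.
Proof. by rewrite /br; vec. Qed.
Lemma brZr r x z : br z (r *: x) = r *: br z x.
Proof. by rewrite /br; vec. Qed.
Definition brE := (brDl, brZl, brDr, brZr).
Lemma brxx x : br x x = 0.
Proof. by rewrite /br; vec. Qed.
Lemma brC x y : br x y = - br y x.
Proof. by rewrite /br; vec. Qed.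
Lemma Bf_br_l x y : Bf x (br x y) = 0.
Proof. by rewrite /br /Bf /=; ring. Qed.
Lemma Bf_br_r x y : Bf y (br x y) = 0.
Proof. by rewrite /br /Bf /=; ring. Qed.
(** The analogue of the triple product identity for cross products; it converts orthogonality for
    [Bf] into information on brackets. *)
Lemma br_br x y z : br x (br y z) = (2%:R * Bf x y) *: z - (2%:R * Bf x z) *: y.
Proof. by rewrite /br /Bf; vec. Qed.
Lemma Nm_br x y : Nm (br x y) = Bf x y ^+ 2 - 4%:R * (Nm x * Nm y).
Proof. by rewrite /br /Bf /Nm /=; ring. Qed.

End LieBracket.

(** * Orthogonal bases and structure constants *)

Section Orthogonal.
Variable D : dvr.
Local Notation pi := (unif D).
Local Notation q := #|resF D|.
Local Notation L := (sl2 D).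
Implicit Types (A M : set L) (x y z v w : L).

Definition brclosed A := forall x y, A x -> A y -> A (br x y).

Definition Alg k : set (set L) :=
  fun A => [/\ submod A, brclosed A & relidx setT A (q ^ k)].

(* Orthogonality of the basis makes the bracket diagonal: the [s_i] are elementary
   divisors of [A, A] in A. *)
Record OB A v1 v2 v3 (s1 s2 s3 : D) : Prop := MkOB {
  ob_span : forall x, A x <-> span3 v1 v2 v3 x;
  ob_det : det3 v1 v2 v3 != 0;
  ob_12 : Bf v1 v2 = 0;
  ob_13 : Bf v1 v3 = 0;
  ob_23 : Bf v2 v3 = 0;
  ob_br1 : br v2 v3 = s1 *: v1;
  ob_br2 : br v3 v1 = s2 *: v2;
  ob_br3 : br v1 v2 = s3 *: v3 }.

Lemma det3_br x y z : Bf x (br y z) = - 2%:R * det3 x y z.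
Proof. by rewrite /Bf /br /det3 /=; ring. Qed.

Lemma cramer v1 v2 v3 w : det3 v1 v2 v3 *: w =
  det3 w v2 v3 *: v1 + det3 v1 w v3 *: v2 + det3 v1 v2 w *: v3.
Proof. by rewrite /det3; vec. Qed.

Lemma scale_eq0 (r : D) x : r *: x = 0 -> r = 0 \/ x = 0.
Proof.
move=> e; have [->|r0] := eqVneq r 0; [by left|right].
have h (a : D) : r * a = 0 -> a = 0 by move/eqP; rewrite mulf_eq0 (negbTE r0) => /eqP.
apply: sl2P; crd; apply: h.
- exact: (congr1 (fun x : L => x.1.1 : D) e).
- exact: (congr1 (fun x : L => x.1.2 : D) e).
- exact: (congr1 (fun x : L => x.2 : D) e).
Qed.

Lemma mul0 (a b : D) : a * b = 0 -> a != 0 -> b = 0.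
Proof. by move/eqP; rewrite mulf_eq0 => /orP[/eqP->|/eqP->//]; rewrite eqxx. Qed.

Lemma Bf_nondeg v1 v2 v3 z : det3 v1 v2 v3 != 0 ->
  Bf z v1 = 0 -> Bf z v2 = 0 -> Bf z v3 = 0 -> z = 0.
Proof.
move=> d0 z1 z2 z3.
have zw w : Bf z w = 0.
  by apply: (mul0 (a := det3 v1 v2 v3)) => //; rewrite -BfZr cramer !BfE z1 z2 z3 !mulr0 !addr0.
apply: sl2P; crd.
- by rewrite -(zw (0, 0, 1)) /Bf /=; ring.
- apply: (mul0 (a := 2%:R)); last exact: two_neq0.
  by rewrite -(zw (0, 1, 0)) /Bf /=; ring.
- by rewrite -(zw (1, 0, 0)) /Bf /=; ring.
Qed.

(** Gram-Schmidt has to divide by the norm of the pivot, so over a valuation ring the pivot is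
    chosen with norm of least valuation. *)
Lemma min_norm M x0 : M x0 -> Nm x0 != 0 ->
  exists v, [/\ M v, Nm v != 0 & forall x, M x -> exists r, Nm x = r * Nm v].
Proof.
move=> Mx0 N0.
pose P n := `[< exists x, M x /\ exists u, u \is a GRing.unit /\ Nm x = u * pi ^+ n >].
have ex : exists n, P n.
  by have [u [n [uu e]]] := dvrP N0; exists n; apply/asboolP; exists x0; split=> //; exists u.
case: (ex_minnP ex) => n /asboolP[v [Mv [u [uu Nv]]]] mn; exists v; split=> //.
  by rewrite Nv mulf_neq0 ?pow_unif_neq0 //; apply: contraTneq uu => ->; rewrite unitr0.
move=> x Mx; have [->|Nx] := eqVneq (Nm x) 0; first by exists 0; rewrite mul0r.
have [u' [m [uu' e]]] := dvrP Nx.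
have nm : (n <= m)%N by apply: mn; apply/asboolP; exists x; split=> //; exists u'.
exists (u' * u^-1 * pi ^+ (m - n)); rewrite e Nv -(subnK nm) addnK exprD.
by rewrite mulrACA -(mulrA u') mulVr // mulr1; ring.
Qed.

(** By polarization [Bf x v] is a multiple of [Nm v], so the projection coefficient, [Bf x v]
    divided by twice [Nm v], lies in the ring. *)
Lemma min_split M v x : submod M -> M v -> (forall y, M y -> exists r, Nm y = r * Nm v) ->
  M x -> exists r, M (x - r *: v) /\ Bf (x - r *: v) v = 0.
Proof.
move=> sM Mv mv Mx; have [M0 MD MZ] := sM.
have [a ea] := mv _ Mx; have [b eb] := mv _ (MD _ _ Mx Mv).
exists (2%:R^-1 * (b - a - 1)); split; first by apply: submodB => //; apply: MZ.
rewrite -scaleNr !BfE Bfxx.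
have -> : Bf x v = (b - a - 1) * Nm v by have := NmD x v; rewrite ea eb => e; rewrite !mulrBl e; ring.
by rewrite mulNr mulrACA mulVr ?two_unit // mul1r subrr.
Qed.

(** Gram-Schmidt with pivots of least norm. Once the basis is orthogonal, [br v1 v2] is orthogonal
    to [v1] and [v2], hence a multiple of [v3], and cyclically. *)
Lemma OB_exists A k : Alg k A -> exists v1 v2 v3 s1 s2 s3, OB A v1 v2 v3 s1 s2 s3.
Proof.
move=> [sA cA iA]; have [A0 AD AZ] := sA.
have [p p0 Ap] : exists2 p : D, p != 0 & forall x, A (p *: x).
  by exists (pi ^+ (q ^ k)); [exact: pow_unif_neq0|exact: relidx_pow sA iA].
have [v1 [A1 N1 m1]] : exists v, [/\ A v, Nm v != 0 & forall x, A x -> exists r, Nm x = r * Nm v].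
  apply: (@min_norm A (p *: (1, 0, 1))) => //.
  by rewrite NmZ (_ : Nm _ = 1) ?mulr1 ?expf_neq0 // /Nm /=; ring.
pose M2 : set L := fun x => A x /\ Bf x v1 = 0.
have sM2 : submod M2.
  split=> [|x y [Ax x1] [Ay y1]|r x [Ax x1]].
  - by split=> //; rewrite /Bf; crd; ring.
  - by split; [exact: AD|rewrite BfE x1 y1 addr0].
  - by split; [exact: AZ|rewrite BfE x1 mulr0].
have [v2 [[A2 v21] N2 m2]] : exists v, [/\ M2 v, Nm v != 0 & forall x, M2 x -> exists r, Nm x = r * Nm v].
  have [x Mx Nx] : exists2 x, M2 x & Nm x != 0.
    (* If the norm vanished on the complement of [v1], projecting x would give 4 Nm v1 Nm x = (Bf x
       v1)^2 for all x. For x = e, f and e + f this forces Nm v1 = 0. *)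
    apply: contrapT => H.
    have HN x : 4%:R * Nm v1 * Nm x = Bf x v1 ^+ 2.
      pose x' := p *: ((2%:R * Nm v1) *: x - Bf x v1 *: v1).
      have Mx' : M2 x'.
        by split; [exact: Ap|rewrite /x' -scaleNr !BfE Bfxx; ring].
      have Nx' : Nm x' = 0 by apply/eqP/negPn/negP => Nx'; apply: H; exists x'.
      apply/eqP; rewrite -subr_eq0; apply/eqP/(@mul0 (p ^+ 2 * Nm v1)); last by rewrite mulf_neq0 ?expf_neq0.
      by rewrite -Nx' /x' NmZ -scaleNr NmD !NmZ !BfE; ring.
    have sq0 (a : D) : 0 = a ^+ 2 -> a = 0 by move/esym/eqP; rewrite expf_eq0 => /eqP.
    have g0 : v1.2 = 0 :> D.
      apply: sq0; rewrite (_ : v1.2 = Bf (1, 0, 0) v1) -?HN /Nm /Bf /=; ring.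
    have a0 : v1.1.1 = 0 :> D.
      apply: sq0; rewrite (_ : v1.1.1 = Bf (0, 0, 1) v1) -?HN /Nm /Bf /=; ring.
    have : 2%:R * (2%:R * Nm v1) = 0.
      rewrite (_ : _ * _ = 4%:R * Nm v1 * Nm (1, 0, 1)); last by rewrite /Nm /=; ring.
      by rewrite HN /Bf /= g0 a0; ring.
    by move/mul0 => /(_ (two_neq0 D)) /mul0 => /(_ (two_neq0 D)) e1; rewrite e1 eqxx in N1.
  by apply: (min_norm Mx Nx).
pose M3 : set L := fun x => M2 x /\ Bf x v2 = 0.
have sM3 : submod M3.
  case: (sM2) => M20 M2D M2Z; split=> [|x y [Ax x1] [Ay y1]|r x [Ax x1]].
  - by split=> //; rewrite /Bf; crd; ring.
  - by split; [exact: M2D|rewrite BfE x1 y1 addr0].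
  - by split; [exact: M2Z|rewrite BfE x1 mulr0].
(* The bracket shows that the norm does not vanish on the complement of [v1] and [v2]: Nm n = - 4 Nm
   v1 Nm v2. *)
pose n := br v1 v2.
have Mn : M3 n.
  split; first split; first exact: cA.
    by rewrite BfC Bf_br_l.
  by rewrite BfC Bf_br_r.
have Nn : Nm n != 0.
  rewrite /n Nm_br BfC v21 expr0n /= sub0r oppr_eq0.
  by rewrite (_ : 4%:R = 2%:R * 2%:R) ?mulf_neq0 ?two_neq0 //; ring.
have [v3 [[[A3 v31] v32] N3 m3]] := min_norm Mn Nn.
(* As [v3] is orthogonal to [v1] and [v2], the triple product gives [br n v3 = 0]. Were [Bf n v3]
   zero as well, [br n (br n v3)] would be 4 Nm n times [v3]. *)
have nv3 : Bf n v3 != 0.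
  apply/eqP => e; have : br n (br n v3) = 0.
    rewrite (_ : br n v3 = 0); first by rewrite /br; vec.
    rewrite brC br_br v31 v32 !mulr0 !scale0r subrr; exact: oppr0.
  rewrite br_br e Bfxx mulr0 scale0r subr0 => /scale_eq0 [|e3].
    by move/mul0 => /(_ (two_neq0 D)) /mul0 => /(_ (two_neq0 D)) /eqP; apply/negP.
  by move: N3; rewrite e3 /Nm; crd; rewrite mul0r expr0n addr0 eqxx.
have d0 : det3 v1 v2 v3 != 0.
  apply/eqP => e; move/eqP: nv3; apply.
  have -> : Bf n v3 = - 2%:R * det3 v1 v2 v3 by rewrite /n /Bf /br /det3 /=; ring.
  by rewrite e mulr0.
have spanA x : A x <-> span3 v1 v2 v3 x.
  split; last exact: submod_span3.
  move=> Ax; have [r1 Mx1] := min_split sA A1 m1 Ax.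
  have [r2 [Mx2 x2]] := min_split sM2 (conj A2 v21) m2 Mx1.
  have [r3 [[[Mx3 x31] x32] x33]] := min_split sM3 (conj (conj A3 v31) v32) m3 (conj Mx2 x2).
  have := Bf_nondeg d0 x31 x32 x33; move/eqP; rewrite subr_eq0 => /eqP e.
  by exists r1, r2, r3; rewrite -e; vec.
have coef (x y w : L) (r s t : D) : Nm x != 0 -> Bf x y = 0 -> Bf x w = 0 ->
    Bf x (r *: x + s *: y + t *: w) = 0 -> r = 0.
  move=> Nx xy xw; rewrite !BfE xy xw !mulr0 !addr0 Bfxx mulrC => /mul0; apply.
  by rewrite mulf_neq0 ?two_neq0.
have [r1 [r2 [r3 e1]]] := (spanA _).1 (cA _ _ A2 A3).
have [t1 [t2 [t3 e2]]] := (spanA _).1 (cA _ _ A3 A1).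
have [u1 [u2 [u3 e3]]] := (spanA _).1 (cA _ _ A1 A2).
have b12 : Bf v1 v2 = 0 by rewrite BfC.
have b13 : Bf v1 v3 = 0 by rewrite BfC.
have b23 : Bf v2 v3 = 0 by rewrite BfC.
exists v1, v2, v3, r1, t2, u3; split=> //.
- have -> : br v2 v3 = r1 *: v1 + r2 *: v2 + r3 *: v3 := e1.
  have r20 : r2 = 0.
    apply: (coef v2 v1 v3 r2 r1 r3) => //; rewrite [_ *: v2 + _]addrC -e1; exact: Bf_br_l.
  have r30 : r3 = 0.
    apply: (coef v3 v1 v2 r3 r1 r2) => //; rewrite -addrA addrC -e1; exact: Bf_br_r.
  by rewrite r20 r30 !scale0r !addr0.
- rewrite e2.
  have r20 : t1 = 0.
    apply: (coef v1 v2 v3 t1 t2 t3) => //; rewrite -e2; exact: Bf_br_r.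
  have r30 : t3 = 0.
    apply: (coef v3 v1 v2 t3 t1 t2) => //; rewrite -addrA addrC -e2; exact: Bf_br_l.
  by rewrite r20 r30 !scale0r !addr0 add0r.
- rewrite e3.
  have r20 : u1 = 0.
    apply: (coef v1 v2 v3 u1 u2 u3) => //; rewrite -e3; exact: Bf_br_l.
  have r30 : u2 = 0.
    apply: (coef v2 v1 v3 u2 u1 u3) => //; rewrite [_ *: v2 + _]addrC -e3; exact: Bf_br_r.
  by rewrite r20 r30 !scale0r !add0r.
Qed.

Lemma det3_comb v1 v2 v3 (a1 a2 a3 b1 b2 b3 c1 c2 c3 : D) :
  det3 (a1 *: v1 + a2 *: v2 + a3 *: v3) (b1 *: v1 + b2 *: v2 + b3 *: v3)
       (c1 *: v1 + c2 *: v2 + c3 *: v3) = det3 (a1, a2, a3) (b1, b2, b3) (c1, c2, c3) * det3 v1 v2 v3.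
Proof. by rewrite /det3; crd; rewrite /=; ring. Qed.

Lemma span3_mem v1 v2 v3 : [/\ span3 v1 v2 v3 v1, span3 v1 v2 v3 v2 & span3 v1 v2 v3 v3].
Proof.
split; [exists 1, 0, 0|exists 0, 1, 0|exists 0, 0, 1];
by rewrite ?scale1r ?scale0r ?addr0 ?add0r.
Qed.

Lemma det3_basis v1 v2 v3 w1 w2 w3 : det3 v1 v2 v3 != 0 ->
  (forall x, span3 v1 v2 v3 x <-> span3 w1 w2 w3 x) ->
  exists u, u \is a GRing.unit /\ det3 w1 w2 w3 = u * det3 v1 v2 v3.
Proof.
move=> d0 vw; have [V1 V2 V3] := span3_mem v1 v2 v3; have [W1 W2 W3] := span3_mem w1 w2 w3.
have [a1 [a2 [a3 ea]]] := (vw _).2 W1; have [b1 [b2 [b3 eb]]] := (vw _).2 W2.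
have [c1 [c2 [c3 ec]]] := (vw _).2 W3.
have [a1' [a2' [a3' ea']]] := (vw _).1 V1; have [b1' [b2' [b3' eb']]] := (vw _).1 V2.
have [c1' [c2' [c3' ec']]] := (vw _).1 V3.
have e := det3_comb v1 v2 v3 a1 a2 a3 b1 b2 b3 c1 c2 c3.
have e' := det3_comb w1 w2 w3 a1' a2' a3' b1' b2' b3' c1' c2' c3'.
rewrite -ea -eb -ec in e; rewrite -ea' -eb' -ec' in e'.
set P := det3 (a1, a2, a3) _ _ in e; set Q := det3 (a1', a2', a3') _ _ in e'.
exists P; split=> //; rewrite e mulrA in e'.
have /eqP: Q * P = 1.
  apply/eqP; rewrite -subr_eq0; apply/eqP/(@mul0 (det3 v1 v2 v3)) => //.
  by rewrite mulrBr mulr1 mulrC -e' subrr.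
by move=> /eqP QP; apply/unitrP; exists Q; rewrite QP mulrC QP.
Qed.

Lemma q_gt1 : (1 < q)%N.
Proof. exact: card_finNzRing_gt1. Qed.

Lemma powq_inj k l : (q ^ k)%N = (q ^ l)%N -> k = l.
Proof. exact/expnI/q_gt1. Qed.

Lemma Alg_det A k v1 v2 v3 : Alg k A -> (forall x, A x <-> span3 v1 v2 v3 x) ->
  exists u, u \is a GRing.unit /\ det3 v1 v2 v3 = u * pi ^+ k.
Proof.
move=> [sA cA iA] Av; have [l [w1 [w2 [w3 [/powq_inj <- d wA]]]]] := triangular_basis sA iA.
rewrite -d; apply: det3_basis; first by rewrite d pow_unif_neq0.
by move=> x; rewrite -wA Av.
Qed.

Section OBtheory.
Variables (A : set L) (v1 v2 v3 : L) (s1 s2 s3 : D).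
Hypothesis o : OB A v1 v2 v3 s1 s2 s3.

Lemma OB_mem : [/\ A v1, A v2 & A v3].
Proof. by have [? ? ?] := span3_mem v1 v2 v3; split; apply/(ob_span o). Qed.

Lemma OB_rot : OB A v2 v3 v1 s2 s3 s1.
Proof.
case: o => sp d b12 b13 b23 r1 r2 r3; split=> //; rewrite 1?BfC //.
- move=> x; rewrite sp; split.
    by move=> [a [b [c ->]]]; exists b, c, a; vec.
  by move=> [a [b [c ->]]]; exists c, a, b; vec.
- by rewrite (_ : det3 v2 v3 v1 = det3 v1 v2 v3) // /det3; ring.
Qed.

Lemma OB_free a b c : a *: v1 + b *: v2 + c *: v3 = 0 -> [/\ a = 0, b = 0 & c = 0].
Proof.
move=> e; have d0 := ob_det o.
have z x y : det3 (0 : L) x y = 0 by rewrite /det3; crd; ring.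
by split; apply: (mul0 (a := det3 v1 v2 v3)) => //;
 [rewrite -(z v2 v3)|rewrite -(z v3 v1)|rewrite -(z v1 v2)]; rewrite -e /det3; crd; ring.
Qed.

Lemma OB_neq0 : v1 != 0 /\ v2 != 0.
Proof.
split; apply/eqP => e.
  have [/eqP] : [/\ (1 : D) = 0, (0 : D) = 0 & (0 : D) = 0] by apply: OB_free; rewrite e scaler0 !scale0r !addr0.
  by rewrite oner_eq0.
have [_ /eqP] : [/\ (0 : D) = 0, (1 : D) = 0 & (0 : D) = 0] by apply: OB_free; rewrite e scaler0 !scale0r !addr0.
by rewrite oner_eq0.
Qed.

(** [br v1 (br v1 v2)] is evaluated by the structure constants and by the triple product. The norms
    of the basis vectors thus tell which s_i are units. *)
Lemma OB_Nm1 : s2 * s3 = - (4%:R * Nm v1).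
Proof.
case: (o) => sp d b12 b13 b23 r1 r2 r3.
have := br_br v1 v1 v2; rewrite b12 mulr0 scale0r subr0 Bfxx r3 brZr brC r2 scalerN scalerA => e.
have /scale_eq0 [|e2] : (s3 * s2 + 4%:R * Nm v1) *: v2 = 0.
  by rewrite scalerDl -(opprK ((s3 * s2) *: v2)) e -scaleNr -scalerDl; rewrite (_ : _ + _ = 0) ?scale0r //; ring.
  by move/eqP; rewrite addr_eq0 mulrC => /eqP.
by case: OB_neq0 => _; rewrite e2 eqxx.
Qed.

Lemma OB_s1N : s1 * Nm v1 = - det3 v1 v2 v3.
Proof.
case: (o) => sp d b12 b13 b23 r1 r2 r3.
have := det3_br v1 v2 v3; rewrite r1 BfZr Bfxx => e.
have : 2%:R * (s1 * Nm v1 + det3 v1 v2 v3) = 0.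
  by rewrite mulrDr mulrCA e mulNr addNr.
by move/mul0 => /(_ (two_neq0 D)) /eqP; rewrite addr_eq0 => /eqP.
Qed.

(** With [Alg_det], the valuations of the s_i add up to the exponent of the index. *)
Lemma OB_det : s1 * s2 * s3 = 4%:R * det3 v1 v2 v3.
Proof. by rewrite -mulrA OB_Nm1 mulrN mulrCA OB_s1N mulrN opprK. Qed.

End OBtheory.

End Orthogonal.


(** * Types of algebras by their unit structure constants, and the weight w *)

Section Types.
Variable D : dvr.
Local Notation pi := (unif D).
Local Notation q := #|resF D|.
Local Notation res := (res D).
Local Notation L := (sl2 D).
Implicit Types (A M : set L) (x y z v w : L).

(* In a basis [w], the bracket is [x, y] = S (x * y) where [*] is the cross product
   of the coordinate vectors and [S] is a symmetric matrix; only matrices [S] whose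
   off-diagonal part is the entry [t] in position (1, 3) are needed. *)
Record SB A w1 w2 w3 (s1 s2 s3 t : D) : Prop := MkSB {
  sb_span : forall x, A x <-> span3 w1 w2 w3 x;
  sb_det : det3 w1 w2 w3 != 0;
  sb_br1 : br w2 w3 = s1 *: w1 + t *: w3;
  sb_br2 : br w3 w1 = s2 *: w2;
  sb_br3 : br w1 w2 = t *: w1 + s3 *: w3 }.

Lemma OB_SB A v1 v2 v3 s1 s2 s3 : OB A v1 v2 v3 s1 s2 s3 -> SB A v1 v2 v3 s1 s2 s3 0.
Proof. by case=> sp d _ _ _ r1 r2 r3; split=> //; rewrite ?r1 ?r2 ?r3 scale0r ?addr0 ?add0r. Qed.

(* With [s_i] as in [OB], the number of units among the [s_i] is 0 for [R0], at least 2
   for [RU], and 1 for the remaining algebras, called [R1] below. *)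
Definition R0 A := forall x y, A x -> A y -> exists z, A z /\ br x y = pi *: z.
Definition RU A := exists y, A y /\ res (Nm y) != 0.

Lemma SB_br A w1 w2 w3 s1 s2 s3 t (x1 x2 x3 y1 y2 y3 : D) : SB A w1 w2 w3 s1 s2 s3 t ->
  br (x1 *: w1 + x2 *: w2 + x3 *: w3) (y1 *: w1 + y2 *: w2 + y3 *: w3) =
  (s1 * (x2 * y3 - x3 * y2) + t * (x1 * y2 - x2 * y1)) *: w1
  + (s2 * (x3 * y1 - x1 * y3)) *: w2
  + (t * (x2 * y3 - x3 * y2) + s3 * (x1 * y2 - x2 * y1)) *: w3.
Proof.
move=> o; rewrite !brE !brxx (brC w2 w1) (brC w1 w3) (brC w3 w2).
by rewrite (sb_br1 o) (sb_br2 o) (sb_br3 o); vec.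
Qed.

Lemma det3_free w1 w2 w3 (a b c : D) : det3 w1 w2 w3 != 0 ->
  a *: w1 + b *: w2 + c *: w3 = 0 -> [/\ a = 0, b = 0 & c = 0].
Proof.
move=> d0 e.
have z x y : det3 (0 : L) x y = 0 by rewrite /det3; crd; ring.
by split; apply: (mul0 (a := det3 w1 w2 w3)) => //;
 [rewrite -(z w2 w3)|rewrite -(z w3 w1)|rewrite -(z w1 w2)]; rewrite -e /det3; crd; ring.
Qed.

Lemma det3_inj w1 w2 w3 (a b c a' b' c' : D) : det3 w1 w2 w3 != 0 ->
  a *: w1 + b *: w2 + c *: w3 = a' *: w1 + b' *: w2 + c' *: w3 ->
  [/\ a = a', b = b' & c = c'].
Proof.
move=> d0 e; have [] : [/\ a - a' = 0, b - b' = 0 & c - c' = 0].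
  apply: (det3_free d0).
  have -> : (a - a') *: w1 + (b - b') *: w2 + (c - c') *: w3 =
    (a *: w1 + b *: w2 + c *: w3) - (a' *: w1 + b' *: w2 + c' *: w3) by vec.
  by rewrite e subrr.
by move=> ea eb ec; split; apply/subr0_eq.
Qed.

Lemma resZ (r : D) : res r = 0 -> exists t, r = pi * t.
Proof. by move/(res_eq0 (d := D)). Qed.

Lemma R0_OB A v1 v2 v3 s1 s2 s3 : OB A v1 v2 v3 s1 s2 s3 ->
  R0 A <-> [/\ res s1 = 0, res s2 = 0 & res s3 = 0].
Proof.
move=> o; have [A1 A2 A3] := OB_mem o; split.
  move=> h; split.
  - have [z [/(ob_span o)[a [b [c ->]]]]] := h _ _ A2 A3.
    have -> : br v2 v3 = s1 *: v1 + 0 *: v2 + 0 *: v3 by rewrite (ob_br1 o) !scale0r !addr0.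
    rewrite !scalerDr !scalerA => /(det3_inj (ob_det o))[-> _ _].
    by rewrite rmorphM /= res_unif mul0r.
  - have [z [/(ob_span o)[a [b [c ->]]]]] := h _ _ A3 A1.
    have -> : br v3 v1 = 0 *: v1 + s2 *: v2 + 0 *: v3 by rewrite (ob_br2 o) !scale0r !addr0 add0r.
    rewrite !scalerDr !scalerA => /(det3_inj (ob_det o))[_ -> _].
    by rewrite rmorphM /= res_unif mul0r.
  - have [z [/(ob_span o)[a [b [c ->]]]]] := h _ _ A1 A2.
    have -> : br v1 v2 = 0 *: v1 + 0 *: v2 + s3 *: v3 by rewrite (ob_br3 o) !scale0r !add0r.
    rewrite !scalerDr !scalerA => /(det3_inj (ob_det o))[_ _ ->].
    by rewrite rmorphM /= res_unif mul0r.
move=> [/resZ[t1 e1] /resZ[t2 e2] /resZ[t3 e3]] x y.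
move=> /(ob_span o)[x1 [x2 [x3 ->]]] /(ob_span o)[y1 [y2 [y3 ->]]].
rewrite (SB_br _ _ _ _ _ _ (OB_SB o)) e1 e2 e3.
exists ((t1 * (x2 * y3 - x3 * y2)) *: v1 + (t2 * (x3 * y1 - x1 * y3)) *: v2
   + (t3 * (x1 * y2 - x2 * y1)) *: v3); split; last by vec.
by apply/(ob_span o); do 3!eexists.
Qed.

Lemma OB_Nm A v1 v2 v3 s1 s2 s3 (a b c : D) : OB A v1 v2 v3 s1 s2 s3 ->
  Nm (a *: v1 + b *: v2 + c *: v3) = a ^+ 2 * Nm v1 + b ^+ 2 * Nm v2 + c ^+ 2 * Nm v3.
Proof.
move=> o; rewrite !NmD !NmZ !BfE (ob_12 o) (ob_13 o) (ob_23 o); ring.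
Qed.

Lemma res4 : res 4%:R != 0.
Proof.
by rewrite (_ : 4%:R = 2%:R * 2%:R) ?rmorphM ?mulf_neq0 ?rmorph_nat ?two_res //; ring.
Qed.

Lemma OB_resN A v1 v2 v3 s1 s2 s3 : OB A v1 v2 v3 s1 s2 s3 ->
  (res (Nm v1) == 0) = (res s2 * res s3 == 0).
Proof.
move=> o; rewrite -rmorphM (OB_Nm1 o) rmorphN oppr_eq0 rmorphM /= mulf_eq0.
by rewrite (negbTE res4).
Qed.

(** If the norm takes a unit value, some Nm v_i is a unit, and then so are the two structure
    constants other than s_i; a rotation of the basis brings them to the front. *)
Lemma RU_OB A v1 v2 v3 s1 s2 s3 : OB A v1 v2 v3 s1 s2 s3 ->
  RU A -> exists w1 w2 w3 t1 t2 t3,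
   [/\ OB A w1 w2 w3 t1 t2 t3, res t1 != 0, res t2 != 0 & s1 * s2 * s3 = t1 * t2 * t3].
Proof.
move=> o [y [/(ob_span o)[a [b [c ->]]]]]; rewrite (OB_Nm _ _ _ o) !rmorphD !rmorphM /=.
have o2 := OB_rot o; have o3 := OB_rot o2.
have [->|n1] := eqVneq (res (Nm v1)) 0; last first.
  move=> _; move: n1; rewrite (OB_resN o) mulf_eq0 negb_or => /andP[r2 r3].
  by exists v2, v3, v1, s2, s3, s1; split=> //; ring.
have [->|n1] := eqVneq (res (Nm v2)) 0; last first.
  move=> _; move: n1; rewrite (OB_resN o2) mulf_eq0 negb_or => /andP[r2 r3].
  by exists v3, v1, v2, s3, s1, s2; split=> //; ring.
have [->|n1] := eqVneq (res (Nm v3)) 0; last first.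
  move=> _; move: n1; rewrite (OB_resN o3) mulf_eq0 negb_or => /andP[r2 r3].
  by exists v1, v2, v3, s1, s2, s3.
by rewrite !mulr0 !addr0 eqxx.
Qed.

Lemma OB_R1 A v1 v2 v3 s1 s2 s3 : OB A v1 v2 v3 s1 s2 s3 -> ~ R0 A -> ~ RU A ->
  exists w1 w2 w3 t1 t2 t3,
   [/\ OB A w1 w2 w3 t1 t2 t3, res t1 != 0, res t2 = 0, res t3 = 0
     & s1 * s2 * s3 = t1 * t2 * t3].
Proof.
move=> o n0 nU; have [A1 A2 A3] := OB_mem o.
have o2 := OB_rot o; have o3 := OB_rot o2.
have z v : A v -> res (Nm v) == 0.
  by move=> Av; apply/negPn/negP => h; apply: nU; exists v.
have := z _ A1; rewrite (OB_resN o) mulf_eq0 => z1.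
have := z _ A2; rewrite (OB_resN o2) mulf_eq0 => z2.
have := z _ A3; rewrite (OB_resN o3) mulf_eq0 => z3.
have [e1|e1] := eqVneq (res s1) 0; last first.
  by move: z2 z3; rewrite (negbTE e1) orbF /= => /eqP z2 /eqP z3; exists v1, v2, v3, s1, s2, s3; split.
have [e2|e2] := eqVneq (res s2) 0; last first.
  move: z1 z3; rewrite (negbTE e2) orbF /= => /eqP y2 _; exists v2, v3, v1, s2, s3, s1.
  by split=> //; ring.
have [e3|e3] := eqVneq (res s3) 0; last first.
  by exists v3, v1, v2, s3, s1, s2; split=> //; ring.
by case: n0; apply/(R0_OB o).
Qed.

Lemma Alg_OB_prod A k v1 v2 v3 s1 s2 s3 : Alg k A -> OB A v1 v2 v3 s1 s2 s3 ->
  exists u, u \is a GRing.unit /\ s1 * s2 * s3 = u * pi ^+ k.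
Proof.
move=> Ak o; have [u [uu e]] := Alg_det Ak (ob_span o).
exists (4%:R * u); split; last by rewrite (OB_det o) e mulrA.
by rewrite unitrM uu unit_resE res4.
Qed.

Lemma RU_type A k : Alg k A -> RU A -> exists v1 v2 v3 s1 s2 s3,
  [/\ OB A v1 v2 v3 s1 s2 s3, s1 \is a GRing.unit, s2 \is a GRing.unit
    & exists u, u \is a GRing.unit /\ s3 = u * pi ^+ k].
Proof.
move=> Ak rA; have [v1 [v2 [v3 [s1 [s2 [s3 o]]]]]] := OB_exists Ak.
have [w1 [w2 [w3 [t1 [t2 [t3 [o' r1 r2 _]]]]]]] := RU_OB o rA.
have [u [uu e]] := Alg_OB_prod Ak o'; rewrite -unit_resE in r1; rewrite -unit_resE in r2.
exists w1, w2, w3, t1, t2, t3; split=> //; exists ((t1 * t2)^-1 * u); split.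
  by rewrite unitrM unitrV unitrM r1 r2 uu.
by rewrite -mulrA -e mulKr // unitrM r1 r2.
Qed.

Lemma R1_type A k : Alg k A -> ~ R0 A -> ~ RU A -> exists v1 v2 v3 s1 s2 s3 b c u2 u3,
  [/\ OB A v1 v2 v3 s1 s2 s3, s1 \is a GRing.unit,
   s2 = u2 * pi ^+ b.+1 /\ u2 \is a GRing.unit,
   s3 = u3 * pi ^+ c.+1 /\ u3 \is a GRing.unit & k = (b + c).+2].
Proof.
move=> Ak nA rA; have [v1 [v2 [v3 [s1 [s2 [s3 o]]]]]] := OB_exists Ak.
have [w1 [w2 [w3 [t1 [t2 [t3 [o' r1 r2 r3 _]]]]]]] := OB_R1 o nA rA.
have [u [uu e]] := Alg_OB_prod Ak o'; rewrite -unit_resE in r1.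
have pos (t : D) : t != 0 -> res t = 0 -> exists u b, u \is a GRing.unit /\ t = u * pi ^+ b.+1.
  move=> t0 rt; have [v [[|b] [vv et]]] := dvrP t0; last by exists v, b.
  by move: vv; rewrite unit_resE; move: rt; rewrite et mulr1 => ->; rewrite eqxx.
have nz : u * pi ^+ k != 0.
  by rewrite mulf_neq0 ?pow_unif_neq0 //; apply: contraTneq uu => ->; rewrite unitr0.
rewrite -e in nz.
have n2 : t2 != 0 by apply: contra_neq nz => ->; rewrite mulr0 mul0r.
have n3 : t3 != 0 by apply: contra_neq nz => ->; rewrite mulr0.
have [u2 [b [uu2 e2]]] := pos _ n2 r2; have [u3 [c [uu3 e3]]] := pos _ n3 r3.
exists w1, w2, w3, t1, t2, t3, b, c, u2, u3; split=> //.
have e' : (t1 * u2 * u3) * pi ^+ (b + c).+2 = u * pi ^+ k.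
  by rewrite -e e2 e3 -addSn -addnS exprD; ring.
have uu' : t1 * u2 * u3 \is a GRing.unit by rewrite !unitrM r1 uu2.
apply/eqP; rewrite eqn_leq; apply/andP; split.
  by apply: (pdvd_unit uu'); rewrite e'; apply/pdvdM/pdvd_pow.
by apply: (pdvd_unit uu); rewrite -e'; apply/pdvdM/pdvd_pow.
Qed.

Local Notation G := ((D^o : lmodType D) * L)%type.

(* The subalgebras of gl_2 = R x sl_2 that project onto [A] and meet the centre in pi^m. *)
Definition lifts (m : nat) A : set (set G) := fun U =>
  [/\ submod U, forall x, pproj2 U x <-> A x, forall z : D^o, psub1 U z <-> pdvd m (z : D)
    & forall x y, A x -> A y -> U (0, br x y)].

Definition w (m : nat) A := csize (lifts m A).

(** A lift is the graph of a linear map A -> R/pi^m that kills the vectors s_i v_i. The image of v_i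
    can be any element of R/pi^m annihilated by s_i, and there are q^min(a_i, m) of these. *)
Lemma w_OB A v1 v2 v3 s1 s2 s3 u1 u2 u3 a1 a2 a3 m : OB A v1 v2 v3 s1 s2 s3 ->
  u1 \is a GRing.unit -> u2 \is a GRing.unit -> u3 \is a GRing.unit ->
  s1 = u1 * pi ^+ a1 -> s2 = u2 * pi ^+ a2 -> s3 = u3 * pi ^+ a3 ->
  fin (lifts m A) /\ w m A = (q ^ (minn a1 m + minn a2 m + minn a3 m))%N.
Proof.
move=> o uu1 uu2 uu3 e1 e2 e3; have [A1 A2 A3] := OB_mem o.
have [f1 [_ f1s f1i]] := relidx_idl D (minn a1 m).
have [f2 [_ f2s f2i]] := relidx_idl D (minn a2 m).
have [f3 [_ f3s f3i]] := relidx_idl D (minn a3 m).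
pose IT := ('I_(q ^ minn a1 m) * 'I_(q ^ minn a2 m) * 'I_(q ^ minn a3 m))%type.
have -> : (q ^ (minn a1 m + minn a2 m + minn a3 m))%N = #|{: IT}|.
  by rewrite !card_prod !card_ord !expnD.
pose g (p1 p2 p3 : D) : set G := fun x : G => exists r1 r2 r3 : D,
  x.2 = r1 *: v1 + r2 *: v2 + r3 *: v3 /\ pdvd m ((x.1 : D) - (r1 * p1 + r2 * p2 + r3 * p3)).
(* The annihilator of pi^a in R/pi^m is generated by pi^(m - min(a, m)). *)
pose P a i : D := pi ^+ (m - minn a m) * i.
have Pm a (i : D) u : pdvd m (u * pi ^+ a * P a i).
  rewrite /P (_ : _ * _ = (u * i) * pi ^+ (a + (m - minn a m))); last by rewrite exprD; ring.
  by apply/pdvdM/(pdvd_leq _ (pdvd_pow D _)); lia.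
have PP a (z u : D) : u \is a GRing.unit -> pdvd m (u * pi ^+ a * z) -> exists i, z = P a i.
  move=> uu; rewrite -mulrA => /(pdvd_unitM _ _ uu) h.
  have : pdvd (m - minn a m) z; last by [].
  have [am|ma] := leqP a m; last by rewrite subnn; exact: pdvd_0n.
  by apply: (@pdvd_mulI D a); rewrite subnKC.
have Pi a (f : 'I_(q ^ minn a m) -> D) : (forall i j, pdvd (minn a m) (f i - f j) -> i = j) ->
    forall i j, pdvd m (P a (f i) - P a (f j)) -> i = j.
  move=> fi i j; rewrite /P -mulrBr => h; apply: fi; apply: (@pdvd_mulI D (m - minn a m)).
  by rewrite subnK // geq_minr.
have [spl [d0 sp]] : (forall x, A x -> span3 v1 v2 v3 x) /\ det3 v1 v2 v3 != 0 /\
   (forall x, span3 v1 v2 v3 x -> A x).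
  by split; [move=> x /(ob_span o)|split; [exact: ob_det o|move=> x /(ob_span o)]].
have gsub p1 p2 p3 : submod (g p1 p2 p3).
  split.
  - by exists 0, 0, 0; split; [rewrite !scale0r !addr0|rewrite !mul0r !addr0 subr0; exact: pdvd0].
  - move=> x y [r1 [r2 [r3 [ex px]]]] [t1 [t2 [t3 [ey py]]]].
    exists (r1 + t1), (r2 + t2), (r3 + t3); split; first by rewrite /= ex ey; vec.
    by have := pdvdD px py; congr pdvd; rewrite /=; ring.
  - move=> r x [r1 [r2 [r3 [ex px]]]].
    exists (r * r1), (r * r2), (r * r3); split; first by rewrite /= ex; vec.
    by have := pdvdM r px; congr pdvd; rewrite /= /GRing.scale /=; ring.
have gP p1 p2 p3 : pdvd m (s1 * p1) -> pdvd m (s2 * p2) -> pdvd m (s3 * p3) ->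
    lifts m A (g p1 p2 p3).
  move=> h1 h2 h3; split=> //.
  - move=> x; split; first by move=> [z [r1 [r2 [r3 [/= -> _]]]]]; apply: sp; exists r1, r2, r3.
    move=> /spl[r1 [r2 [r3 ->]]]; exists (r1 * p1 + r2 * p2 + r3 * p3), r1, r2, r3.
    by rewrite subrr; split=> //; exact: pdvd0.
  - move=> z; split.
      move=> [r1 [r2 [r3 [/= /esym /(det3_free d0)[-> -> ->]]]]].
      by rewrite !mul0r !addr0 subr0.
    by move=> h; exists 0, 0, 0; rewrite !scale0r !mul0r !addr0 subr0.
  - move=> x y /spl[x1 [x2 [x3 ->]]] /spl[y1 [y2 [y3 ->]]].
    rewrite (SB_br _ _ _ _ _ _ (OB_SB o)); do 3!eexists; split; first by [].
    rewrite sub0r; apply: pdvdN; apply: pdvdD; first apply: pdvdD.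
    + rewrite mul0r addr0 mulrAC; exact: pdvdMr.
    + rewrite mulrAC; exact: pdvdMr.
    + rewrite mul0r add0r mulrAC; exact: pdvdMr.
apply: (@csize_fin _ _ _ _ (fun i : IT => g (P a1 (f1 i.1.1)) (P a2 (f2 i.1.2)) (P a3 (f3 i.2)))).
- by move=> i _; apply: gP; rewrite ?e1 ?e2 ?e3; apply: Pm.
- move=> U [sU UA Um Ubr]; have [_ UD UZ] := sU.
  have [z1 U1] := (UA _).2 A1; have [z2 U2] := (UA _).2 A2; have [z3 U3] := (UA _).2 A3.
  have key (z : D^o) v s x y : A x -> A y -> br x y = s *: v -> U (z, v) -> pdvd m (s * z).
    move=> Ax Ay e Uz; apply/Um; have := submodB sU (UZ s _ Uz) (Ubr _ _ Ax Ay).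
    by rewrite e; congr U; congr pair; rewrite /= ?subr0 ?subrr.
  have := key _ _ _ _ _ A2 A3 (ob_br1 o) U1; rewrite e1 => /(PP _ _ _ uu1)[i1 h1].
  have := key _ _ _ _ _ A3 A1 (ob_br2 o) U2; rewrite e2 => /(PP _ _ _ uu2)[i2 h2].
  have := key _ _ _ _ _ A1 A2 (ob_br3 o) U3; rewrite e3 => /(PP _ _ _ uu3)[i3 h3].
  have [j1 k1] := f1s i1 I; have [j2 k2] := f2s i2 I; have [j3 k3] := f3s i3 I.
  have Pd a (i x : D) : pdvd (minn a m) (x - i) -> pdvd m (P a x - P a i).
    rewrite /P -mulrBr => h; have := pdvdMM (pdvd_pow D (m - minn a m)) h.
    by rewrite subnK // geq_minr.
  exists (j1, j2, j3) => //=; apply/funext => -[z x]; apply/propext.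
  set Q1 := P a1 _; set Q2 := P a2 _; set Q3 := P a3 _.
  have k r1 r2 r3 : pdvd m (z - (r1 * z1 + r2 * z2 + r3 * z3)) <-> pdvd m (z - (r1 * Q1 + r2 * Q2 + r3 * Q3)).
    have hd : pdvd m (r1 * (z1 - Q1) + r2 * (z2 - Q2) + r3 * (z3 - Q3)).
      by rewrite h1 h2 h3; apply: pdvdD; [apply: pdvdD|]; apply/pdvdM/Pd.
    split=> h; [have := pdvdD h hd|have := pdvdB h hd]; congr pdvd; ring.
  have U3' r1 r2 r3 : U (r1 * z1 + r2 * z2 + r3 * z3, r1 *: v1 + r2 *: v2 + r3 *: v3).
    by have := UD _ _ (UD _ _ (UZ r1 _ U1) (UZ r2 _ U2)) (UZ r3 _ U3).
  split.
    move=> Uzx; have /spl[r1 [r2 [r3 ex]]] := (UA x).1 (ex_intro _ z Uzx).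
    exists r1, r2, r3; split=> //; apply/k/Um; have := submodB sU Uzx (U3' r1 r2 r3).
    by congr U; congr pair; rewrite /= ex subrr.
  move=> [r1 [r2 [r3 [/= -> /k/Um h]]]].
  have := UD _ _ h (U3' r1 r2 r3); congr U; congr pair; rewrite /= ?add0r //.
  by rewrite subrK.
- move=> [[i1 i2] i3] [[j1 j2] j3] _ _ /= e.
  have g1 p1 p2 p3 : [/\ g p1 p2 p3 (p1, v1), g p1 p2 p3 (p2, v2) & g p1 p2 p3 (p3, v3)].
    have p0 : pdvd m (0 : D) := pdvd0 D m.
    split; [exists 1, 0, 0|exists 0, 1, 0|exists 0, 0, 1]; rewrite /= !(scale1r, scale0r, addr0, add0r);
    by split=> //; rewrite !(mul1r, mul0r, addr0, add0r) subrr.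
  have [] := g1 (P a1 (f1 i1)) (P a2 (f2 i2)) (P a3 (f3 i3)).
  rewrite e => -[r1 [r2 [r3 [/= E1 h1]]]] [t1 [t2 [t3 [/= E2 h2]]]] [y1 [y2 [y3 [/= E3 h3]]]].
  have [x1 x2 x3] := span3_mem v1 v2 v3.
  have E1' : 1 *: v1 + 0 *: v2 + 0 *: v3 = r1 *: v1 + r2 *: v2 + r3 *: v3.
    by rewrite -E1 scale1r !scale0r !addr0.
  have E2' : 0 *: v1 + 1 *: v2 + 0 *: v3 = t1 *: v1 + t2 *: v2 + t3 *: v3.
    by rewrite -E2 scale1r !scale0r add0r addr0.
  have E3' : 0 *: v1 + 0 *: v2 + 1 *: v3 = y1 *: v1 + y2 *: v2 + y3 *: v3.
    by rewrite -E3 scale1r !scale0r !add0r.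
  have [e11 e12 e13] := det3_inj d0 E1'; have [e21 e22 e23] := det3_inj d0 E2'.
  have [e31 e32 e33] := det3_inj d0 E3'.
  rewrite -e11 -e12 -e13 !(mul1r, mul0r, addr0, add0r) in h1.
  rewrite -e21 -e22 -e23 !(mul1r, mul0r, addr0, add0r) in h2.
  rewrite -e31 -e32 -e33 !(mul1r, mul0r, addr0, add0r) in h3.
  by rewrite (Pi _ _ f1i _ _ h1) (Pi _ _ f2i _ _ h2) (Pi _ _ f3i _ _ h3).
Qed.

End Types.


(** * Finiteness of the classes of subalgebras *)

Section Finiteness.
Variable D : dvr.
Local Notation pi := (unif D).
Local Notation q := #|resF D|.

Definition finreps (V : lmodType D) := forall n, exists (I : finType) (f : I -> V),
  forall x, exists i y, x - f i = pi ^+ n *: y.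

Lemma finreps_regular : finreps (D^o : lmodType D).
Proof.
move=> n; have [f [_ fs _]] := relidx_idl D n.
by exists _, f => x; have [i [r e]] := fs x I; exists i, r.
Qed.

Lemma finreps_prod (V W : lmodType D) : finreps V -> finreps W -> finreps (V * W)%type.
Proof.
move=> hV hW n; have [I [f fP]] := hV n; have [J [g gP]] := hW n.
exists (I * J)%type, (fun p => (f p.1, g p.2)) => -[x y].
have [i [a ea]] := fP x; have [j [b eb]] := gP y.
by exists (i, j), (a, b); congr pair.
Qed.

(** A submodule of index n contains pi^n V, so it is determined by the representatives modulo pi^n
    that it contains. *)
Lemma fin_relidx (V : lmodType D) n : finreps V ->
  fin (fun U : set V => submod U /\ relidx setT U n).
Proof.
move=> /(_ n) [I [f fP]].
apply: (@fin_inj _ _ (fun U : set V => [set i | `[< U (f i) >]])) => U U' [sU iU] [sU' iU'] e.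
apply/funext => x; apply/propext; have [i [y exy]] := fP x.
have h : U (x - f i) by rewrite exy; apply: relidx_pow.
have h' : U' (x - f i) by rewrite exy; apply: relidx_pow.
rewrite (submodDE sU h) (submodDE sU' h').
by have /setP/(_ i) := e; rewrite !inE => ee; split=> /asboolP hh; apply/asboolP; rewrite ?ee // -ee.
Qed.

Lemma fin_Alg k : fin (@Alg D k).
Proof.
apply: (fin_sub (fin_relidx (q ^ k) (finreps_prod (finreps_prod finreps_regular finreps_regular) finreps_regular))).
by move=> A [].
Qed.

End Finiteness.

(** * Similitudes and the Borel subalgebras *)

Section Similitudes.
Variable D : dvr.
Local Notation pi := (unif D).
Local Notation F := (resF D).
Local Notation q := #|resF D|.
Local Notation res := (res D).
Local Notation L := (sl2 D).
Implicit Types (A M : set L) (x y z v : L).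

Definition im (h : L -> L) A : set L := fun y => exists x, A x /\ y = h x.

(** The bracket condition says that h is pi times an automorphism of sl_2 over the fraction
    field. *)
Record sim (h : L -> L) : Prop := MkSim {
  simD : forall x y, h (x + y) = h x + h y;
  simZ : forall (r : D) x, h (r *: x) = r *: h x;
  sim_br : forall x y, br (h x) (h y) = pi *: h (br x y);
  sim_Bf : forall x y, Bf (h x) (h y) = pi ^+ 2 * Bf x y;
  sim_det : forall x y z, det3 (h x) (h y) (h z) = pi ^+ 3 * det3 x y z;
  sim_idx : relidx setT (im h setT) (q ^ 3) }.

Lemma Bf_eq0 x : (forall y, Bf x y = 0) -> x = 0.
Proof.
move=> h; apply: (@Bf_nondeg D (1, 0, 0) (0, 1, 0) (0, 0, 1)) => //.
by rewrite (_ : det3 _ _ _ = 1) ?oner_neq0 // /det3 /=; ring.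
Qed.

Section OneSim.
Variable h : L -> L.
Hypothesis sh : sim h.

Lemma simB x y : h (x - y) = h x - h y.
Proof. by rewrite -scaleN1r (simD sh) (simZ sh) scaleN1r. Qed.

Lemma sim0 : h 0 = 0.
Proof. by have := simZ sh 0 0; rewrite !scale0r. Qed.

Lemma sim_inj x y : h x = h y -> x = y.
Proof.
move=> e; apply/eqP; rewrite -subr_eq0; apply/eqP/Bf_eq0 => z.
apply: (mul0 (a := pi ^+ 2)); last exact: pow_unif_neq0.
rewrite -(sim_Bf sh) simB e subrr /Bf; crd; ring.
Qed.

Lemma im_inj A A' : im h A = im h A' -> A = A'.
Proof.
move=> e; apply/funext => x; apply/propext; split=> Ax.
  have : im h A (h x) by exists x.
  by rewrite e => -[y [Ay /sim_inj ->]].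
have : im h A' (h x) by exists x.
by rewrite -e => -[y [Ay /sim_inj ->]].
Qed.

Lemma im_mem A x : im h A (h x) <-> A x.
Proof. by split=> [[y [Ay /sim_inj ->]]//|Ax]; exists x. Qed.

Lemma im_submod A : submod A -> submod (im h A).
Proof.
move=> [A0 AD AZ]; split.
- by exists 0; rewrite sim0.
- by move=> _ _ [x [Ax ->]] [y [Ay ->]]; exists (x + y); split; [exact: AD|rewrite (simD sh)].
- by move=> r _ [x [Ax ->]]; exists (r *: x); split; [exact: AZ|rewrite (simZ sh)].
Qed.

Lemma im_R0 A : brclosed A -> R0 (im h A).
Proof.
move=> cA _ _ [x [Ax ->]] [y [Ay ->]]; exists (h (br x y)); rewrite (sim_br sh).
by split=> //; exists (br x y); split=> //; apply: cA.
Qed.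

Lemma im_idx A n : submod A -> relidx setT A n -> relidx setT (im h A) (q ^ 3 * n).
Proof.
move=> sA iA; apply: (relidx_tower _ _ _ _ _ (sim_idx sh)).
- exact: submodT.
- exact/im_submod/submodT.
- exact: im_submod.
- by [].
- by move=> _ [x [Ax ->]]; exists x.
- apply: (relidx_inj (h := h) _ _ _ _ iA); first exact: simB.
  + by move=> x _; exists x.
  + by move=> y [x [_ ->]]; exists x.
  + by move=> x; exact: im_mem.
Qed.

Lemma im_Alg A k : Alg k A -> Alg (k + 3) (im h A).
Proof.
move=> [sA cA iA]; split; first exact: im_submod.
  move=> x y hx hy; have [z [hz ->]] := im_R0 cA hx hy.
  by have [_ _] := im_submod sA; apply.
by rewrite addnC expnD; apply: im_idx.
Qed.

(** Converse to [im_Alg]: if [A, A] lies in pi A, the preimage under h is closed, since h [x, y] is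
    [h x, h y] divided by pi. Its index is not known in advance and is read off a Hermite basis. *)
Lemma pre_Alg A k : Alg k A -> R0 A -> (forall x, A x -> exists y, x = h y) ->
  exists k' A', [/\ k = (k' + 3)%N, Alg k' A' & A = im h A'].
Proof.
move=> [sA cA iA] rA Ah; pose A' : set L := fun x => A (h x).
have [A0 AD AZ] := sA.
have sA' : submod A'.
  split=> [|x y|r x]; rewrite /A'.
  - by rewrite sim0.
  - by rewrite (simD sh); apply: AD.
  - by rewrite (simZ sh); apply: AZ.
have cA' : brclosed A'.
  move=> x y Ax Ay; have [z [Az e]] := rA _ _ Ax Ay; rewrite /A'.
  suff -> : h (br x y) = z by [].
  have : pi *: (h (br x y) - z) = 0 by rewrite scalerBr -(sim_br sh) e subrr.
  by case/scale_eq0 => [e0|/eqP]; [have := unif_neq0 D; rewrite e0 eqxx|rewrite subr_eq0 => /eqP].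
have eA : A = im h A'.
  apply/funext => x; apply/propext; split=> [Ax|[y [Ay ->]]//].
  by have [y ey] := Ah _ Ax; exists y; split; rewrite // /A' -ey.
have [k' [_ [_ [_ [iA' _ _]]]]] : exists k v1 v2 v3, [/\ relidx setT A' (q ^ k), det3 v1 v2 v3 = pi ^+ k
    & forall x, A' x <-> span3 v1 v2 v3 x].
  by apply: (@triangular_basis_pow D A' (q ^ k)) => // x; rewrite /A' (simZ sh); apply: relidx_pow.
exists k', A'; split=> //; apply: (@powq_inj D); apply: (relidx_uniq sA iA).
by rewrite {1}eA addnC expnD; apply: im_idx.
Qed.

Lemma im_OB A v1 v2 v3 s1 s2 s3 : OB A v1 v2 v3 s1 s2 s3 ->
  OB (im h A) (h v1) (h v2) (h v3) (pi * s1) (pi * s2) (pi * s3).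
Proof.
case=> sp d b12 b13 b23 r1 r2 r3.
have hs (a b c : D) : h (a *: v1 + b *: v2 + c *: v3) = a *: h v1 + b *: h v2 + c *: h v3.
  by rewrite !(simD sh) !(simZ sh).
split; rewrite ?(sim_Bf sh) ?(sim_br sh) ?b12 ?b13 ?b23 ?r1 ?r2 ?r3 ?(simZ sh) ?scalerA ?mulr0 //.
- move=> x; split=> [[y [/sp[a [b [c ->]]] ->]]|[a [b [c ->]]]].
    by exists a, b, c; rewrite hs.
  by exists (a *: v1 + b *: v2 + c *: v3); rewrite hs; split=> //; apply/sp; exists a, b, c.
- by rewrite (sim_det sh) mulf_neq0 ?pow_unif_neq0.
Qed.

End OneSim.

Lemma Alg_OB_val A k v1 v2 v3 s1 s2 s3 : Alg k A -> OB A v1 v2 v3 s1 s2 s3 ->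
  exists u1 u2 u3 a1 a2 a3, [/\ [/\ u1 \is a GRing.unit, u2 \is a GRing.unit & u3 \is a GRing.unit],
    s1 = u1 * pi ^+ a1, s2 = u2 * pi ^+ a2 & s3 = u3 * pi ^+ a3].
Proof.
move=> Ak o; have [u [uu e]] := Alg_OB_prod Ak o.
have nz : s1 * s2 * s3 != 0.
  by rewrite e mulf_neq0 ?pow_unif_neq0 //; apply: contraTneq uu => ->; rewrite unitr0.
have n1 : s1 != 0 by apply: contra_neq nz => ->; rewrite !mul0r.
have n2 : s2 != 0 by apply: contra_neq nz => ->; rewrite mulr0 mul0r.
have n3 : s3 != 0 by apply: contra_neq nz => ->; rewrite mulr0.
have [u1 [a1 [uu1 e1]]] := dvrP n1; have [u2 [a2 [uu2 e2]]] := dvrP n2.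
by have [u3 [a3 [uu3 e3]]] := dvrP n3; exists u1, u2, u3, a1, a2, a3.
Qed.

Lemma w0 A k : Alg k A -> w 0 A = 1%N.
Proof.
move=> Ak; have [v1 [v2 [v3 [s1 [s2 [s3 o]]]]]] := OB_exists Ak.
have [u1 [u2 [u3 [a1 [a2 [a3 [[uu1 uu2 uu3] e1 e2 e3]]]]]]] := Alg_OB_val Ak o.
by have [_ ->] := w_OB 0 o uu1 uu2 uu3 e1 e2 e3; rewrite !minn0.
Qed.

(** All three valuations grow by one, and min(a + 1, m + 1) = min(a, m) + 1. *)
Lemma w_im h A k m : sim h -> Alg k A -> w m.+1 (im h A) = (q ^ 3 * w m A)%N.
Proof.
move=> sh Ak; have [v1 [v2 [v3 [s1 [s2 [s3 o]]]]]] := OB_exists Ak.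
have [u1 [u2 [u3 [a1 [a2 [a3 [[uu1 uu2 uu3] e1 e2 e3]]]]]]] := Alg_OB_val Ak o.
have [_ ->] := w_OB m o uu1 uu2 uu3 e1 e2 e3.
have e (s u : D) a : s = u * pi ^+ a -> pi * s = u * pi ^+ a.+1.
  by move=> ->; rewrite exprS mulrCA.
have [_ ->] := w_OB m.+1 (im_OB sh o) uu1 uu2 uu3 (e _ _ _ e1) (e _ _ _ e2) (e _ _ _ e3).
by rewrite -expnD; congr expn; rewrite !minnSS; lia.
Qed.

Lemma relidx_box i j k :
  relidx setT (fun x : L => [/\ pdvd i (x.1.1 : D), pdvd j (x.1.2 : D) & pdvd k (x.2 : D)]) (q ^ (i + j + k)).
Proof.
set X : set L := (X in relidx _ X _).
have sX : submod X.
  split.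
  - by rewrite /X; crd; split; exact: pdvd0.
  - by move=> x y [? ? ?] [? ? ?]; rewrite /X; crd; split; exact: pdvdD.
  - by move=> r x [? ? ?]; rewrite /X; crd; split; exact: pdvdM.
have eqset (T : Type) (P Q : set T) : (forall t, P t <-> Q t) -> P = Q.
  by move=> PQ; apply/funext => y; apply/propext.
rewrite expnD; apply: (relidx_prod (V := (D^o * D^o)%type) (W := D^o)) => //; last first.
  rewrite (_ : pproj2 _ = (pdvd k : set D^o)); first exact: relidx_idl.
  apply: eqset => x; split; first by move=> [y []].
  by move=> px; exists 0; split=> //; exact: pdvd0.
have s1 := psub1_submod (V := (D^o * D^o)%type) (W := D^o) sX.
rewrite expnD; apply: relidx_prod => //.
  rewrite (_ : psub1 _ = (pdvd i : set D^o)); first exact: relidx_idl.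
  apply: eqset => x; split; first by move=> [].
  by move=> px; split=> //; exact: pdvd0.
rewrite (_ : pproj2 _ = (pdvd j : set D^o)); first exact: relidx_idl.
apply: eqset => x; split; first by move=> [y []].
by move=> px; exists 0; split=> //; exact: pdvd0.
Qed.

Definition hpi : L -> L := fun x => pi *: x.

Lemma sim_pi : sim hpi.
Proof.
split; rewrite /hpi.
- by move=> x y; rewrite scalerDr.
- by move=> r x; rewrite !scalerA mulrC.
- by move=> x y; rewrite brZl brZr.
- by move=> x y; rewrite !BfE; ring.
- by move=> x y z; rewrite /det3; crd; ring.
- have := relidx_box 1 1 1; congr relidx; apply/funext => x; apply/propext; split.
    move=> [[a ea] [b eb] [c ec]]; exists (a, b, c); split=> //.
    by apply: sl2P; crd; rewrite /= ?ea ?eb ?ec expr1.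
  by move=> [y [_ ->]]; crd; split; rewrite -[X in pdvd _ (X * _)]expr1; apply/pdvdMr/pdvd_pow.
Qed.

(* [gB i] is an automorphism of the Lie algebra carrying the Borel line of [e] to
   the one indexed by [i]; it is spanned by the nilpotent vector [nv i]. *)
Definition nv (i : option F) : L :=
  if i is Some t then (1, rlift t, - rlift t ^+ 2) else (0, 0, 1).
Definition gU (t : D) x : L :=
  (x.1.1, x.1.2 + t * x.1.1, x.2 - 2%:R * t * x.1.2 - t ^+ 2 * x.1.1).
Definition gW x : L := (x.2, - x.1.2, x.1.1).
Definition gB (i : option F) : L -> L := if i is Some t then gU (rlift t) else gW.
Definition gBi (i : option F) : L -> L := if i is Some t then gU (- rlift t) else gW.
(** This is pi times conjugation by the matrix with rows (0, 1) and (pi, 0). The maps [theta i]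
    correspond to the q + 1 neighbours of a vertex in the Bruhat-Tits tree. *)
Definition dW x : L := (x.2, - (pi * x.1.2), pi ^+ 2 * x.1.1).
Definition theta i x := gB i (dW (gBi i x)).

End Similitudes.

Ltac gsimp := rewrite ?/theta ?/gB ?/gBi ?/nv ?/gU ?/gW ?/dW ?/br; repeat (cbn [fst snd]; progress crd); cbn [fst snd].

Section BorelMaps.
Variable D : dvr.
Local Notation pi := (unif D).
Local Notation L := (sl2 D).
Implicit Types (x y z : L) (i : option (resF D)).

Lemma gBK i x : gBi i (gB i x) = x.
Proof. by case: i => [t|]; apply: sl2P; gsimp; ring. Qed.

Lemma gBiK i x : gB i (gBi i x) = x.
Proof. by case: i => [t|]; apply: sl2P; gsimp; ring. Qed.

Lemma gBiD i x y : gBi i (x + y) = gBi i x + gBi i y.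
Proof. by case: i => [t|]; apply: sl2P; gsimp; ring. Qed.

Lemma gBiZ i (r : D) x : gBi i (r *: x) = r *: gBi i x.
Proof. by case: i => [t|]; apply: sl2P; gsimp; ring. Qed.

Lemma gBD i x y : gB i (x + y) = gB i x + gB i y.
Proof. by case: i => [t|]; apply: sl2P; gsimp; ring. Qed.

Lemma gBZ i (r : D) x : gB i (r *: x) = r *: gB i x.
Proof. by case: i => [t|]; apply: sl2P; gsimp; ring. Qed.

Lemma gBi_Nm i x : Nm (gBi i x) = Nm x.
Proof. by case: i => [t|]; rewrite /Nm; gsimp; ring. Qed.

Lemma gBi_Bf i x y : Bf (gBi i x) (gBi i y) = Bf x y.
Proof. by case: i => [t|]; rewrite /Bf; gsimp; ring. Qed.

Lemma gBi_ga i x : (gBi i x).2 = Bf x (nv i).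
Proof. by case: i => [t|]; rewrite /Bf; gsimp; ring. Qed.

Lemma sim_theta i : sim (theta i).
Proof.
split.
- by move=> x y; rewrite /theta gBiD -gBD; congr gB; apply: sl2P; gsimp; ring.
- by move=> r x; rewrite /theta gBiZ -gBZ; congr gB; apply: sl2P; gsimp; ring.
- by move=> x y; case: i => [t|]; apply: sl2P; gsimp; ring.
- by move=> x y; case: i => [t|]; rewrite /Bf; gsimp; ring.
- by move=> x y z; case: i => [t|]; rewrite /det3; gsimp; ring.
- apply: (relidx_inj (h := gB i) _ _ _ _ (relidx_box D 0 1 2)).
  + by move=> x y; rewrite gBD -scaleN1r gBZ scaleN1r.
  + by [].
  + by move=> y _; exists (gBi i y); rewrite ?gBiK.
  + move=> x; split.
      move=> [y [_ e]]; have -> : x = dW (gBi i y) by rewrite -(gBK i x) e gBK.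
      split; [exact: pdvd_0n|by apply: pdvdN; apply: pdvdMr; exact: (pdvd_pow D 1)|].
      by apply: pdvdMr; exact: pdvd_pow.
    move=> [_ [b eb] [c ec]]; exists (gB i (c, - b, x.1.1)); split=> //.
    rewrite /theta gBK; congr gB; apply: sl2P; rewrite /= ?eb ?ec //; ring.
Qed.

End BorelMaps.


(** * Borel subalgebras modulo pi and the descent *)

Section Borels.
Variable D : dvr.
Local Notation pi := (unif D).
Local Notation F := (resF D).
Local Notation q := #|resF D|.
Local Notation res := (res D).
Local Notation L := (sl2 D).
Implicit Types (A M : set L) (x y z v : L) (i j : option F).

(* Modulo pi, [A] lies in the Borel subalgebra orthogonal to [nv i]. *)
Definition inB i A := forall x, A x -> res (Bf x (nv i)) = 0.

Definition beta A := #|[pred i | `[< inB i A >]]|.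

(** The [nv i] are the isotropic points modulo pi, i.e. the points of a conic, and no two of them
    are orthogonal. *)
Lemma res_nv i j : (res (Bf (nv i) (nv j)) == 0) = (i == j).
Proof.
case: i j => [s|] [t|] //=; rewrite /Bf /=.
- rewrite (_ : _ + _ = - (rlift s - rlift t) ^+ 2); last by ring.
  rewrite rmorphN rmorphXn rmorphB /= !rliftK oppr_eq0 expf_eq0 /= subr_eq0.
  by apply/eqP/eqP => [->|[->]].
- by rewrite (_ : _ + _ = 1) ?rmorph1 ?oner_eq0 //; ring.
- by rewrite (_ : _ + _ = 1) ?rmorph1 ?oner_eq0 //; ring.
- by rewrite (_ : _ + _ = 0) ?rmorph0 ?eqxx //; ring.
Qed.

(** Modulo pi, [theta i] has rank one: its kernel is the Borel subalgebra i and its image is the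
    nilpotent line in it. Hence the image of A lies in pi L exactly when A lies in that Borel
    subalgebra; excluding such A avoids counting an algebra twice. *)
Lemma theta_mod i x : exists z, theta i x = Bf x (nv i) *: nv i + pi *: z.
Proof.
case: i => [t|].
  exists (0, - (x.1.2 - rlift t * x.1.1), pi * x.1.1 + 2%:R * rlift t * (x.1.2 - rlift t * x.1.1)).
  by apply: sl2P; rewrite /Bf; gsimp; ring.
by exists (pi * x.2, - x.1.2, 0); apply: sl2P; rewrite /Bf; gsimp; ring.
Qed.

Lemma theta_res i x y : res (Bf (theta i x) y) = res (Bf x (nv i)) * res (Bf (nv i) y).
Proof.
have [z ->] := theta_mod i x.
by rewrite BfDl !BfZl rmorphD !rmorphM /= res_unif mul0r addr0.
Qed.

Lemma inB_theta i j A : ~ inB i A -> inB j (im (theta i) A) <-> i = j.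
Proof.
move=> nA; split=> [h|<- _ [x [Ax ->]]]; last first.
  have e : res (Bf (nv i) (nv i)) = 0 by apply/eqP; rewrite res_nv.
  by rewrite theta_res e mulr0.
apply/eqP; rewrite -res_nv; apply/negPn/negP => ne; apply: nA => x Ax.
have /eqP : res (Bf (theta i x) (nv j)) = 0 by apply: h; exists x.
by rewrite theta_res mulf_eq0 (negbTE ne) orbF => /eqP.
Qed.

Lemma beta_theta i A : ~ inB i A -> beta (im (theta i) A) = 1%N.
Proof.
move=> nA; rewrite /beta -(card1 i); apply: eq_card => j; rewrite !inE.
by apply/asboolP/eqP => [/(inB_theta _ nA)->|->] //; apply/inB_theta.
Qed.

Lemma beta_pi A : beta (im (@hpi D) A) = q.+1.
Proof.
rewrite /beta -card_option; apply: eq_card => j; rewrite !inE.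
apply/asboolP => _ [x [_ ->]]; rewrite /hpi BfZl rmorphM /= res_unif mul0r //.
Qed.

Lemma card_notinB A : (\sum_i (if `[< ~ inB i A >] then 1 else 0) : int) = (q.+1)%:Z - (beta A)%:Z.
Proof.
have -> : (q.+1 = beta A + #|[predC [pred i | `[< inB i A >]]]|)%N.
  by rewrite -card_option -(cardC [pred i | `[< inB i A >]]).
rewrite PoszD addrAC subrr add0r -sum1_card (big_morph Posz PoszD (erefl _)).
rewrite [RHS]big_mkcond /=; apply: eq_bigr => i _; rewrite !inE.
by rewrite -asbool_neg.
Qed.

Definition in_pi A := forall x, A x -> exists y, x = hpi y.

(** Up to the unit -4, the norm of a basis vector is the product of two of the s_i. *)
Lemma R0_Nm k A : Alg k A -> R0 A -> forall x, A x -> pdvd 2 (Nm x).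
Proof.
move=> Ak rA x; have [v1 [v2 [v3 [s1 [s2 [s3 o]]]]]] := OB_exists Ak.
have [/resZ[t1 e1] /resZ[t2 e2] /resZ[t3 e3]] := (R0_OB o).1 rA.
have h s t (v : L) : (pi * s) * (pi * t) = - (4%:R * Nm v) -> pdvd 2 (Nm v).
  move=> e; have u4 : (- 4%:R : D) \is a GRing.unit by rewrite unitrN unit_resE res4.
  apply/(pdvd_unitM _ _ u4); rewrite mulNr -e; exists (s * t); rewrite expr2; ring.
have := OB_Nm1 o; have := OB_Nm1 (OB_rot o); have := OB_Nm1 (OB_rot (OB_rot o)).
rewrite e1 e2 e3 => /h n3 /h n2 /h n1.
move=> /(ob_span o)[a [b [c ->]]]; rewrite (OB_Nm _ _ _ o).
by apply: pdvdD; [apply: pdvdD|]; apply: pdvdM.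
Qed.

Lemma R0_Bf k A : Alg k A -> R0 A -> forall x y, A x -> A y -> pdvd 2 (Bf x y).
Proof.
move=> Ak rA x y Ax Ay; have h := R0_Nm Ak rA; have [[_ AD _] _ _] := Ak.
rewrite (_ : Bf x y = Nm (x + y) - Nm x - Nm y); last by rewrite NmD; ring.
by apply: pdvdB; [apply: pdvdB|]; apply: h => //; apply: AD.
Qed.

Lemma res_sq_dvd (a : D) : pdvd 1 (a ^+ 2) -> pdvd 1 a.
Proof. by rewrite -!resP rmorphXn /= => /eqP; rewrite expf_eq0 => /eqP. Qed.

Lemma pdvd_unit_cancel n (a b : D) : res a != 0 -> pdvd n (a * b) -> pdvd n b.
Proof. by rewrite -unit_resE => ua /(pdvd_unitM _ _ ua). Qed.

(** An x in A outside pi L is isotropic modulo pi, and some [gBi t] makes it a unit multiple of e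
    modulo pi. As pi^2 divides all norms and all values of the form on A, the h- and f-coordinates
    of every y in A are then divisible by pi and pi^2, which describes the image of [dW]. *)
Lemma R0_dir k A : Alg k A -> R0 A -> ~ in_pi A -> exists i, forall x, A x -> exists y, x = theta i y.
Proof.
move=> Ak rA npi; have hN := R0_Nm Ak rA; have hB := R0_Bf Ak rA.
have [x Ax nx] : exists2 x, A x & ~ exists y, x = hpi y.
  by apply: contrapT => H; apply: npi => x Ax; apply: contrapT => H'; apply: H; exists x.
have [i ai] : exists i, res (gBi i x).1.1 != 0.
  have [a0|a0] := eqVneq (res x.1.1) 0; last by exists (Some 0).
  exists None; rewrite /=; apply/eqP => c0; apply: nx.
  have /res_sq_dvd/resP b0 : pdvd 1 ((x.1.2 : D) ^+ 2).
    apply/resP; have /resP := pdvd_leq (isT : (1 <= 2)%N) (hN _ Ax).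
    by rewrite /Nm rmorphD rmorphM /= a0 mul0r add0r.
  have [[a ea] [b eb] [c ec]] := And3 (resZ a0) (resZ b0) (resZ c0).
  by exists (a, b, c); apply: sl2P; rewrite /hpi; crd.
have [t bt] : exists t, res (gBi t x).1.1 != 0 /\ res (gBi t x).1.2 = 0.
  case: i ai => [t|] /= ai; last first.
    have [a0|a0] := eqVneq (res x.1.1) 0.
      exists None; split=> //=; rewrite rmorphN /=.
      have /res_sq_dvd/resP -> : pdvd 1 ((x.1.2 : D) ^+ 2).
        apply/resP; have /resP := pdvd_leq (isT : (1 <= 2)%N) (hN _ Ax).
        by rewrite /Nm rmorphD rmorphM /= a0 mul0r add0r.
      by rewrite oppr0.
    exists (Some (res x.1.2 / res x.1.1)); split=> //=.
    by rewrite mulNr rmorphB rmorphM /= rliftK divfK // subrr.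
  exists (Some (res x.1.2 / res x.1.1)); split=> //=.
  by rewrite mulNr rmorphB rmorphM /= rliftK divfK // subrr.
case: bt => at0 bt0; exists t => y Ay.
have := hN _ Ax; rewrite -(gBi_Nm t) => Nx.
have := hN _ Ay; rewrite -(gBi_Nm t) => Ny.
have := hB _ _ Ax Ay; rewrite -(gBi_Bf t) => Bxy.
set x' := gBi t x in at0 bt0 Nx Bxy *; set y' := gBi t y in Ny Bxy *.
have b1 : pdvd 1 (x'.1.2 : D) by apply/resP.
have b2 : pdvd 2 ((x'.1.2 : D) ^+ 2) by rewrite expr2; apply: (pdvdMM b1 b1).
have g2 : pdvd 2 (x'.2 : D).
  by apply: (pdvd_unit_cancel at0); have := pdvdB Nx b2; congr pdvd; rewrite /Nm; ring.
have g21 := pdvd_leq (isT : (1 <= 2)%N) g2.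
have gy1 : pdvd 1 (y'.2 : D).
  apply: (pdvd_unit_cancel at0).
  have := pdvdB (pdvdB (pdvd_leq (isT : (1 <= 2)%N) Bxy) (pdvdMr y'.1.1 g21)) (pdvdM 2%:R (pdvdMr y'.1.2 b1)).
  by congr pdvd; rewrite /Bf; ring.
have by1 : pdvd 1 (y'.1.2 : D).
  apply: res_sq_dvd; have := pdvdB (pdvd_leq (isT : (1 <= 2)%N) Ny) (pdvdM y'.1.1 gy1).
  by congr pdvd; rewrite /Nm; ring.
have gy2 : pdvd 2 (y'.2 : D).
  apply: (pdvd_unit_cancel at0).
  have := pdvdB (pdvdB Bxy (pdvdMr y'.1.1 g2)) (pdvdM 2%:R (pdvdMM b1 by1)).
  by congr pdvd; rewrite /Bf; ring.
have [b eb] := by1; have [c ec] := gy2.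
exists (gB t (c, - b, y'.1.1)); rewrite /theta gBK -[LHS](gBiK t) -/y'; congr gB.
by apply: sl2P; rewrite /dW /= ?eb ?ec; ring.
Qed.

(* [A'] gives rise to pi A', which lies in all q + 1 Borel subalgebras, and to one
   theta_i A' for each Borel subalgebra not containing [A'], which lies in that one alone. *)
Lemma sum_R0 k (g : nat -> int) (h h' : set L -> int) :
  (forall A, Alg k A -> h (im (@hpi D) A) = h' A) ->
  (forall A i, Alg k A -> h (im (theta i) A) = h' A) ->
  ssum (fun A => Alg (k + 3) A /\ R0 A) (fun A => g (beta A) * h A) =
  ssum (@Alg D k) (fun A => (g q.+1 + ((q.+1)%:Z - (beta A)%:Z) * g 1%N) * h' A).
Proof.
move=> hp ht; set P := (fun A => Alg (k + 3) A /\ R0 A).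
have fP : fin P by apply: (fin_sub (fin_Alg D (k + 3))) => A [].
have fA := @fin_Alg D k.
rewrite (ssum_split in_pi) //; set f := fun A => _.
rewrite [X in X + _ = _](_ : _ = ssum (@Alg D k) (fun A => g q.+1 * h' A)); last first.
  rewrite (@ssum_reindex _ _ _ (@Alg D k) (im (@hpi D))) //.
  - by apply: ssum_ext => A Ak; rewrite /f beta_pi hp.
  - by apply: (fin_sub fP) => A [].
  - move=> A Ak; split; first split; first exact: im_Alg (sim_pi D) _ _ Ak.
      by apply: (im_R0 (sim_pi D)); case: Ak.
    by move=> _ [y [_ ->]]; exists y.
  - move=> A [[Ak rA] pA].
    have [k' [A' [/eqP + A'k ->]]] := pre_Alg (sim_pi D) Ak rA pA.
    by rewrite eqn_add2r => /eqP e; exists A'; rewrite // e.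
  - by move=> A A' _ _; exact: (im_inj (sim_pi D)).
rewrite [X in _ + X = _](_ : _ = \sum_i ssum (@Alg D k) (fun A => if `[< ~ inB i A >] then g 1%N * h' A else 0)); last first.
  (* Outside pi L the Borel subalgebra modulo pi is unique, so the sum can be split according to
     it. *)
  have uniqB A : P A /\ ~ in_pi A -> exists i, forall j, inB j A <-> i = j.
    move=> [[Ak rA] nA]; have [i dir] := R0_dir Ak rA nA.
    have [k' [A' [_ _ eA]]] := pre_Alg (sim_theta i) Ak rA dir.
    exists i => j; rewrite eA; apply: inB_theta => iA'; apply: nA => x Ax.
    have : im (theta i) A' x by rewrite -eA.
    move=> [y [A'y ->]]; have [z ->] := theta_mod i y.
    have [c ->] := resZ (iA' _ A'y); exists (c *: nv i + z).
    by rewrite /hpi scalerDr scalerA.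
  rewrite (@ssum_ext _ _ _ (fun A => \sum_i (if `[< inB i A >] then f A else 0))); last first.
    move=> A /uniqB[i ui]; rewrite (bigD1 i) //= asboolT; last exact/ui.
    by rewrite big1 ?addr0 // => j ij; rewrite asboolF // => /ui /eqP; rewrite eq_sym (negbTE ij).
  rewrite ssum_sum; apply: eq_bigr => i _.
  have fP' : fin (fun A => P A /\ ~ in_pi A) by apply: (fin_sub fP) => A [].
  rewrite -(ssum_mkcond (inB i)) // -(ssum_mkcond (fun A => ~ inB i A)) //.
  rewrite (@ssum_reindex _ _ _ (fun A => Alg k A /\ ~ inB i A) (im (theta i))) //.
  - by apply: ssum_ext => A [Ak nA]; rewrite /f beta_theta // ht.
  - by apply: (fin_sub fP') => A [].
  - by apply: (fin_sub fA) => A [].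
  - move=> A [Ak nA]; split; last exact/inB_theta.
    split; first split; first exact: im_Alg (sim_theta i) _ _ Ak.
      by apply: (im_R0 (sim_theta i)); case: Ak.
    move=> pA; apply: nA => x Ax; have [y ey] := pA _ (ex_intro _ x (conj Ax erefl)).
    have [j ne] : exists j, i != j by case: (i) => [t|]; [exists None|exists (Some 0)].
    have /eqP : res (Bf (theta i x) (nv j)) = 0.
      by rewrite ey /hpi BfZl rmorphM /= res_unif mul0r.
    by rewrite theta_res mulf_eq0 res_nv (negbTE ne) orbF => /eqP.
  - move=> A [[[Ak rA] nA] iA]; have [j dir] := R0_dir Ak rA nA.
    have [j' uj] := uniqB A (conj (conj Ak rA) nA).
    have [k' [A' [/eqP + A'k eA]]] := pre_Alg (sim_theta j) Ak rA dir.
    rewrite eqn_add2r => /eqP ek.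
    have nj : ~ inB j A'.
      move=> jA'; apply: nA => x Ax; have : im (theta j) A' x by rewrite -eA.
      move=> [y [A'y ->]]; have [z ->] := theta_mod j y.
      have [c ->] := resZ (jA' _ A'y); exists (c *: nv j + z).
      by rewrite /hpi scalerDr scalerA.
    have ji : j = i by apply/(inB_theta _ nj); rewrite -eA.
    by exists A'; rewrite -?ji // ek.
  - by move=> A A' _ _; exact: (im_inj (sim_theta i)).
rewrite -ssum_sum -ssumD; apply: ssum_ext => A Ak.
rewrite -card_notinB mulrDl -mulrA mulr_suml; congr (_ + _); apply: eq_bigr => i _.
by case: ifP => _; rewrite ?mul1r ?mul0r.
Qed.

Lemma R0_ge3 k A : Alg k A -> R0 A -> (3 <= k)%N.
Proof.
move=> Ak rA; have [pA|nA] := pselect (in_pi A).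
  by have [k' [A' [-> _ _]]] := pre_Alg (sim_pi D) Ak rA pA; rewrite leq_addl.
have [i dir] := R0_dir Ak rA nA.
by have [k' [A' [-> _ _]]] := pre_Alg (sim_theta i) Ak rA dir; rewrite leq_addl.
Qed.

End Borels.


(** * Parents and children *)

Section ProjectivePoints.
Variable F : fieldType.

Definition normd (d : F * F * F) :=
  [|| d.1.1 == 1, (d.1.1 == 0) && (d.1.2 == 1) | [&& d.1.1 == 0, d.1.2 == 0 & d.2 == 1]].

Lemma normdP d : normd d ->
  [\/ d = (1, d.1.2, d.2), d = (0, 1, d.2) | d = (0, 0, 1)].
Proof.
case: d => [[a b] c]; rewrite /normd /= => /or3P[/eqP->|/andP[/eqP-> /eqP->]|/and3P[/eqP-> /eqP-> /eqP->]];
by [constructor 1|constructor 2|constructor 3].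
Qed.

Lemma normd_scale (a b c : F) : ~ [/\ a = 0, b = 0 & c = 0] ->
  exists r, r != 0 /\ normd (r * a, r * b, r * c).
Proof.
move=> nz; have [a0|a0] := eqVneq a 0; last first.
  by exists a^-1; rewrite invr_eq0 /normd /= mulVf ?eqxx.
have [b0|b0] := eqVneq b 0; last first.
  by exists b^-1; rewrite invr_eq0 /normd /= a0 mulr0 mulVf ?eqxx ?orbT.
have [c0|c0] := eqVneq c 0; first by case: nz.
by exists c^-1; rewrite invr_eq0 /normd /= a0 b0 !mulr0 mulVf ?eqxx ?orbT.
Qed.

Lemma normd_eq (d e : F * F * F) : normd d -> normd e ->
  d.1.1 * e.1.2 = d.1.2 * e.1.1 -> d.1.1 * e.2 = d.2 * e.1.1 ->
  d.1.2 * e.2 = d.2 * e.1.2 -> d = e.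
Proof.
have n01 : (0 : F) = 1 -> False by move/eqP; rewrite eq_sym oner_eq0.
have n10 : (1 : F) = 0 -> False by move/eqP; rewrite oner_eq0.
by case/normdP => -> /normdP[] -> /=; rewrite ?(mulr0, mul0r, mulr1, mul1r) => h1 h2 h3;
 first [by rewrite h1 h2|by rewrite h3|by case: n10|by case: n01|by []].
Qed.

End ProjectivePoints.

Section Parent.
Variable D : dvr.
Local Notation pi := (unif D).
Local Notation F := (resF D).
Local Notation q := #|resF D|.
Local Notation res := (res D).
Local Notation L := (sl2 D).
Implicit Types (A M : set L) (x y z v : L) (d : F * F * F).

(* For [A] in [R1], the index of [par A] is q times smaller. The algebras in [R1] with
   parent [A1] are the kernels of the functionals [d] on A1/pi A1 with S d = 0 modulo pi
   and d S d nonzero modulo pi^2, where S is the symmetric matrix of [SB]. *)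
Definition par A : set L := fun x => A (hpi x) /\ forall y, A y -> A (br x y).

Definition R1 k : set (set L) := fun A => [/\ Alg k A, ~ R0 A & ~ RU A].

Definition ker3 (w1 w2 w3 : L) d : set L := fun x => exists x1 x2 x3 : D,
  x = x1 *: w1 + x2 *: w2 + x3 *: w3 /\ d.1.1 * res x1 + d.1.2 * res x2 + d.2 * res x3 = 0.

Definition israd (s1 s2 s3 t : D) d := [&& res s1 * d.1.1 + res t * d.2 == 0,
  res s2 * d.1.2 == 0 & res t * d.1.1 + res s3 * d.2 == 0].

Definition Qd (s1 s2 s3 t : D) d : D :=
  s1 * rlift d.1.1 ^+ 2 + s2 * rlift d.1.2 ^+ 2 + s3 * rlift d.2 ^+ 2
  + 2%:R * t * rlift d.1.1 * rlift d.2.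

(** Two unit structure constants force the coordinates of pi x to be divisible by pi. Consequently
    an algebra that differs from its parent is not [RU]. *)
Lemma par_RU k A : Alg k A -> RU A -> par A = A.
Proof.
move=> Ak rA; have [sA cA _] := Ak; have [_ _ AZ] := sA.
have [v1 [v2 [v3 [s1 [s2 [s3 [o uu1 uu2 _]]]]]]] := RU_type Ak rA.
have [A1 A2 A3] := OB_mem o; have d0 := ob_det o.
have r1 : res s1 != 0 by rewrite -unit_resE.
have r2 : res s2 != 0 by rewrite -unit_resE.
have rp (s z : D) c : res s != 0 -> s * z = pi * c -> res z = 0.
  move=> rs e; apply/eqP; have /eqP : res (s * z) = 0 by rewrite e rmorphM /= res_unif mul0r.
  by rewrite rmorphM mulf_eq0 /= (negbTE rs).
apply/funext => x; apply/propext; split; last first.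
  by move=> Ax; split=> [|y Ay]; [exact: AZ|exact: cA].
move=> [/(ob_span o)[z1 [z2 [z3 ex]]] h].
have key v z (y1 y2 y3 : D) : A v -> br (hpi x) v = z -> z = y1 *: v1 + y2 *: v2 + y3 *: v3 ->
    [/\ exists c, y1 = pi * c, exists c, y2 = pi * c & exists c, y3 = pi * c].
  move=> Av <-; rewrite /hpi brZl; have /(ob_span o)[c1 [c2 [c3 ->]]] := h v Av.
  by rewrite !scalerDr !scalerA => /(det3_inj d0)[<- <- <-]; split; eexists.
have [|[c1 e1] [c2 e2] _] := key v3 _ (s1 * z2) (- (s2 * z1)) 0 A3 erefl.
  by rewrite ex !brE brxx (brC v1 v3) (ob_br1 o) (ob_br2 o); vec.
have z20 := rp _ _ _ r1 e1; have z10 : res z1 = 0 by apply: (rp s2 _ (- c2)); rewrite // mulrN -e2 opprK.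
have [|_ [c3 e3] _] := key v1 _ 0 (s2 * z3) (- (s3 * z2)) A1 erefl.
  by rewrite ex !brE brxx (brC v2 v1) (ob_br2 o) (ob_br3 o); vec.
have z30 := rp _ _ _ r2 e3.
have [[a1 ea1] [a2 ea2] [a3 ea3]] := And3 (resZ z10) (resZ z20) (resZ z30).
apply/(ob_span o); exists a1, a2, a3; apply: (sim_inj (sim_pi D)).
by rewrite ex ea1 ea2 ea3 /hpi; vec.
Qed.

Section Fiber.
Variables (k : nat) (A1 : set L) (w1 w2 w3 : L) (s1 s2 s3 t : D).
Hypothesis A1k : Alg k A1.
Hypothesis sb : SB A1 w1 w2 w3 s1 s2 s3 t.

Local Notation K := (ker3 w1 w2 w3).
Local Notation rad := (israd s1 s2 s3 t).
Local Notation Q := (Qd s1 s2 s3 t).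

Lemma ker3_mem d (x1 x2 x3 : D) : K d (x1 *: w1 + x2 *: w2 + x3 *: w3) <->
  d.1.1 * res x1 + d.1.2 * res x2 + d.2 * res x3 = 0.
Proof.
split=> [[y1 [y2 [y3 [/(det3_inj (sb_det sb))[<- <- <-]]]]]//|h].
by exists x1, x2, x3.
Qed.

Lemma ker3_submod d : submod (K d).
Proof.
split.
- by exists 0, 0, 0; rewrite !scale0r !addr0 rmorph0 !mulr0 !addr0.
- move=> x y [x1 [x2 [x3 [-> hx]]]] [y1 [y2 [y3 [-> hy]]]].
  exists (x1 + y1), (x2 + y2), (x3 + y3); split; first by vec.
  by rewrite !rmorphD /= -[RHS](addr0 0) -{1}hx -hy; ring.
- move=> r x [x1 [x2 [x3 [-> hx]]]]; exists (r * x1), (r * x2), (r * x3).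
  split; first by vec.
  by rewrite !rmorphM /= -[RHS](mulr0 (res r)) -hx; ring.
Qed.

Lemma ker3_sub d x : K d x -> A1 x.
Proof. by move=> [x1 [x2 [x3 [-> _]]]]; apply/(sb_span sb); exists x1, x2, x3. Qed.

Lemma ker3_pi d x : A1 x -> K d (hpi x).
Proof.
move=> /(sb_span sb)[x1 [x2 [x3 ->]]]; exists (pi * x1), (pi * x2), (pi * x3).
by split; [rewrite /hpi; vec|rewrite !rmorphM /= res_unif !mul0r !mulr0 !addr0].
Qed.

Lemma ker3_idx d : normd d -> relidx A1 (K d) q.
Proof.
move=> nd; have [e1 [e2 [e3 he]]] : exists e1 e2 e3 : D, d.1.1 * res e1 + d.1.2 * res e2 + d.2 * res e3 = 1.
  case/normdP: nd => ->; [exists 1, 0, 0|exists 0, 1, 0|exists 0, 0, 1];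
  by rewrite /= !rmorph1 !rmorph0 !(mulr1, mulr0, addr0, add0r).
pose e := e1 *: w1 + e2 *: w2 + e3 *: w3.
have he' (a : D) (x1 x2 x3 : D) : K d (x1 *: w1 + x2 *: w2 + x3 *: w3 - a *: e) <->
    d.1.1 * res x1 + d.1.2 * res x2 + d.2 * res x3 = res a.
  have -> : x1 *: w1 + x2 *: w2 + x3 *: w3 - a *: e =
    (x1 - a * e1) *: w1 + (x2 - a * e2) *: w2 + (x3 - a * e3) *: w3 by rewrite /e; vec.
  rewrite ker3_mem !rmorphB !rmorphM /=.
  have -> : d.1.1 * (res x1 - res a * res e1) + d.1.2 * (res x2 - res a * res e2) + d.2 * (res x3 - res a * res e3)
    = d.1.1 * res x1 + d.1.2 * res x2 + d.2 * res x3 - res a * (d.1.1 * res e1 + d.1.2 * res e2 + d.2 * res e3) by ring.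
  by rewrite he mulr1; split=> [/eqP|->]; rewrite ?subrr // subr_eq0 => /eqP.
apply: (@relidx_fin _ _ A1 (K d) F (fun a => rlift a *: e)).
- by move=> a; case: A1k => -[_ _ AZ] _ _; apply: AZ; apply/(sb_span sb); exists e1, e2, e3.
- move=> x /(sb_span sb)[x1 [x2 [x3 ->]]]; eexists; apply/he'; rewrite rliftK; reflexivity.
- move=> a b; rewrite -scalerBl.
  have -> : (rlift a - rlift b) *: e = 0 *: w1 + 0 *: w2 + 0 *: w3 - (rlift b - rlift a) *: e by vec.
  move/he'; rewrite rmorph0 !mulr0 !addr0 rmorphB /= !rliftK => /eqP.
  by rewrite eq_sym subr_eq0 eq_sym => /eqP.
Qed.

(** The bracket has coordinates S (x * y), with * the cross product, and S is symmetric; so d takes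
    the value (S d) . (x * y) on it. *)
Lemma ker3_br d x y : rad d -> A1 x -> A1 y -> K d (br x y).
Proof.
move=> /and3P[/eqP h1 /eqP h2 /eqP h3].
move=> /(sb_span sb)[x1 [x2 [x3 ->]]] /(sb_span sb)[y1 [y2 [y3 ->]]].
rewrite (SB_br _ _ _ _ _ _ sb) ker3_mem !rmorphD !rmorphM !rmorphB !rmorphM /=.
set m1 := (res x2 * res y3 - _); set m2 := (res x3 * res y1 - _); set m3 := (res x1 * res y2 - _).
transitivity (m1 * (res s1 * d.1.1 + res t * d.2) + m2 * (res s2 * d.1.2)
  + m3 * (res t * d.1.1 + res s3 * d.2)); first by ring.
by rewrite h1 h2 h3 !mulr0 !addr0.
Qed.

Lemma ker3_Alg d : normd d -> rad d -> Alg k.+1 (K d).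
Proof.
move=> nd rd; have [sA cA iA] := A1k; split; first exact: ker3_submod.
  by move=> x y /ker3_sub Ax /ker3_sub Ay; apply: ker3_br.
rewrite expnSr; apply: (relidx_tower _ _ _ _ _ iA (ker3_idx nd)) => //.
- exact: ker3_submod.
- exact: ker3_sub.
Qed.

(** g is S d divided by pi, on the lift of d. The condition on d S d modulo pi^2 becomes a condition
    on g . d modulo pi. *)
Definition Qg (d : F * F * F) (g1 g2 g3 : D) :=
  [/\ s1 * rlift d.1.1 + t * rlift d.2 = pi * g1, s2 * rlift d.1.2 = pi * g2
    & t * rlift d.1.1 + s3 * rlift d.2 = pi * g3].

Lemma rad_Qg d : rad d -> exists g1 g2 g3, Qg d g1 g2 g3.
Proof.
move=> /and3P[/eqP h1 /eqP h2 /eqP h3].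
have [|g1 e1] := @resZ D (s1 * rlift d.1.1 + t * rlift d.2).
  by rewrite rmorphD !rmorphM /= !rliftK.
have [|g2 e2] := @resZ D (s2 * rlift d.1.2); first by rewrite rmorphM /= rliftK.
have [|g3 e3] := @resZ D (t * rlift d.1.1 + s3 * rlift d.2).
  by rewrite rmorphD !rmorphM /= !rliftK.
by exists g1, g2, g3.
Qed.

Lemma Qd_Qg d g1 g2 g3 : Qg d g1 g2 g3 ->
  Q d = pi * (g1 * rlift d.1.1 + g2 * rlift d.1.2 + g3 * rlift d.2).
Proof.
move=> [h1 h2 h3]; rewrite !mulrDr !(mulrA pi) -h1 -h2 -h3 /Qd; ring.
Qed.

Lemma Qd_pdvd d g1 g2 g3 : Qg d g1 g2 g3 ->
  pdvd 2 (Q d) <-> d.1.1 * res g1 + d.1.2 * res g2 + d.2 * res g3 = 0.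
Proof.
move=> /Qd_Qg ->; split=> [/(@pdvd_mulI D 1 1)/resP|h].
  by rewrite !rmorphD !rmorphM /= !rliftK => <-; ring.
apply: (pdvdMM (pdvd_pow D 1)); apply/resP.
by rewrite !rmorphD !rmorphM /= !rliftK -h; ring.
Qed.

(* The vectors e_j * d span the kernel of d modulo pi. *)
Definition cr1 d : L := 0 *: w1 + (- rlift d.2) *: w2 + rlift d.1.2 *: w3.
Definition cr2 d : L := rlift d.2 *: w1 + 0 *: w2 + (- rlift d.1.1) *: w3.
Definition cr3 d : L := (- rlift d.1.2) *: w1 + rlift d.1.1 *: w2 + 0 *: w3.

Lemma cr_mem d : [/\ K d (cr1 d), K d (cr2 d) & K d (cr3 d)].
Proof. by split; apply/ker3_mem; rewrite ?rmorphN ?rmorph0 /= !rliftK; ring. Qed.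

(** Up to sign (e_j * d) * (e_k * d) is d_i d, so the brackets of these kernel vectors are d_i S d =
    pi d_i g. Were the kernel [R0], all d_i g would lie in it, so that g . d = 0 modulo pi. *)
Lemma ker3_nR0 d : normd d -> rad d -> ~ pdvd 2 (Q d) -> ~ R0 (K d).
Proof.
move=> nd rd nQ r0; have [g1 [g2 [g3 gg]]] := rad_Qg rd; apply: nQ; apply/(Qd_pdvd gg).
have [K1 K2 K3] := cr_mem d; case: gg => h1 h2 h3.
set S := _ + _.
have key x y (r : D) : K d x -> K d y ->
    br x y = (pi * (r * g1)) *: w1 + (pi * (r * g2)) *: w2 + (pi * (r * g3)) *: w3 -> res r * S = 0.
  move=> Kx Ky e; have [z [Kz ez]] := r0 _ _ Kx Ky.
  have : K d ((r * g1) *: w1 + (r * g2) *: w2 + (r * g3) *: w3).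
    rewrite (_ : _ + _ + _ = z) //; apply: (sim_inj (sim_pi D)).
    by rewrite /hpi -ez e; vec.
  by move/ker3_mem; rewrite !rmorphM /= /S => <-; ring.
have e1 : d.1.1 * S = 0.
  rewrite -(rliftK d.1.1); apply: (key _ _ _ K2 K3).
  by rewrite /cr2 /cr3 (SB_br _ _ _ _ _ _ sb) !(mulrCA pi) -h1 -h2 -h3; vec.
have e2 : d.1.2 * S = 0.
  rewrite -(rliftK d.1.2); apply: (key _ _ _ K3 K1).
  by rewrite /cr1 /cr3 (SB_br _ _ _ _ _ _ sb) !(mulrCA pi) -h1 -h2 -h3; vec.
have e3 : d.2 * S = 0.
  rewrite -(rliftK d.2); apply: (key _ _ _ K1 K2).
  by rewrite /cr1 /cr2 (SB_br _ _ _ _ _ _ sb) !(mulrCA pi) -h1 -h2 -h3; vec.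
by move: e1 e2 e3; case/normdP: nd => -> /=; rewrite ?mul1r.
Qed.

(** Let x be in the parent and let z be the coordinates of pi x. That d vanishes on [x, e_j * d]
    means g . (z * (e_j * d)) = 0, i.e. (g . d) z_j = g_j (d . z) = 0 modulo pi. As g . d is nonzero
    modulo pi, z is divisible by pi. *)
Lemma ker3_par d : normd d -> rad d -> ~ pdvd 2 (Q d) -> par (K d) = A1.
Proof.
move=> nd rd nQ; have [g1 [g2 [g3 gg]]] := rad_Qg rd.
apply/funext => x; apply/propext; split; last first.
  by move=> Ax; split; [exact: ker3_pi|move=> y /ker3_sub Ay; exact: ker3_br].
move=> [[z1 [z2 [z3 [ex hz]]]] hx].
have [K1 K2 K3] := cr_mem d; have d0 := sb_det sb; have [h1 h2 h3] := gg.
have {}nQ : d.1.1 * res g1 + d.1.2 * res g2 + d.2 * res g3 != 0 by apply/eqP => /(Qd_pdvd gg).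
have key y (y1 y2 y3 : D) : y = y1 *: w1 + y2 *: w2 + y3 *: w3 -> K d y ->
   res (g1 * (z2 * y3 - z3 * y2) + g2 * (z3 * y1 - z1 * y3) + g3 * (z1 * y2 - z2 * y1)) = 0.
  move=> ey Ky; have [c1 [c2 [c3 [ec hc]]]] := hx _ Ky.
  have := congr1 (@hpi D) ec; rewrite /hpi -brZl -/(hpi x) ex ey (SB_br _ _ _ _ _ _ sb) !scalerDr !scalerA.
  move=> /(det3_inj d0)[f1 f2 f3].
  have : pi * (g1 * (z2 * y3 - z3 * y2) + g2 * (z3 * y1 - z1 * y3) + g3 * (z1 * y2 - z2 * y1)) =
    pi * (rlift d.1.1 * c1 + rlift d.1.2 * c2 + rlift d.2 * c3).
    transitivity ((pi * g1) * (z2 * y3 - z3 * y2) + (pi * g2) * (z3 * y1 - z1 * y3)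
      + (pi * g3) * (z1 * y2 - z2 * y1)); first by ring.
    rewrite -h1 -h2 -h3.
    transitivity (rlift d.1.1 * (pi * c1) + rlift d.1.2 * (pi * c2) + rlift d.2 * (pi * c3)); last by ring.
    rewrite -f1 -f2 -f3; ring.
  move/(mulfI (unif_neq0 D)) => ->; rewrite !rmorphD !rmorphM /= !rliftK; exact: hc.
have k1 := key _ _ _ _ erefl K1; have k2 := key _ _ _ _ erefl K2; have k3 := key _ _ _ _ erefl K3.
rewrite !(rmorphD, rmorphM, rmorphN, rmorph0) /= !rliftK in k1 k2 k3.
set S := _ + _ in nQ.
have fin' (z : D) g : res z * S = g * (d.1.1 * res z1 + d.1.2 * res z2 + d.2 * res z3) ->
    exists c, z = pi * c.
  rewrite hz mulr0 => /eqP; rewrite mulf_eq0 (negbTE nQ) orbF => /eqP; exact: resZ.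
have [a1 e1] : exists c, z1 = pi * c.
  apply: (fin' _ (res g1)); rewrite -[RHS]subr0 -[X in _ - X]k1 /S; ring.
have [a2 e2] : exists c, z2 = pi * c.
  apply: (fin' _ (res g2)); rewrite -[RHS]subr0 -[X in _ - X]k2 /S; ring.
have [a3 e3] : exists c, z3 = pi * c.
  apply: (fin' _ (res g3)); rewrite -[RHS]subr0 -[X in _ - X]k3 /S; ring.
apply/(sb_span sb); exists a1, a2, a3; apply: (sim_inj (sim_pi D)).
by rewrite ex e1 e2 e3 /hpi; vec.
Qed.

Lemma ker3_R1 d : normd d -> rad d -> ~ pdvd 2 (Q d) -> R1 k.+1 (K d).
Proof.
move=> nd rd nQ; have Ka := ker3_Alg nd rd; split=> //; first exact: ker3_nR0.
move=> rU; have := par_RU Ka rU; rewrite ker3_par // => e.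
have := ker3_idx nd; rewrite -e => h; have := relidx_full (let: And3 a _ _ := A1k in a) (ltnW (q_gt1 D)) h.
by move=> e1; have := q_gt1 D; rewrite e1.
Qed.

Lemma ker3_inj d d' : normd d -> normd d' -> K d = K d' -> d = d'.
Proof.
move=> nd nd' e; have [K1 K2 K3] := cr_mem d.
rewrite e in K1 K2 K3.
move: K1 K2 K3; rewrite !ker3_mem !rmorphN !rmorph0 /= !rliftK => h1 h2 h3.
apply: normd_eq => //; apply/eqP; rewrite -subr_eq0; apply/eqP.
- by rewrite -h3; ring.
- by rewrite -[RHS]oppr0 -h2; ring.
- by rewrite -h1; ring.
Qed.

(** If s_1 is the only unit, then v1 / pi, v2, v3 is a basis of the parent, in which A is the kernel
    of the first coordinate modulo pi. This functional is then rewritten in the basis w. *)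
Lemma R1_ker3 A : R1 k.+1 A -> par A = A1 -> exists2 d, normd d & A = K d.
Proof.
move=> [Ak nr0 nrU] pA; have [v1 [v2 [v3 [r1 [r2 [r3 [b [c [u2 [u3 [o uu1 [e2 _] [e3 _] _]]]]]]]]]]] := R1_type Ak nr0 nrU.
have [sA cA iA] := Ak; have [A0 AD AZ] := sA; have d0 := ob_det o.
have [sA1 _ iA1] := A1k.
have AA1 x : A x -> A1 x.
  by move=> Ax; rewrite -pA; split=> [|y Ay]; [exact: AZ|exact: cA].
have rr1 : res r1 != 0 by rewrite -unit_resE.
have rp (z : D) c' : r1 * z = pi * c' -> exists c, z = pi * c.
  move=> e; apply: resZ; apply/eqP; have /eqP : res (r1 * z) = 0 by rewrite e rmorphM /= res_unif mul0r.
  by rewrite rmorphM mulf_eq0 /= (negbTE rr1).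
have [A_1 A_2 A_3] := OB_mem o.
have pA1 x : A1 x -> exists z1 z2 z3 : D, hpi x = z1 *: v1 + (pi * z2) *: v2 + (pi * z3) *: v3.
  rewrite -pA => -[/(ob_span o)[z1 [z2 [z3 ex]]] h].
  have [a1 [a2 [a3 ea]]] := (ob_span o _).1 (h _ A_2).
  have [b1 [b2 [b3 eb]]] := (ob_span o _).1 (h _ A_3).
  have [|z3' ez3] := rp z3 (- a1).
    have := congr1 (@hpi D) ea; rewrite /hpi -brZl -/(hpi x) ex !scalerDr !scalerA.
    rewrite !brE brxx (brC v3 v2) (ob_br1 o) (ob_br3 o).
    have -> : z1 *: (r3 *: v3) + z2 *: 0 + z3 *: - (r1 *: v1) = (- (r1 * z3)) *: v1 + 0 *: v2 + (z1 * r3) *: v3 by vec.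
    by move=> /(det3_inj d0)[f _ _]; rewrite mulrN -f opprK.
  have [|z2' ez2] := rp z2 b1.
    have := congr1 (@hpi D) eb; rewrite /hpi -brZl -/(hpi x) ex !scalerDr !scalerA.
    rewrite !brE brxx (brC v1 v3) (ob_br1 o) (ob_br2 o).
    have -> : z1 *: - (r2 *: v2) + z2 *: (r1 *: v1) + z3 *: 0 = (r1 * z2) *: v1 + (- (z1 * r2)) *: v2 + 0 *: v3 by vec.
    by move=> /(det3_inj d0)[-> _ _].
  by exists z1, z2', z3'; rewrite ex ez2 ez3.
(* The two indices differ, so the parent has an element outside A. The coordinate of pi x0 on [v1]
   is a unit, and this makes [v1] divisible by pi in the parent. *)
have [x0 A1x0 nAx0] : exists2 x, A1 x & ~ A x.
  apply: contrapT => H; have e : A = A1.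
    apply/funext => x; apply/propext; split; first exact: AA1.
    by move=> A1x; apply: contrapT => nA; apply: H; exists x.
  rewrite e in iA; have := powq_inj (relidx_uniq sA1 iA1 iA); lia.
have [z1 [z2 [z3 ez]]] := pA1 _ A1x0.
have uz1 : z1 \is a GRing.unit.
  rewrite unit_resE; apply/eqP => /resZ[c1 ec]; apply: nAx0.
  have -> : x0 = c1 *: v1 + z2 *: v2 + z3 *: v3; last by apply/(ob_span o); exists c1, z2, z3.
  by apply: (sim_inj (sim_pi D)); rewrite ez ec /hpi; vec.
pose v1' := z1^-1 *: (x0 - (z2 *: v2 + z3 *: v3)).
have ev1 : v1 = hpi v1'.
  have -> : v1 = z1^-1 *: (z1 *: v1) by rewrite scalerA mulVr // scale1r.
  have -> : hpi v1' = z1^-1 *: (hpi x0 - hpi (z2 *: v2 + z3 *: v3)) by rewrite /v1' /hpi; vec.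
  by congr (_ *: _); rewrite ez /hpi; vec.
have A1v : A1 v1'.
  case: (sA1) => _ D1 Z1; apply: Z1; apply: submodB => //; apply: AA1.
  by apply: AD; apply: AZ.
have A1P x : A1 x -> exists y1 y2 y3 : D, x = y1 *: v1' + y2 *: v2 + y3 *: v3.
  move=> /pA1[y1 [y2 [y3 e]]]; exists y1, y2, y3; apply: (sim_inj (sim_pi D)).
  by rewrite e ev1 /hpi; vec.
have AP (y1 y2 y3 : D) : A (y1 *: v1' + y2 *: v2 + y3 *: v3) <-> res y1 = 0.
  split.
    move=> /(ob_span o)[c1 [c2 [c3]]] /(congr1 (@hpi D)); rewrite /hpi => e.
    have : y1 *: v1 + (pi * y2) *: v2 + (pi * y3) *: v3 = (pi * c1) *: v1 + (pi * c2) *: v2 + (pi * c3) *: v3.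
      rewrite {1}ev1 /hpi -(scalerA pi c1) -(scalerA pi c2) -(scalerA pi c3) -!scalerDr -e; vec.
    by move=> /(det3_inj d0)[-> _ _]; rewrite rmorphM /= res_unif mul0r.
  move=> /resZ[c1 ->]; apply/(ob_span o); exists c1, y2, y3; rewrite ev1 /hpi; vec.
have [W1 W2 W3] : [/\ A1 w1, A1 w2 & A1 w3].
  by have [? ? ?] := span3_mem w1 w2 w3; split; apply/(sb_span sb).
have [a1 [a2 [a3 ea]]] := A1P _ W1; have [b1 [b2 [b3 eb]]] := A1P _ W2; have [c1 [c2 [c3 ec]]] := A1P _ W3.
have AK (x1 x2 x3 : D) : A (x1 *: w1 + x2 *: w2 + x3 *: w3) <-> res a1 * res x1 + res b1 * res x2 + res c1 * res x3 = 0.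
  have -> : x1 *: w1 + x2 *: w2 + x3 *: w3 = (x1 * a1 + x2 * b1 + x3 * c1) *: v1'
     + (x1 * a2 + x2 * b2 + x3 * c2) *: v2 + (x1 * a3 + x2 * b3 + x3 * c3) *: v3.
    by rewrite ea eb ec; vec.
  rewrite AP !rmorphD !rmorphM /= (mulrC (res a1)) (mulrC (res b1)) (mulrC (res c1)) //.
have [|r [r0 nd]] := @normd_scale F (res a1) (res b1) (res c1).
  move=> [h1 h2 h3]; apply: nAx0; have /(sb_span sb)[x1 [x2 [x3 ->]]] := A1x0.
  by apply/AK; rewrite h1 h2 h3 !mul0r !addr0.
exists (r * res a1, r * res b1, r * res c1) => //.
apply/funext => x; apply/propext; split.
  move=> Ax; have /(sb_span sb)[x1 [x2 [x3 ex]]] := AA1 _ Ax; rewrite ex.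
  apply/ker3_mem; rewrite /= -!mulrA -!mulrDr; rewrite ex in Ax.
  by rewrite (AK x1 x2 x3).1 ?mulr0.
move=> [x1 [x2 [x3 [-> h]]]]; apply/AK; move: h; rewrite /= -!mulrA -!mulrDr => /eqP.
by rewrite mulf_eq0 (negbTE r0) => /eqP.
Qed.

(** The bracket with any element of the parent preserves the kernel, so S d modulo pi is orthogonal
    to all e_i * (e_j * d); for nonzero d these span the whole space. *)
Lemma par_rad d : normd d -> par (K d) = A1 -> rad d.
Proof.
move=> nd pK; have [K1 K2 K3] := cr_mem d.
have [W1 W2 W3] : [/\ par (K d) w1, par (K d) w2 & par (K d) w3].
  by rewrite pK; have [? ? ?] := span3_mem w1 w2 w3; split; apply/(sb_span sb).
set g1 := res s1 * d.1.1 + res t * d.2; set g2 := res s2 * d.1.2; set g3 := res t * d.1.1 + res s3 * d.2.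
have key x y (x1 x2 x3 y1 y2 y3 : D) : par (K d) x -> K d y ->
    x = x1 *: w1 + x2 *: w2 + x3 *: w3 -> y = y1 *: w1 + y2 *: w2 + y3 *: w3 ->
    g1 * (res x2 * res y3 - res x3 * res y2) + g2 * (res x3 * res y1 - res x1 * res y3)
     + g3 * (res x1 * res y2 - res x2 * res y1) = 0.
  move=> [_ hx] Ky ex ey; have := hx _ Ky; rewrite ex ey (SB_br _ _ _ _ _ _ sb) ker3_mem => h.
  rewrite -[RHS]h !(rmorphD, rmorphM, rmorphB) /= /g1 /g2 /g3; ring.
have E1 : w1 = 1 *: w1 + 0 *: w2 + 0 *: w3 by rewrite scale1r !scale0r !addr0.
have E2 : w2 = 0 *: w1 + 1 *: w2 + 0 *: w3 by rewrite scale1r !scale0r addr0 add0r.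
have E3 : w3 = 0 *: w1 + 0 *: w2 + 1 *: w3 by rewrite scale1r !scale0r !add0r.
have k11 := key _ _ _ _ _ _ _ _ W1 K1 E1 erefl; have k12 := key _ _ _ _ _ _ _ _ W1 K2 E1 erefl.
have k13 := key _ _ _ _ _ _ _ _ W1 K3 E1 erefl; have k21 := key _ _ _ _ _ _ _ _ W2 K1 E2 erefl.
have k22 := key _ _ _ _ _ _ _ _ W2 K2 E2 erefl; have k23 := key _ _ _ _ _ _ _ _ W2 K3 E2 erefl.
have k31 := key _ _ _ _ _ _ _ _ W3 K1 E3 erefl; have k32 := key _ _ _ _ _ _ _ _ W3 K2 E3 erefl.
have k33 := key _ _ _ _ _ _ _ _ W3 K3 E3 erefl.
rewrite !(rmorphN, rmorph0, rmorph1) /= !rliftK in k11 k12 k13 k21 k22 k23 k31 k32 k33.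
rewrite /israd -/g1 -/g2 -/g3; move: g1 g2 g3 k11 k12 k13 k21 k22 k23 k31 k32 k33 {key} => g1 g2 g3.
move: d nd {pK K1 K2 K3 W1 W2 W3} => d /normdP[] -> /= k11 k12 k13 k21 k22 k23 k31 k32 k33.
- have g20 : g2 = 0 by rewrite -k12; ring.
  have g30 : g3 = 0 by rewrite -k13; ring.
  have g10 : g1 = 0 by rewrite -[RHS]oppr0 -k22 g30; ring.
  by rewrite g10 g20 g30 eqxx.
- have g10 : g1 = 0 by rewrite -k21; ring.
  have g30 : g3 = 0 by rewrite -k23; ring.
  have g20 : g2 = 0 by rewrite -[RHS]oppr0 -k11 g30; ring.
  by rewrite g10 g20 g30 eqxx.
- have g10 : g1 = 0 by rewrite -k31; ring.
  have g20 : g2 = 0 by rewrite -k32; ring.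
  have g30 : g3 = 0 by rewrite -[RHS]oppr0 -k11; ring.
  by rewrite g10 g20 g30 eqxx.
Qed.

End Fiber.

End Parent.


(** * Counting the algebras with a given parent *)

Section Children.
Variable D : dvr.
Local Notation pi := (unif D).
Local Notation F := (resF D).
Local Notation q := #|resF D|.
Local Notation res := (res D).
Local Notation L := (sl2 D).
Implicit Types (A M : set L) (x y z v : L) (d : F * F * F).

Section Fiber.
Variables (k : nat) (A1 : set L) (w1 w2 w3 : L) (s1 s2 s3 t : D).
Hypothesis A1k : Alg k A1.
Hypothesis sb : SB A1 w1 w2 w3 s1 s2 s3 t.
Local Notation K := (ker3 w1 w2 w3).
Local Notation rad := (israd s1 s2 s3 t).
Local Notation Q := (Qd s1 s2 s3 t).

Lemma cross_ker (d1 d2 d3 x1 x2 x3 y1 y2 y3 : F) : normd (d1, d2, d3) ->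
  d1 * x1 + d2 * x2 + d3 * x3 = 0 -> d1 * y1 + d2 * y2 + d3 * y3 = 0 ->
  exists l, [/\ x2 * y3 - x3 * y2 = l * d1, x3 * y1 - x1 * y3 = l * d2
    & x1 * y2 - x2 * y1 = l * d3].
Proof.
move=> /normdP[/= [->]|/= [-> ->]|/= [-> -> ->]]; rewrite ?mul1r ?mul0r ?add0r => hx hy.
- exists (x2 * y3 - x3 * y2).
  have -> : x1 = - (d2 * x2 + d3 * x3) by apply/eqP; rewrite -addr_eq0 addrA hx.
  have -> : y1 = - (d2 * y2 + d3 * y3) by apply/eqP; rewrite -addr_eq0 addrA hy.
  by split; ring.
- exists (x3 * y1 - x1 * y3).
  have -> : x2 = - (d3 * x3) by apply/eqP; rewrite -addr_eq0 hx.
  have -> : y2 = - (d3 * y3) by apply/eqP; rewrite -addr_eq0 hy.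
  by split; ring.
- by exists (x1 * y2 - x2 * y1); rewrite hx hy; split; ring.
Qed.

(** For x, y in the kernel the cross product is l d + pi n, so the bracket is pi (l g + S n); and d
    kills l g + S n because g . d and S d vanish modulo pi. Hence the points left out of [nchild]
    give no algebra in [R1]. *)
Lemma ker3_R0 d : normd d -> rad d -> pdvd 2 (Q d) -> R0 (K d).
Proof.
move=> nd rd hQ; have [g1 [g2 [g3 gg]]] := rad_Qg rd.
have {}hQ := (Qd_pdvd gg).1 hQ; case: gg => h1 h2 h3.
move=> _ _ [x1 [x2 [x3 [-> hx]]]] [y1 [y2 [y3 [-> hy]]]].
have [l [e1 e2 e3]] := @cross_ker d.1.1 d.1.2 d.2 _ _ _ _ _ _ (ltac:(by case: (d) nd => [[]])) hx hy.
have lft (m : D) a : res m = l * a -> exists n, m = rlift l * rlift a + pi * n.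
  move=> e; have [|n en] := @resZ D (m - rlift l * rlift a).
    by rewrite rmorphB rmorphM /= !rliftK e subrr.
  by exists n; rewrite -en addrC subrK.
have [|n1 f1] := @lft (x2 * y3 - x3 * y2) d.1.1; first by rewrite rmorphB !rmorphM.
have [|n2 f2] := @lft (x3 * y1 - x1 * y3) d.1.2; first by rewrite rmorphB !rmorphM.
have [|n3 f3] := @lft (x1 * y2 - x2 * y1) d.2; first by rewrite rmorphB !rmorphM.
rewrite (SB_br _ _ _ _ _ _ sb) f1 f2 f3.
exists ((rlift l * g1 + (s1 * n1 + t * n3)) *: w1 + (rlift l * g2 + s2 * n2) *: w2
  + (rlift l * g3 + (t * n1 + s3 * n3)) *: w3); split.
  apply/(ker3_mem sb); rewrite !(rmorphD, rmorphM) /= rliftK.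
  case/and3P: rd => /eqP r1 /eqP r2 /eqP r3.
  transitivity (l * (d.1.1 * res g1 + d.1.2 * res g2 + d.2 * res g3)
    + res n1 * (res s1 * d.1.1 + res t * d.2) + res n2 * (res s2 * d.1.2)
    + res n3 * (res t * d.1.1 + res s3 * d.2)); first by ring.
  by rewrite hQ r1 r2 r3 !mulr0 !addr0.
have E1 : s1 * (rlift l * rlift d.1.1 + pi * n1) + t * (rlift l * rlift d.2 + pi * n3)
  = pi * (rlift l * g1 + (s1 * n1 + t * n3)).
  by transitivity (rlift l * (s1 * rlift d.1.1 + t * rlift d.2) + pi * (s1 * n1 + t * n3));
    [|rewrite h1]; ring.
have E2 : s2 * (rlift l * rlift d.1.2 + pi * n2) = pi * (rlift l * g2 + s2 * n2).
  by transitivity (rlift l * (s2 * rlift d.1.2) + pi * (s2 * n2)); [|rewrite h2]; ring.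
have E3 : t * (rlift l * rlift d.1.1 + pi * n1) + s3 * (rlift l * rlift d.2 + pi * n3)
  = pi * (rlift l * g3 + (t * n1 + s3 * n3)).
  by transitivity (rlift l * (t * rlift d.1.1 + s3 * rlift d.2) + pi * (t * n1 + s3 * n3));
    [|rewrite h3]; ring.
by rewrite E1 E2 E3; vec.
Qed.

Definition nchild := #|[pred d : F * F * F | [&& normd d, rad d & ~~ `[< pdvd 2 (Q d) >]]]|.

Lemma csize_children : csize (fun A => R1 k.+1 A /\ par A = A1) = nchild.
Proof.
suff [] : fin (fun A => R1 k.+1 A /\ par A = A1) /\ csize (fun A => R1 k.+1 A /\ par A = A1) = nchild by [].
apply: (@csize_fin _ _ (F * F * F)%type _ (fun d => K d)).
- by move=> d /and3P[nd rd /asboolPn nQ]; split; [exact: (ker3_R1 A1k sb)|exact: (ker3_par sb)].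
- move=> A [rA pA]; have [d nd eA] := R1_ker3 A1k sb rA pA.
  exists d => //; rewrite eA in pA rA; have rd := par_rad sb nd pA.
  apply/and3P; split=> //; apply/asboolPn => hQ.
  by case: rA => _ + _; apply; apply: ker3_R0.
- by move=> d d' /and3P[nd _ _] /and3P[nd' _ _]; apply: (ker3_inj sb).
Qed.

End Fiber.

Lemma sq0 (K : idomainType) (a : K) : a ^+ 2 = 0 -> a = 0.
Proof. by move/eqP; rewrite expf_eq0 => /eqP. Qed.

(** Two orthogonal isotropic vectors of the ternary norm form are proportional: the square of each
    minor lies in the ideal of the three relations. *)
Lemma nil_cross (K : idomainType) (a b c a' b' c' : K) : a * c + b ^+ 2 = 0 ->
  a' * c' + b' ^+ 2 = 0 -> a * c' + c * a' + 2%:R * (b * b') = 0 ->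
  [/\ b * a' - a * b' = 0, a * c' - c * a' = 0 & c * b' - b * c' = 0].
Proof.
move=> h1 h2 h3; split; apply: sq0.
- transitivity (- (a * a') * (a * c' + c * a' + 2%:R * (b * b')) + (a * c + b ^+ 2) * a' ^+ 2
    + (a' * c' + b' ^+ 2) * a ^+ 2); first by ring.
  by rewrite h1 h2 h3; ring.
- transitivity ((a * c' + c * a' + 2%:R * (b * b')) * (a * c' + c * a' - 2%:R * (b * b'))
    - 4%:R * (a * c + b ^+ 2) * (a' * c') + 4%:R * (a' * c' + b' ^+ 2) * b ^+ 2); first by ring.
  by rewrite h1 h2 h3; ring.
- transitivity (- (c * c') * (a * c' + c * a' + 2%:R * (b * b')) + (a * c + b ^+ 2) * c' ^+ 2
    + (a' * c' + b' ^+ 2) * c ^+ 2); first by ring.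
  by rewrite h1 h2 h3; ring.
Qed.

Lemma br_nil (x y : L) : res (Nm x) = 0 -> res (Nm y) = 0 -> Bf x y = 0 ->
  exists z, br x y = hpi z.
Proof.
move=> hx hy hb; have {}hb : res (Bf x y) = 0 by rewrite hb rmorph0.
have {}hx : res x.1.1 * res x.2 + res x.1.2 ^+ 2 = 0 by rewrite -rmorphXn -rmorphM -rmorphD.
have {}hy : res y.1.1 * res y.2 + res y.1.2 ^+ 2 = 0 by rewrite -rmorphXn -rmorphM -rmorphD.
have {}hb : res x.1.1 * res y.2 + res x.2 * res y.1.1 + 2%:R * (res x.1.2 * res y.1.2) = 0.
  by rewrite -(rmorph_nat res) -!rmorphM -!rmorphD.
have [h1 h2 h3] := nil_cross hx hy hb.
have [|z1 e1] := @resZ D (x.1.2 * y.1.1 - x.1.1 * y.1.2); first by rewrite rmorphB !rmorphM.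
have [|z2 e2] := @resZ D (x.1.1 * y.2 - x.2 * y.1.1); first by rewrite rmorphB !rmorphM.
have [|z3 e3] := @resZ D (x.2 * y.1.2 - x.1.2 * y.2); first by rewrite rmorphB !rmorphM.
exists (2%:R * z1, z2, 2%:R * z3); rewrite /br e1 e2 e3 /hpi.
by apply: sl2P; crd; cbn [fst snd]; ring.
Qed.

Lemma gBi_br_ga i (x y : L) : (gBi i (br x y)).2 = (br (gBi i x) (gBi i y)).2.
Proof. by case: i => [t|]; gsimp; ring. Qed.

(** Without unit norms, the basis vectors v2 and v3 are isotropic and orthogonal modulo pi, hence
    proportional. So [v2, v3] is divisible by pi in L, and with it the vector v1, since s1 is a
    unit. Dividing v1 by pi removes a factor pi from the second and third structure constants and
    adds one to the first. *)
Lemma par_Alg k A : R1 k.+1 A -> exists v1 v2 v3 s1 s2 s3 b c u2 u3,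
  [/\ OB A (hpi v1) v2 v3 s1 (pi * s2) (pi * s3), OB (par A) v1 v2 v3 (pi * s1) s2 s3,
   [/\ s1 \is a GRing.unit, s2 = u2 * pi ^+ b, u2 \is a GRing.unit,
   s3 = u3 * pi ^+ c & u3 \is a GRing.unit], k = (b + c).+1
   & Alg k (par A) /\ beta (par A) = beta A].
Proof.
move=> [Ak nr0 nrU].
have [v1 [v2 [v3 [s1 [s2 [s3 [b [c [u2 [u3 [o uu1 [e2 uu2] [e3 uu3] ek]]]]]]]]]]] := R1_type Ak nr0 nrU.
case: ek => ek; have [sA cA iA] := Ak; have [A0 AD AZ] := sA; have d0 := ob_det o.
have [A1 A2 A3] := OB_mem o; have rr1 : res s1 != 0 by rewrite -unit_resE.
have hN v : A v -> res (Nm v) = 0.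
  by move=> Av; apply/eqP/negPn/negP => h; apply: nrU; exists v.
have [z ez] := br_nil (hN _ A2) (hN _ A3) (ob_23 o).
have [v1' ev1] : exists v1' : L, v1 = hpi v1'.
  by exists (s1^-1 *: z); rewrite /hpi scalerA mulrC -scalerA -/(hpi z) -ez (ob_br1 o) scalerA mulVr // scale1r.
pose t2 := u2 * pi ^+ b; pose t3 := u3 * pi ^+ c.
have et2 : s2 = pi * t2 by rewrite e2 /t2 exprS mulrCA.
have et3 : s3 = pi * t3 by rewrite e3 /t3 exprS mulrCA.
have hi x y : hpi x = hpi y -> x = y by apply: (sim_inj (sim_pi D)).
have hi0 (r : D) : pi * r = 0 -> r = 0 by move/mul0; apply; exact: unif_neq0.
have par1 x : par A x <-> span3 v1' v2 v3 x.
  split.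
    move=> [/(ob_span o)[z1 [z2 [z3 ex]]] h].
    have rp (r : D) c' : s1 * r = pi * c' -> exists c, r = pi * c.
      move=> e; apply: resZ; apply/eqP; have /eqP : res (s1 * r) = 0 by rewrite e rmorphM /= res_unif mul0r.
      by rewrite rmorphM mulf_eq0 /= (negbTE rr1).
    have [a1 [a2 [a3 ea]]] := (ob_span o _).1 (h _ A2).
    have [b1 [b2 [b3 eb]]] := (ob_span o _).1 (h _ A3).
    have [|z3' ez3] := rp z3 (- a1).
      have : br (hpi x) v2 = (pi * a1) *: v1 + (pi * a2) *: v2 + (pi * a3) *: v3.
        by rewrite /hpi brZl ea /hpi; vec.
      rewrite ex.
      rewrite !brE brxx (brC v3 v2) (ob_br1 o) (ob_br3 o).
      have -> : z1 *: (s3 *: v3) + z2 *: 0 + z3 *: - (s1 *: v1) = (- (s1 * z3)) *: v1 + 0 *: v2 + (z1 * s3) *: v3 by vec.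
      by move=> /(det3_inj d0)[f _ _]; rewrite mulrN -f opprK.
    have [|z2' ez2] := rp z2 b1.
      have : br (hpi x) v3 = (pi * b1) *: v1 + (pi * b2) *: v2 + (pi * b3) *: v3.
        by rewrite /hpi brZl eb /hpi; vec.
      rewrite ex.
      rewrite !brE brxx (brC v1 v3) (ob_br1 o) (ob_br2 o).
      have -> : z1 *: - (s2 *: v2) + z2 *: (s1 *: v1) + z3 *: 0 = (s1 * z2) *: v1 + (- (z1 * s2)) *: v2 + 0 *: v3 by vec.
      by move=> /(det3_inj d0)[-> _ _].
    by exists z1, z2', z3'; apply: hi; rewrite ex ez2 ez3 ev1 /hpi; vec.
  move=> [z1 [z2 [z3 ->]]]; split.
    by apply/(ob_span o); exists z1, (pi * z2), (pi * z3); rewrite ev1 /hpi; vec.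
  move=> y /(ob_span o)[y1 [y2 [y3 ->]]].
  apply/(ob_span o); exists (s1 * (z2 * y3 - z3 * y2)), (t2 * (pi * z3 * y1 - z1 * y3)), (t3 * (z1 * y2 - pi * z2 * y1)).
  apply: hi; rewrite {1}/hpi -brZl.
  have -> : pi *: (z1 *: v1' + z2 *: v2 + z3 *: v3) = z1 *: v1 + (pi * z2) *: v2 + (pi * z3) *: v3.
    by rewrite ev1 /hpi; vec.
  by rewrite (SB_br _ _ _ _ _ _ (OB_SB o)) et2 et3 /hpi; vec.
have ed : det3 v1 v2 v3 = pi * det3 v1' v2 v3 by rewrite ev1 /det3 /hpi; crd; ring.
have o' : OB (par A) v1' v2 v3 (pi * s1) t2 t3.
  split=> //.
  - by apply: contra_neq d0 => e; rewrite ed e mulr0.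
  - by apply: hi0; rewrite -(ob_12 o) ev1 /hpi BfZl.
  - by apply: hi0; rewrite -(ob_13 o) ev1 /hpi BfZl.
  - exact: ob_23 o.
  - by rewrite (ob_br1 o) ev1 /hpi; vec.
  - by apply: hi; rewrite {1}/hpi -brZr -/(hpi v1') -ev1 (ob_br2 o) et2 /hpi; vec.
  - by apply: hi; rewrite {1}/hpi -brZl -/(hpi v1') -ev1 (ob_br3 o) et3 /hpi; vec.
exists v1', v2, v3, s1, t2, t3, b, c, u2, u3; rewrite -et2 -et3 -ev1; split=> //; split.
  have spar : submod (par A).
    by rewrite (_ : par A = span3 v1' v2 v3); [exact: span3_submod|apply/funext => x; apply/propext].
  have [k' [x1 [x2 [x3 [ipar dx px]]]]] : exists k v1 v2 v3, [/\ relidx setT (par A) (q ^ k),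
      det3 v1 v2 v3 = pi ^+ k & forall x, par A x <-> span3 v1 v2 v3 x].
    apply: (@triangular_basis_pow D (par A) (q ^ k.+1)) => // x; have Ax := relidx_pow sA iA x.
    by split=> [|y Ay]; [exact: AZ|exact: cA].
  split=> //.
    move=> x y /par1[z1 [z2 [z3 ->]]] /par1[y1 [y2 [y3 ->]]]; apply/par1.
    by rewrite (SB_br _ _ _ _ _ _ (OB_SB o')); do 3!eexists.
  suff -> : k = k' by [].
  have [|u [uu eu]] := @det3_basis D _ _ _ v1' v2 v3 _ (fun x => iff_trans (iff_sym (px x)) (par1 x)).
    by rewrite dx pow_unif_neq0.
  have [u' [uu' eu']] := Alg_det Ak (ob_span o).
  have e : u' * pi ^+ k.+1 = u * pi ^+ k'.+1.
    rewrite -eu' ed.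
    by rewrite eu dx exprS mulrCA.
  apply/eqP; rewrite eqn_leq; apply/andP; split; rewrite -ltnS.
    by apply: (pdvd_unit uu); rewrite -e; apply/pdvdM/pdvd_pow.
  by apply: (pdvd_unit uu'); rewrite e; apply/pdvdM/pdvd_pow.
(* In coordinates adapted to a Borel subalgebra i containing A, the h- and f-coordinates of v2 and
   v3 are divisible by pi. The f-coordinate of [v2, v3] is then divisible by pi^2, so that of [v1']
   is divisible by pi, and the parent lies in i too. *)
apply: eq_card => i; rewrite !inE; apply: asbool_equiv_eq; split=> h x.
  by move=> Ax; apply: h; split=> [|y Ay]; [exact: AZ|exact: cA].
move=> /par1[z1 [z2 [z3 ->]]]; rewrite !BfE !rmorphD !rmorphM /= (h _ A2) (h _ A3) !mulr0 !addr0.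
suff -> : res (Bf v1' (nv i)) = 0 by rewrite mulr0.
have hg v : A v -> pdvd 1 ((gBi i v).2 : D) /\ pdvd 1 ((gBi i v).1.2 : D).
  move=> Av; have g0 : res (gBi i v).2 = 0 by rewrite gBi_ga; exact: h.
  split; apply/resP => //; have := hN _ Av; rewrite -(gBi_Nm i) /Nm rmorphD rmorphM /= g0 mulr0 add0r.
  by rewrite rmorphXn => /sq0.
have [g2 b2] := hg _ A2; have [g3 b3] := hg _ A3.
have : pdvd 2 ((gBi i (br v2 v3)).2 : D).
  by rewrite gBi_br_ga; apply: pdvdM; apply: pdvdB; [apply: (pdvdMM g2 b3)|apply: (pdvdMM b2 g3)].
rewrite (ob_br1 o) gBi_ga BfZl ev1 /hpi BfZl => /(pdvd_unitM _ _ uu1).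
by rewrite -{1}(expr1 pi) => /(@pdvd_mulI D 1 1)/resP.
Qed.

End Children.


(** * Points off a conic over a finite field *)

Section FiniteFieldCounts.
Variable F : finFieldType.
Hypothesis two : (2%:R : F) != 0.
Local Notation q := #|F|.

Lemma card_normd (P : pred (F * F * F)) :
  #|[pred d | normd d && P d]| =
  (#|[pred x : F * F | P (1%R, x.1, x.2)]| + #|[pred c | P (0%R, 1%R, c)]| + P (0%R, 0%R, 1%R))%N.
Proof.
pose A1 := [set (1 : F, x.1, x.2) | x : F * F & P (1, x.1, x.2)].
pose A2 := [set (0 : F, 1 : F, c) | c : F & P (0, 1, c)].
pose A3 := [set d in [:: (0 : F, 0 : F, 1 : F)] | P d].
have -> : #|[pred d | normd d && P d]| = #|A1 :|: A2 :|: A3|.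
  apply: eq_card => d; rewrite !inE; apply/andP/idP.
    case=> /normdP[] e Pd; apply/orP.
    - by left; apply/orP; left; apply/imsetP; exists (d.1.2, d.2); rewrite ?inE -e.
    - by left; apply/orP; right; apply/imsetP; exists d.2; rewrite ?inE -e.
    - by right; rewrite Pd e eqxx.
  case/orP => [/orP[]/imsetP[x + ->]|/andP[/eqP-> ?]]; rewrite ?inE /normd /= ?eqxx ?orbT //.
rewrite cardsU (_ : _ :&: A3 = finset.set0); last first.
  apply/setP => d; rewrite !inE; apply/negP => /andP[/orP[]/imsetP[x _ ->]];
  by rewrite !xpair_eqE ?oner_eq0 ?andbF.
rewrite cards0 subn0 cardsU (_ : A1 :&: A2 = finset.set0); last first.
  apply/setP => d; rewrite !inE; apply/negP => /andP[/imsetP[x _ ->] /imsetP[y _ [/eqP]]].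
  by rewrite oner_eq0.
rewrite cards0 subn0; congr (_ + _ + _)%N.
- by rewrite card_imset ?cardsE // => -[x y] [x' y'] /= [-> ->].
- by rewrite card_imset ?cardsE // => x y [].
- case E: (P _); last first.
    by apply: eq_card0 => d; rewrite !inE; case: eqP => // ->; rewrite E.
  rewrite (_ : A3 = [set (0, 0, 1)]) ?cards1 //.
  by apply/setP => d; rewrite !inE; case: eqP => // ->; rewrite E.
Qed.

Lemma card_pairl (P : pred F) : #|[pred x : F * F | P x.1]| = (#|[pred x | P x]| * q)%N.
Proof.
have := cardX [pred x | P x] (predT : pred F); rewrite (_ : #|predT| = q) //.
by move=> <-; apply: eq_card => x; rewrite !inE andbT.
Qed.

Lemma card_pairr (P : pred F) : #|[pred x : F * F | P x.2]| = (#|[pred x | P x]| * q)%N.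
Proof.
have := cardX (predT : pred F) [pred x | P x]; rewrite (_ : #|predT| = q) // mulnC.
by move=> <-; apply: eq_card => x; rewrite !inE.
Qed.

Definition issq (a : F) := [exists r, a == r ^+ 2].

Lemma card_sqrt (a b : F) : a != 0 -> b != 0 ->
  #|[pred x | a + b * x ^+ 2 == 0]| = if issq (- (a * b)) then 2%N else 0%N.
Proof.
move=> a0 b0; case: ifP => [/existsP[r /eqP e]|ns]; last first.
  apply: eq_card0 => x; rewrite !inE; apply/negP => /eqP e; apply: (negP (negbT ns)).
  apply/existsP; exists (b * x); apply/eqP; rewrite exprMn.
  have -> : a = - (b * x ^+ 2) by apply/eqP; rewrite -addr_eq0 e.
  by ring.
have r0 : r != 0.
  by apply/eqP => r0; move/eqP: e; rewrite r0 expr0n oppr_eq0 mulf_eq0 (negbTE a0) (negbTE b0).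
rewrite (_ : #|_| = #|[set r / b; - (r / b)]|).
  rewrite cards2; suff -> : r / b != - (r / b) by [].
  rewrite -addr_eq0 -mulr2n -mulr_natl !mulf_eq0 invr_eq0 (negbTE b0) (negbTE r0).
  by rewrite (negbTE two).
apply: eq_card => x; rewrite !inE.
have -> : (a + b * x ^+ 2 == 0) = (b * x ^+ 2 + a == 0) by rewrite addrC.
have eb : b * (b * x ^+ 2 + a) = (b * x - r) * (b * x + r).
  by transitivity (b ^+ 2 * x ^+ 2 - (- (a * b))); [ring|rewrite e; ring].
have -> : (b * x ^+ 2 + a == 0) = (b * (b * x ^+ 2 + a) == 0) by rewrite mulf_eq0 (negbTE b0).
rewrite eb mulf_eq0 subr_eq0 addr_eq0; congr orb.
  by apply/eqP/eqP => [<-|->]; rewrite ?(mulrC b) ?mulfK ?divfK.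
by apply/eqP/eqP => [h|->]; [rewrite -mulNr -h (mulrC b) mulfK|rewrite mulrN (mulrC b) divfK].
Qed.

Lemma card_nsqrt (a b : F) : a != 0 -> b != 0 ->
  #|[pred x | a + b * x ^+ 2 != 0]| = (q - if issq (- (a * b)) then 2 else 0)%N.
Proof.
move=> a0 b0; rewrite -(card_sqrt a0 b0) -(cardC [pred x | a + b * x ^+ 2 == 0]) addKn.
by apply: eq_card.
Qed.

(** Projective points off the conic with a matrix of the shape used in [SB]. The lemmas below treat
    rank 0, 1 and 2 and the smooth conic of the full algebra. *)
Definition ncq (a b c t : F) :=
  #|[pred d : F * F * F | normd d && (a * d.1.1 ^+ 2 + b * d.1.2 ^+ 2 + c * d.2 ^+ 2
     + 2%:R * t * d.1.1 * d.2 != 0)]|.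

Lemma ncq0 : ncq 0 0 0 0 = 0%N.
Proof. by apply: eq_card0 => d; rewrite !inE !(mulr0, mul0r, addr0) eqxx andbF. Qed.

Lemma ncq1 a : a != 0 -> ncq a 0 0 0 = (q ^ 2)%N.
Proof.
move=> a0; rewrite /ncq card_normd /=.
rewrite (@eq_card (F * F)%type [pred x : F * F | _] predT); last first.
  by move=> x; rewrite !inE !(mulr0, mul0r, addr0, expr1n, mulr1) a0.
rewrite (@eq_card F [pred c : F | _] pred0); last first.
  by move=> x; rewrite !inE !(mulr0, mul0r, addr0, add0r, expr1n, expr0n) /= ?mulr0 ?eqxx.
by rewrite !(mulr0, mul0r, addr0, expr1n, expr0n) /= ?mulr0 ?eqxx card0 !addn0 card_prod mulnn.
Qed.

(** A conic of rank 2 is a pair of lines: 2q + 1 rational points if the lines are rational, only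
    their intersection otherwise. Both sides are sums to avoid truncated subtraction. *)
Lemma ncq2 a b : a != 0 -> b != 0 ->
  (ncq a b 0%R 0%R + (if issq (- (a * b)) then q else 0) = q ^ 2 + (if issq (- (a * b)) then 0 else q))%N.
Proof.
move=> a0 b0; rewrite /ncq card_normd /=.
rewrite (@eq_card _ _ [pred x : F * F | a + b * x.1 ^+ 2 != 0]); last first.
  by move=> x; rewrite !inE !(mulr0, mul0r, addr0, expr1n, mulr1).
rewrite (@eq_card F [pred c : F | _] predT); last first.
  by move=> x; rewrite !inE !(mulr0, mul0r, addr0, add0r, expr1n, expr0n, mulr1) b0.
rewrite !(mulr0, mul0r, addr0, expr1n, expr0n) /= ?mulr0 ?addr0 ?eqxx addn0.
rewrite (card_pairl [pred x | a + b * x ^+ 2 != 0]) card_nsqrt //.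
have q2 : (2 <= q)%N := card_finNzRing_gt1 F.
rewrite (_ : #|(predT : pred F)| = #|F|) // -mulnn.
move: q2; move: #|F| => n n2; case: ifP => _; nia.
Qed.

(* The matrix S of the standard basis e, h, f. *)
Lemma ncqL : ncq 0 (-1) 0 (- 2%:R) = (q ^ 2)%N.
Proof.
rewrite /ncq card_normd /=.
rewrite (@eq_card (F * F)%type [pred x : F * F | _] [pred x | x.1 ^+ 2 + 4%:R * x.2 != 0]); last first.
  by move=> x; rewrite !inE; congr negb; rewrite -[RHS]oppr_eq0; congr (_ == 0); ring.
rewrite (@eq_card F [pred c : F | _] predT); last first.
  by move=> x; rewrite !inE !(mulr0, mul0r, addr0, add0r, expr1n, expr0n, mulr1) oppr_eq0 oner_eq0.
rewrite !(mulr0, mul0r, addr0, expr1n, expr0n) /= ?mulr0 ?addr0 ?eqxx addn0.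
rewrite (_ : #|(predT : pred F)| = #|F|) //.
have -> : #|[pred x : F * F | x.1 ^+ 2 + 4%:R * x.2 != 0]| = (q * q - q)%N.
  rewrite -[X in (X * X - _)%N]/(#|F|) -card_prod.
  rewrite -(cardC [pred x : F * F | x.1 ^+ 2 + 4%:R * x.2 == 0]).
  rewrite (_ : #|[pred x : F * F | x.1 ^+ 2 + 4%:R * x.2 == 0]| = q) ?addKn.
    by apply: eq_card => x; rewrite !inE.
  rewrite (_ : #|_| = #|[set (x, - (x ^+ 2) / 4%:R) | x : F]|).
    by rewrite card_imset ?cardsT // => x y [].
  apply: eq_card => -[x y]; rewrite !inE /=; have f0 : (4%:R : F) != 0.
    by rewrite (_ : 4%:R = 2%:R * 2%:R) ?mulf_neq0 //; ring.
  apply/eqP/imsetP => [e|[z _ [-> ->]]]; last by rewrite mulrC divfK // subrr.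
  exists x => //; congr pair; rewrite -(mulfK f0 y); congr (_ / _).
  by rewrite -[RHS]add0r -e; ring.
by rewrite subnK ?expnS ?expn0 ?muln1 // leq_pmulr // ltnW // card_finNzRing_gt1.
Qed.

End FiniteFieldCounts.


(** * Algebras with exactly one unit structure constant *)

Section RankOne.
Variable D : dvr.
Local Notation pi := (unif D).
Local Notation F := (resF D).
Local Notation q := #|resF D|.
Local Notation res := (res D).
Local Notation L := (sl2 D).
Implicit Types (A M : set L) (x y z v : L) (d : F * F * F).

(** Such a y is diagonalizable modulo pi over the residue field, with eigenvalues r and -r. *)
Definition spl A := exists y, A y /\ exists2 r, r != 0 & res (Nm y) = r ^+ 2.

Lemma fin_R1 k : fin (@R1 D k).
Proof. by apply: (fin_sub (fin_Alg D k)) => A []. Qed.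

Lemma im_SB h A w1 w2 w3 s1 s2 s3 t : sim h -> SB A w1 w2 w3 s1 s2 s3 t ->
  SB (im h A) (h w1) (h w2) (h w3) (pi * s1) (pi * s2) (pi * s3) (pi * t).
Proof.
move=> sh [sp d r1 r2 r3].
have hs (a b c : D) : h (a *: w1 + b *: w2 + c *: w3) = a *: h w1 + b *: h w2 + c *: h w3.
  by rewrite !(simD sh) !(simZ sh).
split; rewrite ?(sim_br sh) ?r1 ?r2 ?r3 ?(simD sh) ?(simZ sh) ?scalerDr ?scalerA //.
- move=> x; split=> [[y [/sp[a [b [c ->]]] ->]]|[a [b [c ->]]]].
    by exists a, b, c; rewrite hs.
  by exists (a *: w1 + b *: w2 + c *: w3); rewrite hs; split=> //; apply/sp; exists a, b, c.
- by rewrite (sim_det sh) mulf_neq0 ?pow_unif_neq0.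
Qed.

(** The matrix of the image is pi S, so the radical condition is empty and only d S d modulo pi
    matters. *)
Lemma nchild_pi (s1 s2 s3 t : D) :
  nchild (pi * s1) (pi * s2) (pi * s3) (pi * t) = ncq (res s1) (res s2) (res s3) (res t).
Proof.
apply: eq_card => d; rewrite !inE /israd !rmorphM /= res_unif !mul0r !addr0 eqxx /=.
congr andb; rewrite /Qd.
have -> : pi * s1 * rlift d.1.1 ^+ 2 + pi * s2 * rlift d.1.2 ^+ 2 + pi * s3 * rlift d.2 ^+ 2
    + 2%:R * (pi * t) * rlift d.1.1 * rlift d.2 = pi * Qd s1 s2 s3 t d by rewrite /Qd; ring.
have -> : res s1 * d.1.1 ^+ 2 + res s2 * d.1.2 ^+ 2 + res s3 * d.2 ^+ 2 + 2%:R * res t * d.1.1 * d.2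
    = res (Qd s1 s2 s3 t d).
  by rewrite /Qd !expr2 !rmorphD !rmorphM /= !rliftK rmorph_nat.
congr negb; apply/asboolP/eqP => [h|/resP].
  by apply/resP; apply: (@pdvd_mulI D 1); rewrite expr1.
by rewrite -{1}(expr1 pi); apply: (pdvdMM (pdvd_pow D 1)).
Qed.

Lemma csize_children_im k A h w1 w2 w3 s1 s2 s3 t : Alg k A -> sim h ->
  SB A w1 w2 w3 s1 s2 s3 t ->
  csize (fun B => R1 (k + 3).+1 B /\ par B = im h A) = ncq (res s1) (res s2) (res s3) (res t).
Proof.
by move=> Ak sh sb; rewrite (csize_children (im_Alg sh Ak) (im_SB sh sb)) nchild_pi.
Qed.

Lemma Alg0 A : Alg 0 A -> forall x, A x.
Proof.
move=> [sA _ iA] x; apply/(relidx_eq (submodT _) (submodT _) sA _ _ iA) => //.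
by rewrite expn0; exact: (relidx_self (submodT _)).
Qed.

Definition LT : set L := fun=> True.

Lemma Alg0E A : Alg 0 A <-> A = LT.
Proof.
split=> [A0|->]; first by apply/funext => x; apply/propext; split=> // _; exact: Alg0.
split; [exact: submodT|by []|by rewrite expn0; exact: (relidx_self (submodT _))].
Qed.

Lemma SB_LT : SB LT (1, 0, 0) (0, 1, 0) (0, 0, 1) 0 (- 1) 0 (- 2%:R).
Proof.
split.
- move=> x; split=> // _; exists x.1.1, x.1.2, x.2; vec.
- by rewrite (_ : det3 _ _ _ = 1) ?oner_neq0 // /det3 /=; ring.
- by rewrite /br; vec.
- by rewrite /br; vec.
- by rewrite /br; vec.
Qed.

Lemma RU_LT : RU LT.
Proof.
exists (0, 1, 0); split=> //; rewrite (_ : Nm _ = 1) ?rmorph1 ?oner_neq0 //.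
by rewrite /Nm /=; ring.
Qed.

Lemma RU_nR0 k A : Alg k A -> RU A -> ~ R0 A.
Proof.
move=> Ak [y [Ay ny]] rA; move/eqP: ny; apply; apply/resP.
exact: pdvd_leq (isT : (1 <= 2)%N) (R0_Nm Ak rA Ay).
Qed.

Lemma spl_issq A v1 v2 v3 s1 s2 s3 : OB A v1 v2 v3 s1 s2 s3 ->
  res s1 != 0 -> res s2 != 0 -> res s3 = 0 -> spl A <-> issq (- (res s1 * res s2)).
Proof.
move=> o r1 r2 r3; have [A1 A2 A3] := OB_mem o.
have f2 : (2%:R : F) != 0 := two_res D.
have e3 : - (res s1 * res s2) = (2%:R) ^+ 2 * res (Nm v3).
  rewrite -rmorphM (OB_Nm1 (OB_rot (OB_rot o))) rmorphN opprK rmorphM rmorph_nat; ring.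
have n1 : res (Nm v1) = 0 by apply/eqP; rewrite (OB_resN o) r3 mulr0.
have n2 : res (Nm v2) = 0 by apply/eqP; rewrite (OB_resN (OB_rot o)) r3 mul0r.
have n3 : res (Nm v3) != 0 by rewrite (OB_resN (OB_rot (OB_rot o))) mulf_neq0.
split.
  move=> [y [/(ob_span o)[a [b [c ->]]] [r r0]]].
  rewrite (OB_Nm _ _ _ o) !rmorphD !rmorphM /= n1 n2 !mulr0 !add0r => e.
  have c0 : res c != 0 by apply: contra_neq r0 => c0; apply: sq0; rewrite -e c0 !mul0r.
  apply/existsP; exists (2%:R * r / res c); rewrite e3 eq_sym; apply/eqP.
  have -> : (2%:R * r / res c) ^+ 2 = 2%:R ^+ 2 * (r ^+ 2 / (res c * res c)).
    by field.
  by rewrite -e; field.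
move=> /existsP[r /eqP e]; exists v3; split=> //; exists (r / 2%:R).
  rewrite mulf_neq0 ?invr_eq0 //; apply: contra_neq n3 => r0; move: e.
  by rewrite e3 r0 expr0n => /eqP; rewrite mulf_eq0 expf_eq0 (negbTE f2) => /eqP.
by rewrite exprMn -e e3 exprVn mulrC mulKf // expf_neq0.
Qed.

(** The number of algebras in [R1] whose parent is the image of A under a given similitude, i.e. of
    points off the conic of S modulo pi. This S is 0 for [R0], of rank 1 for [R1], invertible for
    the full algebra and of rank 2 for the other [RU] algebras, where the two lines are rational
    exactly when A is split. *)
Definition dnum k A : int :=
  if `[< R0 A >] then 0 else if ~~ `[< RU A >] then (q ^ 2)%:Z else
  if k is 0 then (q ^ 2)%:Z else if `[< spl A >] then (q ^ 2)%:Z - q%:Z else (q ^ 2)%:Z + q%:Z.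

Lemma dnumP k A h : Alg k A -> sim h ->
  (csize (fun B => R1 (k + 3).+1 B /\ par B = im h A))%:Z = dnum k A.
Proof.
move=> Ak sh; rewrite /dnum; case: asboolP => [rA|nr0].
  have [v1 [v2 [v3 [s1 [s2 [s3 o]]]]]] := OB_exists Ak.
  have [e1 e2 e3] := (R0_OB o).1 rA.
  by rewrite (csize_children_im Ak sh (OB_SB o)) e1 e2 e3 rmorph0 ncq0.
case: asboolP => [rU|nU] /=; last first.
  have [v1 [v2 [v3 [s1 [s2 [s3 [b [c [u2 [u3 [o uu1 [e2 _] [e3 _] _]]]]]]]]]]] := R1_type Ak nr0 nU.
  rewrite (csize_children_im Ak sh (OB_SB o)) rmorph0.
  by rewrite e2 e3 !exprS !rmorphM /= res_unif !mul0r !mulr0 ncq1 // -unit_resE.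
case: k Ak => [/Alg0E ->|k Ak].
  rewrite (csize_children_im ((Alg0E LT).2 erefl) sh SB_LT) //.
  by rewrite !rmorphN rmorph0 rmorph1 rmorph_nat ncqL // two_res.
have [v1 [v2 [v3 [s1 [s2 [s3 [o uu1 uu2 [u [_ e3]]]]]]]]] := RU_type Ak rU.
have r3 : res s3 = 0 by rewrite e3 exprS !rmorphM /= res_unif mul0r mulr0.
rewrite unit_resE in uu1; rewrite unit_resE in uu2.
rewrite (csize_children_im Ak sh (OB_SB o)) rmorph0 r3.
have := ncq2 (two_res D) uu1 uu2.
have -> : `[< spl A >] = issq (- (res s1 * res s2)).
  by apply/asboolP/idP => /(spl_issq o uu1 uu2 r3).
move: (q ^ 2)%N (ncq _ _ _ _) q => Q N q0; case: ifP => _; rewrite ?addn0; lia.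
Qed.

(** Only for a parent in [R0] does descent lead on to a smaller algebra A'. *)
Definition R1b k : set (set L) := fun A => R1 k A /\ R0 (par A).
Definition R1a k : set (set L) := fun A => R1 k A /\ ~ R0 (par A).

(** The weight of an algebra whose parent is the image of A under a similitude. Passing to the
    parent gives a factor q and lowers m by 1, and the descent gives q^3 and lowers m by 1 again;
    the values at m = 0 and m = 1 fall outside this rule. *)
Definition wb m A : nat := if m is m.+2 then (q ^ 4 * w m A)%N else if m is 1 then (q ^ 2)%N else 1%N.

(** The valuations 0, b + 1, c + 1 of A become 1, b, c for the parent. The rule with a single factor
    q fails at m = 1, where min(1, m - 1) is 0. *)
Lemma w_R1 k A : R1 k.+1 A ->
  w 1 A = (q ^ 2)%N /\ forall m, w m.+2 A = (q * w m.+1 (par A))%N.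
Proof.
move=> rA; have [v1 [v2 [v3 [s1 [s2 [s3 [b [c [u2 [u3 [o o' [uu1 e2 uu2 e3 uu3] _ _]]]]]]]]]]] := par_Alg rA.
have f1 : s1 = s1 * pi ^+ 0 by rewrite mulr1.
have f2 : pi * s2 = u2 * pi ^+ b.+1 by rewrite e2 exprS mulrCA.
have f3 : pi * s3 = u3 * pi ^+ c.+1 by rewrite e3 exprS mulrCA.
have f1' : pi * s1 = s1 * pi ^+ 1 by rewrite mulrC.
split=> [|m].
  by have [_ ->] := w_OB 1 o uu1 uu2 uu3 f1 f2 f3; rewrite min0n !minnSS !minn0.
have [_ ->] := w_OB m.+2 o uu1 uu2 uu3 f1 f2 f3.
have [_ ->] := w_OB m.+1 o' uu1 uu2 uu3 f1' e2 e3.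
by rewrite -expnS; congr expn; rewrite min0n !minnSS; lia.
Qed.

Definition wf m A : nat := if m is m'.+2 then (q * w m'.+1 A)%N else if m is 1 then (q ^ 2)%N else 1%N.

Lemma R1b_ge4 k A : R1b k A -> (4 <= k)%N.
Proof.
case: k => [|k] [rA r0].
  case: rA => /Alg0E -> _ /(_ RU_LT) //.
have [v1 [v2 [v3 [s1 [s2 [s3 [b [c [u2 [u3 [_ _ _ _ [pA _]]]]]]]]]]]] := par_Alg rA.
by have := R0_ge3 pA r0.
Qed.

(** The sum is pushed forward to the parents, which have the same beta, and from there by [sum_R0]
    to the algebras A'. *)
Lemma sum_R1b k m (g : nat -> int) :
  ssum (R1b (k + 3).+1) (fun A => g (beta A) * (w m A)%:Z) =
  ssum (@Alg D k) (fun A => (g q.+1 + ((q.+1)%:Z - (beta A)%:Z) * g 1%N) * (dnum k A * (wb m A)%:Z)).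
Proof.
pose d A1 := csize (fun B => R1 (k + 3).+1 B /\ par B = A1).
rewrite -(@sum_R0 D k g (fun A => (d A)%:Z * (wf m A)%:Z)).
- have fP : fin (R1b (k + 3).+1) by apply: (fin_sub (fin_R1 (k + 3).+1)) => A [].
  have fQ : fin (fun A : set L => Alg (k + 3) A /\ R0 A) by apply: (fin_sub (fin_Alg D (k + 3))) => A [].
  rewrite (@ssum_fiber _ _ _ (fun A => Alg (k + 3) A /\ R0 A) (@par D) _
     (fun A => g (beta A) * (wf m A)%:Z) d fP fQ).
  + by apply: ssum_ext => A _; rewrite mulrCA.
  + move=> A [rA r0].
    have [v1 [v2 [v3 [s1 [s2 [s3 [b [c [u2 [u3 [_ _ _ _ [pA eb]]]]]]]]]]]] := par_Alg rA.
    have [w1e w2e] := w_R1 rA; split=> //; rewrite eb; congr (_ * _%:Z).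
    case: (m) => [|[|m']]; last by rewrite w2e.
      by rewrite (@w0 _ _ (k + 3).+1) //; case: rA.
    by rewrite w1e.
  + move=> B [Bk r0]; apply: csize_set => A; split=> [[[? _] ?]//|[rA e]].
    by split=> //; split=> //; rewrite e.
- move=> A Ak; rewrite (dnumP Ak (sim_pi D)); congr (_ * _%:Z).
  case: m => [|[|m]] //=; rewrite (w_im _ (sim_pi D) Ak).
  by rewrite !expnS expn0 muln1 !mulnA.
- move=> A i Ak; rewrite (dnumP Ak (sim_theta i)); congr (_ * _%:Z).
  case: m => [|[|m]] //=; rewrite (w_im _ (sim_theta i) Ak).
  by rewrite !expnS expn0 muln1 !mulnA.
Qed.

End RankOne.


(** * Borel subalgebras modulo powers of pi *)

Section RankTwo.
Variable D : dvr.
Local Notation pi := (unif D).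
Local Notation F := (resF D).
Local Notation q := #|resF D|.
Local Notation res := (res D).
Local Notation L := (sl2 D).
Implicit Types (A M B : set L) (x y z v : L) (d : F * F * F).

(* An [RU] algebra of positive index is, modulo pi, a Borel subalgebra or a line
   spanned by a semisimple element. *)
Definition Line A := exists y, forall x, A x -> exists (r : D) z, x = r *: y + hpi z.

Definition Bo k : set (set L) := fun A => [/\ Alg k A, RU A & ~ Line A].
Definition Lin k : set (set L) := fun A => [/\ Alg k A, RU A & Line A].

Lemma resNm_mod (r : D) y z : res (Nm (r *: y + hpi z)) = res r ^+ 2 * res (Nm y).
Proof.
have -> : Nm (r *: y + hpi z) = r ^+ 2 * Nm y + pi * (pi * Nm z + r * Bf y z).
  by rewrite NmD /hpi !NmZ !BfE; ring.
by rewrite rmorphD !(rmorphM res) /= res_unif mul0r addr0 expr2.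
Qed.

Lemma line_nil A x : RU A -> Line A -> A x -> res (Nm x) = 0 -> exists z, x = hpi z.
Proof.
move=> [y [Ay ny]] [y0 hA] Ax; have [r [z ->]] := hA _ Ax.
have [r' [z' ey]] := hA _ Ay; rewrite ey resNm_mod in ny.
rewrite resNm_mod => /eqP; rewrite mulf_eq0 => /orP[|/eqP n0]; last by rewrite n0 mulr0 eqxx in ny.
rewrite expf_eq0 /= => /eqP /resZ[c ->]; exists (c *: y0 + z).
by rewrite /hpi; vec.
Qed.

Lemma Line_gen A y : Line A -> A y -> res (Nm y) != 0 ->
  forall x, A x -> exists (r : D) z, x = r *: y + hpi z.
Proof.
move=> [y0 hA] Ay ny x Ax; have [r [z ->]] := hA _ Ax; have [r' [z' ey]] := hA _ Ay.
have ur : r' \is a GRing.unit.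
  by rewrite unit_resE; apply: contra_neq ny => r0; rewrite ey resNm_mod r0 expr0n mul0r.
have -> : y0 = r'^-1 *: (y - hpi z').
  by rewrite ey addrK scalerA mulVr // scale1r.
by exists (r * r'^-1), (z - (r * r'^-1) *: z'); rewrite /hpi; vec.
Qed.

Lemma relidx_functional (l : L -> D) (e0 : L) k :
  (forall x y, l (x - y) = l x - l y) -> (forall (r : D) x, l (r *: x) = r * l x) -> l e0 = 1 ->
  relidx setT (fun x => pdvd k (l x)) (q ^ k).
Proof.
move=> lB lZ l1; have [f [_ fs fi]] := relidx_idl D k.
exists (fun i => f i *: e0); split=> //.
  by move=> x _; have [i hi] := fs (l x) I; exists i; rewrite lB lZ l1 mulr1.
by move=> i j; rewrite -scalerBl lZ l1 mulr1 => /fi.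
Qed.

(** For primitive isotropic n this is a Borel subalgebra modulo pi^k, the orthogonal complement of
    its nilpotent line. *)
Definition bA k (n : L) : set L := fun x => pdvd k (Bf x n).

Lemma bA_submod k n : submod (bA k n).
Proof.
split; rewrite /bA.
- by rewrite (_ : Bf _ _ = 0); [exact: pdvd0|rewrite /Bf; crd; ring].
- by move=> x y hx hy; rewrite BfDl; apply: pdvdD.
- by move=> r x hx; rewrite BfZl; apply: pdvdM.
Qed.

(* Primitive isotropic vectors, normalized; [z] is a multiple of [pi] in the second chart. *)
Definition n1 (t : D) : L := (1, t, - t ^+ 2).
Definition n2 (z : D) : L := (- z ^+ 2, z, 1).

Lemma bA_Alg k n (e0 y0 : L) : (forall x y, exists r s : D, Bf (br x y) n = r * Bf x n + s * Bf y n) ->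
  Bf e0 n = 1 -> Bf y0 n = 0 -> Nm y0 = 1 -> Alg k (bA k n) /\ RU (bA k n).
Proof.
move=> hb h1 h0 N1; split; last by exists y0; rewrite /bA h0 N1 rmorph1 oner_neq0; split=> //; exact: pdvd0.
split; first exact: bA_submod.
  by move=> x y hx hy; have [r [s e]] := hb x y; rewrite /bA e; apply: pdvdD; apply: pdvdM.
apply: (relidx_functional (l := fun x => Bf x n) (e0 := e0)) => //.
  by move=> x y; rewrite -scaleN1r BfDl BfZl mulN1r.
by move=> r x; rewrite BfZl.
Qed.

Lemma bA_Bo k n (e0 y0 : L) : (forall x y, exists r s : D, Bf (br x y) n = r * Bf x n + s * Bf y n) ->
  Bf e0 n = 1 -> Bf y0 n = 0 -> Nm y0 = 1 -> Nm n = 0 -> Bo k (bA k n) /\ spl (bA k n).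
Proof.
move=> hb h1 h0 N1 N0; have [ha hu] := bA_Alg k hb h1 h0 N1.
split; last first.
  exists y0; split; first by rewrite /bA h0; exact: pdvd0.
  by exists 1; rewrite ?oner_neq0 // N1 rmorph1 expr1n.
split=> // hl; have [||z ez] := @line_nil (bA k n) n hu hl.
- by rewrite /bA Bfxx N0 mulr0; exact: pdvd0.
- by rewrite N0 rmorph0.
move: h1; rewrite ez /hpi BfZr => /(congr1 res); rewrite rmorphM /= res_unif mul0r rmorph1.
by move/eqP; rewrite eq_sym oner_eq0.
Qed.

Lemma n1_Bo k t : Bo k (bA k (n1 t)) /\ spl (bA k (n1 t)).
Proof.
apply: (@bA_Bo k (n1 t) (0, 0, 1) (0, 1, - (2%:R * t))); rewrite /n1 /Bf /Nm /=; try by ring.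
move=> x y; exists (2%:R * (y.1.2 - t * y.1.1)), (- (2%:R * (x.1.2 - t * x.1.1))).
by rewrite /br /=; ring.
Qed.

Lemma n2_Bo k (z : D) : Bo k (bA k (n2 z)) /\ spl (bA k (n2 z)).
Proof.
apply: (@bA_Bo k (n2 z) (1, 0, 0) (- (2%:R * z), 1, 0)); rewrite /n2 /Bf /Nm /=; try by ring.
move=> x y; exists (- (2%:R * (y.1.2 - z * y.2))), (2%:R * (x.1.2 - z * x.2)).
by rewrite /br /=; ring.
Qed.

Lemma bA_mod k n n' : (forall x, pdvd k (Bf x n - Bf x n')) -> bA k n = bA k n'.
Proof.
move=> h; apply/funext => x; apply/propext; rewrite /bA; split=> hx.
  by have := pdvdB hx (h x); rewrite opprB addrC subrK.
by have := pdvdD (h x) hx; rewrite subrK.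
Qed.

Lemma bA_unit k n (u : D) : u \is a GRing.unit -> bA k (u *: n) = bA k n.
Proof.
by move=> uu; apply/funext => x; apply/propext; rewrite /bA BfZr; apply: pdvd_unitM.
Qed.

(** The third structure constant has valuation k + 1, so pi^(k+1) divides the norms of [v1] and [v2]
    and their products with all of A. One of the two is primitive, for otherwise A would be a line
    modulo pi. So A lies in its orthogonal complement modulo pi^(k+1), which has the same index. *)
Lemma Bo_bA k A : Bo k.+1 A -> exists n, A = bA k.+1 n /\
  ((exists t, n = n1 t) \/ (exists z : D, n = n2 (pi * z))).
Proof.
move=> [Ak rU nl]; have [sA cA iA] := Ak.
have [v1 [v2 [v3 [s1 [s2 [s3 [o uu1 uu2 [u [uu e3]]]]]]]]] := RU_type Ak rU.
have o2 := OB_rot o.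
have u4 : (- 4%:R : D) \is a GRing.unit by rewrite unitrN unit_resE res4.
have N1 : pdvd k.+1 (Nm v1).
  apply/(pdvd_unitM _ _ u4); rewrite mulNr -(OB_Nm1 o) e3; exact/pdvdM/pdvdM/pdvd_pow.
have N2 : pdvd k.+1 (Nm v2).
  apply/(pdvd_unitM _ _ u4); rewrite mulNr -(OB_Nm1 o2) e3; exact/pdvdMr/pdvdM/pdvd_pow.
have [v [Nv sub nv]] : exists v, [/\ pdvd k.+1 (Nm v), forall x, A x -> pdvd k.+1 (Bf x v) & ~ exists z, v = hpi z].
  have [e1|n1] := pselect (exists z, v1 = hpi z); last first.
    exists v1; split=> // x /(ob_span o)[a [b [c ->]]].
    rewrite !BfE Bfxx (BfC v2) (BfC v3) (ob_12 o) (ob_13 o) !mulr0 !addr0.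
    exact/pdvdM/pdvdM.
  have [e2|n2] := pselect (exists z, v2 = hpi z); last first.
    exists v2; split=> // x /(ob_span o)[a [b [c ->]]].
    rewrite !BfE Bfxx (BfC v3) (ob_12 o) (ob_23 o) !mulr0 !addr0 add0r.
    exact/pdvdM/pdvdM.
  case: nl; exists v3 => x /(ob_span o)[a [b [c ->]]].
  have [z1 ->] := e1; have [z2 ->] := e2; exists c, (a *: z1 + b *: z2).
  by rewrite /hpi; vec.
have fin_ n : (forall k, Bo k (bA k n)) -> bA k.+1 v = bA k.+1 n -> A = bA k.+1 n.
  move=> hB e; have [[sn _ idn] _ _] := hB k.+1.
  apply/funext => x; apply/propext; apply: iff_sym.
  by apply: (relidx_eq (submodT _) sn sA _ _ iA idn) => // y /sub; rewrite -e.
have [a0|a0] := eqVneq (res v.1.1) 0; last first.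
  rewrite -unit_resE in a0.
  exists (n1 (v.1.1^-1 * v.1.2)); split; last by left; eexists.
  apply: fin_ => [k'|]; first by have [] := n1_Bo k' (v.1.1^-1 * v.1.2).
  rewrite -(bA_unit k.+1 v (u := v.1.1^-1)) ?unitrV //; apply: bA_mod => x.
  (* The vector v is isotropic only modulo pi^(k+1). Correcting its last coordinate makes it
     isotropic and changes the functional by a multiple of [Nm v]. *)
  have -> : Bf x (v.1.1^-1 *: v) - Bf x (n1 (v.1.1^-1 * v.1.2)) = x.1.1 * v.1.1^-1 ^+ 2 * Nm v.
    rewrite BfZr /n1 /Bf /Nm; cbn [fst snd].
    move: (mulVr a0); move: (v.1.1^-1 : D) => i ei.
    transitivity (x.1.1 * i ^+ 2 * (v.1.1 * v.2 + v.1.2 ^+ 2)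
      + (i * v.1.1 - 1) * (x.2 - x.1.1 * i * v.2)); first by ring.
    by rewrite ei subrr mul0r addr0.
  exact: pdvdM.
have b0 : res v.1.2 = 0.
  apply: sq0; have /resP := pdvd_leq (isT : (1 <= k.+1)%N) Nv.
  by rewrite /Nm rmorphD rmorphM /= a0 mul0r add0r rmorphXn.
have c0 : res v.2 != 0.
  apply/eqP => c0; apply: nv; have [[a ea] [b eb] [c ec]] := And3 (resZ a0) (resZ b0) (resZ c0).
  by exists (a, b, c); apply: sl2P; rewrite /hpi; crd.
rewrite -unit_resE in c0; have [b eb] := resZ b0.
exists (n2 (pi * (v.2^-1 * b))); split; last by right; eexists.
apply: fin_ => [k'|]; first by have [] := n2_Bo k' (pi * (v.2^-1 * b)).
rewrite -(bA_unit k.+1 v (u := v.2^-1)) ?unitrV //; apply: bA_mod => x.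
have -> : pi * (v.2^-1 * b) = v.2^-1 * v.1.2 by rewrite eb mulrCA.
have -> : Bf x (v.2^-1 *: v) - Bf x (n2 (v.2^-1 * v.1.2)) = x.2 * v.2^-1 ^+ 2 * Nm v.
  rewrite BfZr /n2 /Bf /Nm; cbn [fst snd].
  move: (mulVr c0); move: (v.2^-1 : D) => i ei.
  transitivity (x.2 * i ^+ 2 * (v.1.1 * v.2 + v.1.2 ^+ 2)
    + (i * v.2 - 1) * (x.1.1 - x.2 * i * v.1.1)); first by ring.
  by rewrite ei subrr mul0r addr0.
exact: pdvdM.
Qed.

Lemma n1_inj k t t' : bA k (n1 t) = bA k (n1 t') -> pdvd k (t - t').
Proof.
move=> e; have : bA k (n1 t) (0, 1, - (2%:R * t)).
  by rewrite /bA (_ : Bf _ _ = 0); [exact: pdvd0|rewrite /Bf /=; ring].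
rewrite e /bA (_ : Bf _ _ = - 2%:R * (t - t')); last by rewrite /Bf /=; ring.
by move/(pdvd_unitM _ _); apply; rewrite unitrN two_unit.
Qed.

Lemma n2_inj k t t' : bA k (n2 t) = bA k (n2 t') -> pdvd k (t - t').
Proof.
move=> e; have : bA k (n2 t) (- (2%:R * t), 1, 0).
  by rewrite /bA (_ : Bf _ _ = 0); [exact: pdvd0|rewrite /Bf /=; ring].
rewrite e /bA (_ : Bf _ _ = - 2%:R * (t - t')); last by rewrite /Bf /=; ring.
by move/(pdvd_unitM _ _); apply; rewrite unitrN two_unit.
Qed.

Lemma n12_neq k t (z : D) : bA k.+1 (n1 t) <> bA k.+1 (n2 (pi * z)).
Proof.
move=> e; have : bA k.+1 (n1 t) (n1 t).
  by rewrite /bA (_ : Bf _ _ = 0); [exact: pdvd0|rewrite /Bf /=; ring].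
rewrite e /bA => /(pdvd_leq (isT : (1 <= k.+1)%N)) /resP.
rewrite (_ : Bf _ _ = 1 + pi * (t * z * (2%:R + t * pi * z))); last by rewrite /Bf /=; ring.
by rewrite rmorphD rmorph1 rmorphM /= res_unif mul0r addr0 => /eqP; rewrite oner_eq0.
Qed.

Lemma beta_n1 k t : beta (bA k.+1 (n1 t)) = 1%N.
Proof.
rewrite /beta -(card1 (Some (res t))); apply: eq_card => i; rewrite !inE.
apply/asboolP/eqP => [h|-> x].
  have h1 : bA k.+1 (n1 t) (n1 t).
    by rewrite /bA (_ : Bf _ _ = 0); [exact: pdvd0|rewrite /Bf /=; ring].
  have := h _ h1; case: i {h} => [s|] /=; last first.
    by rewrite (_ : Bf _ _ = 1) ?rmorph1; [move/eqP; rewrite oner_eq0|rewrite /Bf /=; ring].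
  rewrite (_ : Bf _ _ = - (t - rlift s) ^+ 2); last by rewrite /Bf /=; ring.
  rewrite rmorphN rmorphXn rmorphB /= rliftK => /eqP.
  by rewrite oppr_eq0 expf_eq0 /= subr_eq0 => /eqP ->.
rewrite /bA => /(pdvd_leq (isT : (1 <= k.+1)%N)) /resP => <-.
by rewrite /Bf /= !(rmorphD, rmorphM, rmorphN, rmorphXn) /= rliftK.
Qed.

Lemma beta_n2 k (z : D) : beta (bA k.+1 (n2 (pi * z))) = 1%N.
Proof.
rewrite /beta -(card1 (None : option F)); apply: eq_card => i; rewrite !inE.
apply/asboolP/eqP => [h|-> x].
  have h1 : bA k.+1 (n2 (pi * z)) (n2 (pi * z)).
    by rewrite /bA (_ : Bf _ _ = 0); [exact: pdvd0|rewrite /Bf /=; ring].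
  have := h _ h1; case: i {h} => [s|] //=.
  rewrite (_ : Bf _ _ = 1 + pi * (rlift s * z * (2%:R + rlift s * pi * z))); last by rewrite /Bf /=; ring.
  by rewrite rmorphD rmorph1 rmorphM /= res_unif mul0r addr0 => /eqP; rewrite oner_eq0.
rewrite /bA => /(pdvd_leq (isT : (1 <= k.+1)%N)) /resP => <-.
rewrite (_ : Bf x (n2 _) = x.1.1 + pi * (2%:R * x.1.2 * z - pi * z ^+ 2 * x.2)); last by rewrite /Bf /=; ring.
by rewrite [RHS]rmorphD [X in _ = _ + X]rmorphM /= res_unif mul0r addr0 /Bf /=; apply: congr1; ring.
Qed.

Lemma Bo_spl_beta k A : Bo k.+1 A -> spl A /\ beta A = 1%N.
Proof.
move=> /Bo_bA[n [-> [[t ->]|[z ->]]]].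
  by rewrite beta_n1; split=> //; have [] := n1_Bo k.+1 t.
by rewrite beta_n2; split=> //; have [] := n2_Bo k.+1 (pi * z).
Qed.

(** These algebras are the points of the projective line over R/pi^(k+1): q^(k+1) in the first chart
    and q^k in the second. *)
Lemma csize_Bo k : csize (Bo k.+1) = (q ^ k * q.+1)%N.
Proof.
have [f [_ fs fi]] := relidx_idl D k.+1; have [g [_ gs gi]] := relidx_idl D k.
pose h (i : 'I_(q ^ k.+1) + 'I_(q ^ k)) := match i with
  | inl i => bA k.+1 (n1 (f i)) | inr j => bA k.+1 (n2 (pi * g j)) end.
have [_ ->] : fin (Bo k.+1) /\ csize (Bo k.+1) = #|predT : pred ('I_(q ^ k.+1) + 'I_(q ^ k))|.
  apply: (csize_fin (g := h)).
  - by move=> [i|j] _; [have [] := n1_Bo k.+1 (f i)|have [] := n2_Bo k.+1 (pi * g j)].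
  - move=> A /Bo_bA[n [-> [[t ->]|[z ->]]]].
      have [i hi] := fs t I; exists (inl i) => //; apply: bA_mod => x.
      rewrite (_ : _ - _ = (t - f i) * (2%:R * x.1.2 - (t + f i) * x.1.1)); first exact: pdvdMr.
      by rewrite /Bf /=; ring.
    have [j hj] := gs z I; exists (inr j) => //; apply: bA_mod => x.
    have hj' : pdvd k.+1 (pi * (z - g j)).
      by rewrite -[k.+1]add1n -{1}(expr1 pi); apply: (pdvdMM (pdvd_pow D 1)).
    rewrite (_ : _ - _ = pi * (z - g j) * (2%:R * x.1.2 - pi * (z + g j) * x.2)); first exact: pdvdMr.
    by rewrite /Bf /=; ring.
  - move=> [i|i] [j|j] _ _ /= e.
    + by rewrite (fi _ _ (n1_inj e)).
    + by case: (n12_neq e).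
    + by case: (n12_neq (esym e)).
    + have := n2_inj e; rewrite -mulrBr -{1}(expr1 pi) => h'.
      by rewrite (gi i j) //; apply: (@pdvd_mulI D 1 k).
by rewrite card_sum !card_ord expnSr mulnS addnC.
Qed.

End RankTwo.


(** * Squares among the values of the norm form *)

Section MoreFieldCounts.
Variable F : finFieldType.
Local Notation q := #|F|.

Lemma issq_mul (r a : F) : r != 0 -> issq (r ^+ 2 * a) = issq a.
Proof.
move=> r0; apply/existsP/existsP => -[x /eqP e]; last by exists (r * x); rewrite exprMn e.
by exists (x / r); rewrite exprMn exprVn -e mulrC mulKf // expf_neq0.
Qed.

Lemma card_nz : (#|[pred x : F | x != 0%R]| + 1 = q)%N.
Proof.
by have <- := cardC (pred1 (0 : F)); rewrite card1 addnC; congr addn.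
Qed.

Lemma card_bij (T : finType) (A B : pred T) (f g : T -> T) : cancel f g -> cancel g f ->
  (forall x, A x = B (f x)) -> #|[pred x | A x]| = #|[pred x | B x]|.
Proof.
move=> fg gf AB; rewrite -!sum1_card [RHS](reindex f) /=; last first.
  by exists g => x _; [exact: fg|exact: gf].
by apply: eq_bigl => x; rewrite !inE AB.
Qed.

Lemma card_third (c : bool) :
  #|[pred d : F * F * F | normd d && ((d.2 != 0) && c)]| = if c then (q ^ 2)%N else 0%N.
Proof.
case: c; last by apply: eq_card0 => d; rewrite !inE !andbF.
rewrite card_normd /= oner_neq0 /=.
have e : #|[pred x : F | x != 0]| = q.-1 by rewrite -card_nz addn1.
rewrite (@eq_card (F * F)%type _ [pred x | (x.2 : F) != 0]); last by move=> x; rewrite !inE andbT.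
rewrite (@eq_card F _ [pred x | x != 0]); last by move=> x; rewrite !inE andbT.
rewrite (card_pairr [pred x : F | x != 0]) e; have := card_finNzRing_gt1 F.
by case: #|F| => // n _; rewrite /= expnS expn1; nia.
Qed.

Definition sigma := #|[pred s : F | (s != 0) && issq s]|.

Hypothesis two : (2%:R : F) != 0.

Lemma sigmaE : (2 * sigma + 1 = q)%N.
Proof.
rewrite -card_nz; congr addn; rewrite -[in RHS]sum1_card (partition_big (fun x : F => x ^+ 2) (fun s => s != 0)) /=; last first.
  by move=> x; rewrite inE expf_eq0.
rewrite (eq_bigr (fun s => if issq s then 2%N else 0%N)).
  rewrite -big_mkcondr sum_nat_const mulnC; congr muln; apply: eq_card => s.
move=> s s0; rewrite sum1_card.
have ns0 : - s != 0 by rewrite oppr_eq0.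
have := card_sqrt two ns0 (oner_neq0 F); rewrite mulr1 opprK => <-.
apply: eq_card => x; rewrite !inE mul1r addrC subr_eq0; apply/andP/idP => [[_]//|h].
by split=> //; apply: contra_neq s0 => x0; rewrite -(eqP h) x0 expr0n.
Qed.

(** The norm of a projective point is defined up to nonzero squares. At (1, b, c) it is c + b^2, so
    in this chart all values are taken equally often; at (0, 1, c) it is the square 1. *)
Lemma card_NL_split : #|[pred d : F * F * F | normd d && ((d.1.1 * d.2 + d.1.2 ^+ 2 != 0) && issq (d.1.1 * d.2 + d.1.2 ^+ 2))]|
  = (q * sigma + q)%N.
Proof.
rewrite card_normd /= !(mul0r, mul1r, mulr0, addr0, add0r, expr1n, expr0n) /= eqxx addn0; congr addn.
  rewrite mulnC -(card_pairl [pred s : F | (s != 0) && issq s]).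
  pose f (x : F * F) := (x.2 + x.1 ^+ 2, x.1).
  pose g (x : F * F) := (x.2, x.1 - x.2 ^+ 2).
  have fg : cancel f g by move=> [a b]; rewrite /f /g /= addrK.
  have gf : cancel g f by move=> [a b]; rewrite /f /g /= subrK.
by apply: (card_bij fg gf) => x; rewrite /f /= mul1r.
rewrite (@eq_card F _ predT) // => x; rewrite !inE mul0r add0r oner_neq0 /=.
by apply/existsP; exists 1; rewrite expr1n.
Qed.

Lemma card_NL_nsplit : #|[pred d : F * F * F | normd d && ((d.1.1 * d.2 + d.1.2 ^+ 2 != 0) && ~~ issq (d.1.1 * d.2 + d.1.2 ^+ 2))]|
  = (q * sigma)%N.
Proof.
rewrite card_normd /= !(mul0r, mul1r, mulr0, addr0, add0r, expr1n, expr0n) /= eqxx addn0.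
rewrite [X in (_ + X)%N](_ : _ = 0%N) ?addn0; last first.
  apply: eq_card0 => x; rewrite !inE mul0r add0r oner_neq0 /=; apply/negbTE; rewrite negbK.
  by apply/existsP; exists 1; rewrite expr1n.
have e : #|[pred s : F | (s != 0) && ~~ issq s]| = sigma.
  have h := cardID (fun s : F => issq s) [pred s : F | s != 0].
  have e1 : #|[pred x : F | x != 0]| = q.-1 by rewrite -card_nz addn1.
  have e2 := sigmaE; move: h; rewrite e1.
  have -> : #|[predI [pred s : F | s != 0] & (fun s : F => issq s)]| = sigma by apply: eq_card.
  have -> : #|[predD [pred s : F | s != 0] & (fun s : F => issq s)]| = #|[pred s : F | (s != 0) && ~~ issq s]|.
    by apply: eq_card => s; rewrite !inE andbC.
  by move: e2; move: #|_| #|F| sigma => a b c; lia.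
rewrite mulnC -e -(card_pairl [pred s : F | (s != 0) && ~~ issq s]).
pose f (x : F * F) := (x.2 + x.1 ^+ 2, x.1).
pose g (x : F * F) := (x.2, x.1 - x.2 ^+ 2).
have fg : cancel f g by move=> [a b]; rewrite /f /g /= addrK.
have gf : cancel g f by move=> [a b]; rewrite /f /g /= subrK.
by apply: (card_bij fg gf) => x; rewrite /f /= mul1r.
Qed.

End MoreFieldCounts.

Lemma csize_fiber (T U : choiceType) (P : set T) (Q : set U) (p : T -> U) (n : U -> nat) :
  fin P -> fin Q -> (forall x, P x -> Q (p x)) ->
  (forall y, Q y -> csize (fun x => P x /\ p x = y) = n y) ->
  (csize P)%:Z = ssum Q (fun y => (n y)%:Z).
Proof.
move=> fP fQ pQ hn; rewrite csizeE (@ssum_fiber _ _ P Q p _ (fun=> 1) n fP fQ).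
- by apply: ssum_ext => y _; rewrite mulr1.
- by move=> x Px; split=> //; exact: pQ.
- exact: hn.
Qed.

(** * Algebras that are semisimple lines modulo pi *)

Section Lines.
Variable D : dvr.
Local Notation pi := (unif D).
Local Notation F := (resF D).
Local Notation q := #|resF D|.
Local Notation res := (res D).
Local Notation L := (sl2 D).
Implicit Types (A M B : set L) (x y z v : L) (d : F * F * F).

(* A [Line] algebra [A] equals [ch B y] for [B = q2 A] and [y] anisotropic in B modulo pi. *)
Definition q2 A : set L := fun x => A (hpi x).
Definition ch B y : set L := fun x => exists (r : D) z, B z /\ x = r *: y + hpi z.

Lemma span_idx v1 v2 v3 (u : D) k : u \is a GRing.unit -> det3 v1 v2 v3 = u * pi ^+ k ->
  relidx setT (span3 v1 v2 v3) (q ^ k).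
Proof.
move=> uu e; have nz : u * pi ^+ k != 0.
  by rewrite mulf_neq0 ?pow_unif_neq0 //; apply: contraTneq uu => ->; rewrite unitr0.
have [|k' [w1 [w2 [w3 [ik dw sw]]]]] := @triangular_basis_pow D (span3 v1 v2 v3) k (span3_submod v1 v2 v3).
  move=> x; have -> : pi ^+ k *: x = u^-1 *: (det3 v1 v2 v3 *: x).
    by rewrite e scalerA mulrA mulVr // mul1r.
  by case: (span3_submod v1 v2 v3) => _ _ Z; apply: Z; rewrite cramer; do 3!eexists.
have [|u' [uu' eu']] := @det3_basis D w1 w2 w3 v1 v2 v3 _ (fun x => iff_sym (sw x)).
  by rewrite dw pow_unif_neq0.
rewrite e dw in eu'; suff -> : k = k' by [].
apply/eqP; rewrite eqn_leq; apply/andP; split.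
  by apply: (pdvd_unit uu'); rewrite -eu'; apply/pdvdM/pdvd_pow.
by apply: (pdvd_unit uu); rewrite eu'; apply/pdvdM/pdvd_pow.
Qed.

(** The vectors [v1] and [v2] have norm 0 modulo pi, so on a line they are divisible by pi. Dividing
    both by pi gives a basis of [q2 A], and the determinant loses pi^2. *)
Lemma q2_Lin k A : Lin k.+1 A -> exists k', [/\ k.+1 = (k' + 2)%N, Alg k' (q2 A) & RU (q2 A)].
Proof.
move=> [Ak rU lA]; have [sA cA iA] := Ak; have [A0 AD AZ] := sA.
have [v1 [v2 [v3 [s1 [s2 [s3 [o uu1 uu2 [u [uu e3]]]]]]]]] := RU_type Ak rU.
have [A1 A2 A3] := OB_mem o; have d0 := ob_det o.
have r3 : res s3 = 0 by rewrite e3 exprS !rmorphM /= res_unif mul0r mulr0.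
have n1 : res (Nm v1) = 0 by apply/eqP; rewrite (OB_resN o) r3 mulr0.
have n2 : res (Nm v2) = 0 by apply/eqP; rewrite (OB_resN (OB_rot o)) r3 mul0r.
have n3 : res (Nm v3) != 0.
  by rewrite (OB_resN (OB_rot (OB_rot o))) mulf_neq0 -?unit_resE.
have [z1 e1] := line_nil rU lA A1 n1; have [z2 e2] := line_nil rU lA A2 n2.
have hi x y : hpi x = hpi y -> x = y by apply: (sim_inj (sim_pi D)).
have sq2 x : q2 A x <-> span3 z1 z2 v3 x.
  split; last first.
    move=> [a [b [c ->]]]; apply/(ob_span o); exists a, b, (pi * c).
    by rewrite e1 e2 /hpi; vec.
  move=> /(ob_span o)[a [b [c ex]]].
  have c0 : res c = 0.
    have : res (Nm (hpi x)) = 0 by rewrite /hpi NmZ expr2 -mulrA rmorphM /= res_unif mul0r.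
    rewrite ex (OB_Nm _ _ _ o) !rmorphD !rmorphM /= n1 n2 !mulr0 !add0r => /eqP.
    by rewrite !mulf_eq0 (negbTE n3) orbF orbb => /eqP.
  have [c' ec] := resZ c0; exists a, b, c'; apply: hi; rewrite ex e1 e2 ec /hpi; vec.
have ed : det3 v1 v2 v3 = pi ^+ 2 * det3 z1 z2 v3 by rewrite e1 e2 /det3 /hpi; crd; ring.
have [u' [uu' eu']] := Alg_det Ak (ob_span o).
have d0' : det3 z1 z2 v3 != 0 by apply: contra_neq d0 => e; rewrite ed e mulr0.
have [u2 [k' [uu2' ed']]] := dvrP d0'.
have ek : k.+1 = (k' + 2)%N.
  have e : u' * pi ^+ k.+1 = u2 * pi ^+ (k' + 2) by rewrite -eu' ed ed' exprD; ring.
  apply/eqP; rewrite eqn_leq; apply/andP; split.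
    by apply: (pdvd_unit uu2'); rewrite -e; apply/pdvdM/pdvd_pow.
  by apply: (pdvd_unit uu'); rewrite e; apply/pdvdM/pdvd_pow.
exists k'; split=> //; last first.
  by exists v3; split=> //; apply/sq2; case: (span3_mem z1 z2 v3).
have eq2 : q2 A = span3 z1 z2 v3 by apply/funext => x; apply/propext.
split; rewrite ?eq2; [exact: span3_submod| |exact: (span_idx uu2' ed')].
have [t3 et3] := resZ r3.
rewrite -eq2 => x y Ax Ay.
have [/sq2 [x1 [x2 [x3 ex]]] /sq2 [y1 [y2 [y3 ey]]]] := conj Ax Ay.
rewrite /q2; apply/(ob_span o).
exists (s1 * (x2 * y3 - x3 * y2)), (s2 * (x3 * y1 - x1 * y3)), (t3 * (x1 * y2 - x2 * y1)); apply: hi.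
have hx (a b c : D) : hpi (a *: z1 + b *: z2 + c *: v3) = a *: v1 + b *: v2 + (pi * c) *: v3.
  by rewrite e1 e2 /hpi; vec.
have -> : hpi (hpi (br x y)) = br (hpi x) (hpi y) by rewrite /hpi brZl brZr.
by rewrite ex ey !hx (SB_br _ _ _ _ _ _ (OB_SB o)) et3 /hpi; vec.
Qed.

Lemma N_pi y (r : D) z z' : res (Nm y) != 0 -> r *: y + hpi z = hpi z' -> exists c, r = pi * c.
Proof.
move=> ny e; apply: resZ; have := resNm_mod r y z; rewrite e /hpi NmZ expr2 -mulrA rmorphM /= res_unif mul0r.
by move/esym/eqP; rewrite mulf_eq0 (negbTE ny) orbF expf_eq0 => /eqP.
Qed.

Section Child.
Variables (k : nat) (B : set L).
Hypothesis Bk : Alg k B.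

Lemma ch_submod y : submod (ch B y).
Proof.
case: Bk => -[B0 BD BZ] _ _; split.
- by exists 0, 0; split=> //; rewrite /hpi scale0r scaler0 addr0.
- move=> _ _ [r [z [Bz ->]]] [r' [z' [Bz' ->]]]; exists (r + r'), (z + z').
  by split; [exact: BD|rewrite /hpi; vec].
- move=> s _ [r [z [Bz ->]]]; exists (s * r), (s *: z).
  by split; [exact: BZ|rewrite /hpi; vec].
Qed.

Lemma ch_Lin y : B y -> res (Nm y) != 0 -> Lin (k + 2) (ch B y).
Proof.
move=> By ny; have [sB cB iB] := Bk; have [B0 BD BZ] := sB.
have sc := ch_submod y; have yc : ch B y y.
  by exists 1, 0; split=> //; rewrite /hpi scale1r scaler0 addr0.
split; last first.
- by exists y => x [r [z [Bz ->]]]; exists r, z.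
- by exists y.
split=> //.
  move=> _ _ [r [z [Bz ->]]] [r' [z' [Bz' ->]]].
  exists 0, (r *: br y z' - r' *: br y z + pi *: br z z'); split.
    by apply: BD; [apply: submodB => //|]; apply: BZ; apply: cB.
  by rewrite /hpi !brE brxx (brC z y); vec.
have sp := im_submod (sim_pi D) sB; have ip := im_idx (sim_pi D) sB iB.
have iq : relidx (ch B y) (im (@hpi D) B) q.
  apply: (@relidx_fin _ _ (ch B y) _ F (fun a => rlift a *: y)).
  - by move=> a; case: sc => _ _; apply.
  - move=> _ [r [z [Bz ->]]]; exists (res r).
    have [|c ec] := @resZ D (r - rlift (res r)); first by rewrite rmorphB /= rliftK subrr.
    exists (c *: y + z); split; first by apply: BD => //; apply: BZ.
    by rewrite addrAC -scalerBl ec /hpi; vec.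
  - move=> a b [z [Bz]]; rewrite -scalerBl => e.
    have [|c ec] := @N_pi y (rlift a - rlift b) 0 z ny; first by rewrite e /hpi scaler0 addr0.
    apply/eqP; rewrite -subr_eq0 -(rliftK a) -(rliftK b) -rmorphB ec rmorphM /= res_unif mul0r //.
have [j [_ [_ [_ [ij _ _]]]]] : exists k' v1 v2 v3, [/\ relidx setT (ch B y) (q ^ k'), det3 v1 v2 v3 = pi ^+ k'
    & forall x, ch B y x <-> span3 v1 v2 v3 x].
  apply: (@triangular_basis_pow D (ch B y) (q ^ k).+1) => // x.
  exists 0, (pi ^+ (q ^ k) *: x); split; first exact: relidx_pow.
  by rewrite scale0r add0r /hpi scalerA -exprS.
(* The index of pi B is q^3 q^k directly and q^j q through [ch B y]. *)
suff -> : (k + 2)%N = j by [].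
have it : relidx setT (im (@hpi D) B) (q ^ j * q).
  apply: (relidx_tower (submodT _) sc sp _ _ ij iq) => // _ [z [Bz ->]].
  by exists 0, z; rewrite scale0r add0r.
by have := relidx_uniq sp ip it; rewrite -expnD -expnSr => /(@powq_inj D); lia.
Qed.

Lemma q2_ch y : B y -> res (Nm y) != 0 -> q2 (ch B y) = B.
Proof.
move=> By ny; case: (Bk) => -[B0 BD BZ] _ _; apply/funext => x; apply/propext; split; last first.
  by move=> Bx; exists 0, x; rewrite scale0r add0r.
move=> [r [z [Bz e]]]; have [c ec] := N_pi ny (esym e).
have -> : x = c *: y + z.
  by apply: (sim_inj (sim_pi D)); rewrite -/(hpi x) e ec /hpi; vec.
by apply: BD => //; apply: BZ.
Qed.

Lemma ch_eq y y' (r : D) z : r \is a GRing.unit -> B z -> y' = r *: y + hpi z -> ch B y' = ch B y.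
Proof.
move=> ur Bz ->; case: (Bk) => -[B0 BD BZ] _ _; apply/funext => x; apply/propext; split.
  move=> [s [z' [Bz' ->]]]; exists (s * r), (s *: z + z'); split; first by apply: BD => //; apply: BZ.
  by rewrite /hpi; vec.
move=> [s [z' [Bz' ->]]]; exists (s * r^-1), (z' - (s * r^-1) *: z); split.
  by rewrite -scaleN1r; apply: BD => //; apply: (BZ); apply: (BZ).
rewrite scalerDr scalerA -(mulrA s) mulVr // mulr1; rewrite /hpi; vec.
Qed.

Lemma Lin_ch A : Lin (k + 2) A -> q2 A = B -> exists y, [/\ B y, res (Nm y) != 0 & A = ch B y].
Proof.
move=> [[sA cA iA] [y [Ay ny]] lA] e; have [A0 AD AZ] := sA; exists y.
have By : B y by rewrite -e; apply: AZ.
split=> //; apply/funext => x; apply/propext; split.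
  move=> Ax; have [r [z ex]] := Line_gen lA Ay ny Ax; exists r, z; split=> //.
  rewrite -e /q2; have -> : hpi z = x - r *: y by rewrite ex addrC addKr.
  by apply: submodB => //; apply: AZ.
move=> [r [z [Bz ->]]]; apply: AD; first exact: AZ.
by move: Bz; rewrite -e.
Qed.

Lemma spl_ch y : B y -> res (Nm y) != 0 -> spl (ch B y) <-> issq (res (Nm y)).
Proof.
move=> By ny; split.
  move=> [_ [[r [z [Bz ->]]] [s s0]]]; rewrite resNm_mod => e.
  have r0 : res r != 0.
    by apply: contra_neq s0 => r0; apply: sq0; rewrite -e r0 expr0n mul0r.
  by rewrite -(issq_mul _ r0) e; apply/existsP; exists s.
move=> /existsP[s /eqP e]; exists y; split.
  by exists 1, 0; case: (Bk) => -[B0 _ _] _ _; split=> //; rewrite /hpi scale1r scaler0 addr0.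
by exists s => //; apply: contra_neq ny => s0; rewrite e s0 expr0n.
Qed.

Variables (w1 w2 w3 : L).
Hypothesis Bw : forall x, B x <-> span3 w1 w2 w3 x.
Hypothesis d0 : det3 w1 w2 w3 != 0.

Definition yw d : L := rlift d.1.1 *: w1 + rlift d.1.2 *: w2 + rlift d.2 *: w3.

Lemma ch_inj d d' : normd d -> normd d' -> res (Nm (yw d')) != 0 -> ch B (yw d) = ch B (yw d') -> d = d'.
Proof.
move=> nd nd' ny e; have : ch B (yw d) (yw d).
  by exists 1, 0; case: (Bk) => -[B0 _ _] _ _; split=> //; rewrite /hpi scale1r scaler0 addr0.
rewrite e => -[r [z [/Bw[c1 [c2 [c3 ez]]] ey]]].
have : yw d = (r * rlift d'.1.1 + pi * c1) *: w1 + (r * rlift d'.1.2 + pi * c2) *: w2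
   + (r * rlift d'.2 + pi * c3) *: w3 by rewrite ey ez /yw /hpi; vec.
rewrite /yw => /(det3_inj d0)[/(congr1 res) h1 /(congr1 res) h2 /(congr1 res) h3].
rewrite !rmorphD !rmorphM /= res_unif !mul0r !addr0 !rliftK in h1 h2 h3.
by apply: normd_eq => //; rewrite h1 h2 || rewrite h1 h3 || rewrite h2 h3; ring.
Qed.

(** [ch B y] depends only on the projective point of y in B / pi B. The predicate on norms serves to
    separate split from nonsplit lines. *)
Lemma csize_Lin (P : pred F) (Q : set L -> Prop) :
  (forall y, B y -> res (Nm y) != 0 -> Q (ch B y) <-> P (res (Nm y))) ->
  csize (fun A => (Lin (k + 2) A /\ Q A) /\ q2 A = B) =
  #|[pred d | normd d && ((res (Nm (yw d)) != 0) && P (res (Nm (yw d))))]|.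
Proof.
move=> QP; have Byw d : B (yw d) by apply/Bw; do 3!eexists.
set S := fun A => _; suff [] : fin S /\ csize S = #|[pred d | normd d && ((res (Nm (yw d)) != 0)
  && P (res (Nm (yw d))))]| by [].
apply: (csize_fin (g := fun d => ch B (yw d))).
- move=> d /and3P[nd ny Py]; split; last exact: q2_ch.
  by split; [exact: ch_Lin|apply/QP].
- move=> A [[lA QA] eB]; have [y [By ny eA]] := Lin_ch lA eB.
  have [y1 [y2 [y3 ey]]] := (Bw _).1 By.
  have [|r [r0 nd]] := @normd_scale F (res y1) (res y2) (res y3).
    move=> [/resZ[c1 e1] /resZ[c2 e2] /resZ[c3 e3]]; move/eqP: ny; apply.
    have -> : y = 0 *: y + hpi (c1 *: w1 + c2 *: w2 + c3 *: w3).
      by rewrite scale0r add0r ey e1 e2 e3 /hpi; vec.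
    by rewrite resNm_mod rmorph0 expr0n mul0r.
  set d := (_, _, _) in nd.
  have lft (z : D) : exists c, rlift (r * res z) = rlift r * z + pi * c.
    have [|c e] := @resZ D (rlift (r * res z) - rlift r * z).
      by rewrite rmorphB rmorphM /= !rliftK subrr.
    by exists c; rewrite -e addrC subrK.
  have [c1 e1] := lft y1; have [c2 e2] := lft y2; have [c3 e3] := lft y3.
  have eyw : yw d = rlift r *: y + hpi (c1 *: w1 + c2 *: w2 + c3 *: w3).
    by rewrite /yw /d e1 e2 e3 ey /hpi; vec.
  have eA' : ch B (yw d) = ch B y.
    apply: ch_eq eyw; first by rewrite unit_resE rliftK.
    by apply/Bw; do 3!eexists.
  have nyd : res (Nm (yw d)) != 0 by rewrite eyw resNm_mod mulf_neq0 // expf_neq0 // rliftK.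
  exists d; last by rewrite eA'.
  by apply/and3P; split=> //; apply/QP => //; rewrite eA' -eA.
- by move=> d d' /and3P[nd _ _] /and3P[nd' ny' _]; apply: ch_inj.
Qed.

End Child.

Definition LinS k : set (set L) := fun A => Lin k A /\ spl A.
Definition LinN k : set (set L) := fun A => Lin k A /\ ~ spl A.
Definition RUS k : set (set L) := fun A => [/\ Alg k A, RU A & spl A].
Definition RUN k : set (set L) := fun A => [/\ Alg k A, RU A & ~ spl A].

Lemma fin_Lin k : fin (@Lin D k).
Proof. by apply: (fin_sub (fin_Alg D k)) => A []. Qed.

Lemma fin_RUS k : fin (RUS k).
Proof. by apply: (fin_sub (fin_Alg D k)) => A []. Qed.

Lemma Lin_lt2 k A : Lin k.+1 A -> (1 <= k)%N.
Proof. by move=> /q2_Lin[k' [e _ _]]; lia. Qed.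

(** Modulo pi the norm on B is a constant times the square of one coordinate. Its nonzero values
    form one square class, so the lines A with [q2 A = B] are all split or all nonsplit, as B is. *)
Lemma OB_third k B v1 v2 v3 s1 s2 s3 : Alg k B -> OB B v1 v2 v3 s1 s2 s3 ->
  res s1 != 0 -> res s2 != 0 -> res s3 = 0 ->
  [/\ forall d, res (Nm (yw v1 v2 v3 d)) = d.2 ^+ 2 * res (Nm v3), res (Nm v3) != 0
    & spl B <-> issq (res (Nm v3))].
Proof.
move=> Bk o r1 r2 r3.
have n1 : res (Nm v1) = 0 by apply/eqP; rewrite (OB_resN o) r3 mulr0.
have n2 : res (Nm v2) = 0 by apply/eqP; rewrite (OB_resN (OB_rot o)) r3 mul0r.
have n3 : res (Nm v3) != 0 by rewrite (OB_resN (OB_rot (OB_rot o))) mulf_neq0.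
split=> // [d|].
  rewrite (OB_Nm _ _ _ o); move: (Nm v1) (Nm v2) (Nm v3) n1 n2 {n3} => N1 N2 N3 n1 n2.
  by rewrite !rmorphD !(rmorphM res) /= n1 n2 !mulr0 !add0r rliftK -?expr2.
have h := spl_issq o r1 r2 r3; apply: (iff_trans h).
rewrite (_ : - (res s1 * res s2) = (2%:R) ^+ 2 * res (Nm v3)) ?issq_mul ?two_res //.
rewrite -rmorphM (OB_Nm1 (OB_rot (OB_rot o))) rmorphN opprK rmorphM rmorph_nat; ring.
Qed.

Lemma csize_child_S k B : Alg k.+1 B -> RU B ->
  csize (fun A => LinS (k.+1 + 2) A /\ q2 A = B) = if `[< spl B >] then (q ^ 2)%N else 0%N.
Proof.
move=> Bk rU; have [v1 [v2 [v3 [s1 [s2 [s3 [o uu1 uu2 [u [_ e3]]]]]]]]] := RU_type Bk rU.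
have r3 : res s3 = 0 by rewrite e3 exprS !rmorphM /= res_unif mul0r mulr0.
rewrite unit_resE in uu1; rewrite unit_resE in uu2.
have [eN n3 hs] := OB_third Bk o uu1 uu2 r3.
rewrite (csize_Lin Bk (ob_span o) (ob_det o) (P := @issq F)) => [|y By ny]; last exact: (spl_ch Bk).
have -> : `[< spl B >] = issq (res (Nm v3)) by apply/asboolP/idP => /hs.
rewrite -card_third.
apply: eq_card => d; rewrite !inE eN mulf_eq0 expf_eq0 /= (negbTE n3) orbF.
by have [//|d0] := eqVneq d.2 0; rewrite issq_mul.
Qed.

Lemma csize_child_N k B : Alg k.+1 B -> RU B ->
  csize (fun A => LinN (k.+1 + 2) A /\ q2 A = B) = if `[< spl B >] then 0%N else (q ^ 2)%N.
Proof.
move=> Bk rU; have [v1 [v2 [v3 [s1 [s2 [s3 [o uu1 uu2 [u [_ e3]]]]]]]]] := RU_type Bk rU.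
have r3 : res s3 = 0 by rewrite e3 exprS !rmorphM /= res_unif mul0r mulr0.
rewrite unit_resE in uu1; rewrite unit_resE in uu2.
have [eN n3 hs] := OB_third Bk o uu1 uu2 r3.
rewrite (csize_Lin Bk (ob_span o) (ob_det o) (P := fun a : F => ~~ issq a)) => [|y By ny]; last first.
  by rewrite (spl_ch Bk) //; split => /negP.
have -> : (if `[< spl B >] then 0%N else (q ^ 2)%N) = if ~~ issq (res (Nm v3)) then (q ^ 2)%N else 0%N.
  have -> : `[< spl B >] = issq (res (Nm v3)) by apply/asboolP/idP => /hs.
  by case: issq.
rewrite -card_third.
apply: eq_card => d; rewrite !inE eN mulf_eq0 expf_eq0 /= (negbTE n3) orbF.
by have [//|d0] := eqVneq d.2 0; rewrite issq_mul.
Qed.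

Lemma q2_addn k A : Lin (k.+1 + 2) A -> Alg k.+1 (q2 A) /\ RU (q2 A).
Proof.
rewrite [(k.+1 + 2)%N]addn2 => /q2_Lin[k' [e Ak rU]].
by have -> : k.+1 = k' by lia.
Qed.

Lemma csize_LinS k : csize (LinS (k.+1 + 2)) = (q ^ 2 * csize (RUS k.+1))%N.
Proof.
apply/eqP; rewrite -eqz_nat; apply/eqP.
have fP : fin (LinS (k.+1 + 2)) by apply: (fin_sub (fin_Lin (k.+1 + 2))) => A [].
have fU : fin (fun A : set L => Alg k.+1 A /\ RU A) by apply: (fin_sub (fin_Alg D k.+1)) => A [].
rewrite (csize_fiber fP fU (p := q2) (n := fun B => if `[< spl B >] then (q ^ 2)%N else 0%N)).
- rewrite PoszM csizeE -ssum_mull (@ssum_set _ (RUS k.+1) (fun A => (Alg k.+1 A /\ RU A) /\ spl A)).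
    by rewrite [RHS]ssum_mkcond //; apply: ssum_ext => A _; case: ifP; rewrite ?mulr1.
  by move=> A; split=> [[]|[[]]].
- by move=> A [/q2_addn].
- by move=> B [Bk rU]; apply: csize_child_S.
Qed.

Lemma csize_LinN k : csize (LinN (k.+1 + 2)) = (q ^ 2 * csize (RUN k.+1))%N.
Proof.
apply/eqP; rewrite -eqz_nat; apply/eqP.
have fP : fin (LinN (k.+1 + 2)) by apply: (fin_sub (fin_Lin (k.+1 + 2))) => A [].
have fU : fin (fun A : set L => Alg k.+1 A /\ RU A) by apply: (fin_sub (fin_Alg D k.+1)) => A [].
rewrite (csize_fiber fP fU (p := q2) (n := fun B => if `[< spl B >] then 0%N else (q ^ 2)%N)).
- rewrite PoszM csizeE -ssum_mull (@ssum_set _ (RUN k.+1) (fun A => (Alg k.+1 A /\ RU A) /\ ~ spl A)).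
    by rewrite [RHS]ssum_mkcond //; apply: ssum_ext => A _; rewrite asbool_neg; case: ifP; rewrite ?mulr1.
  by move=> A; split=> [[]|[[]]].
- by move=> A [/q2_addn].
- by move=> B [Bk rU]; apply: csize_child_N.
Qed.

Lemma yw_LT d : res (Nm (yw (1, 0, 0) (0, 1, 0) (0, 0, 1) d)) = d.1.1 * d.2 + d.1.2 ^+ 2.
Proof.
rewrite (_ : Nm _ = rlift d.1.1 * rlift d.2 + rlift d.1.2 ^+ 2).
  by rewrite rmorphD rmorphM rmorphXn /= !rliftK.
by rewrite /Nm /yw; crd; cbn [fst snd]; ring.
Qed.

Lemma q2_two A : Lin 2 A -> q2 A = @LT D.
Proof.
move=> /q2_Lin[k' [e Ak _]]; apply/Alg0E; suff <- : k' = 0%N by [].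
by lia.
Qed.

Lemma csize_LinS2 : csize (LinS 2) = (q * sigma F + q)%N.
Proof.
have LT0 := (Alg0E (@LT D)).2 erefl; have sb := SB_LT D.
rewrite -(card_NL_split F).
rewrite (@eq_card _ _ [pred d | normd d && ((res (Nm (yw (1, 0, 0) (0, 1, 0) (0, 0, 1) d)) != 0)
  && issq (res (Nm (yw (1, 0, 0) (0, 1, 0) (0, 0, 1) d))))]); last by move=> d; rewrite !inE yw_LT.
rewrite -(csize_Lin LT0 (sb_span sb) (sb_det sb) (Q := @spl D)).
  by apply: csize_set => A; split=> [[lA sA]|[[lA sA] _]]; split=> //; exact: q2_two.
by move=> y By ny; apply: (spl_ch LT0).
Qed.

Lemma csize_LinN2 : csize (LinN 2) = (q * sigma F)%N.
Proof.
have LT0 := (Alg0E (@LT D)).2 erefl; have sb := SB_LT D.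
rewrite -(card_NL_nsplit (two_res D)).
rewrite (@eq_card _ _ [pred d | normd d && ((res (Nm (yw (1, 0, 0) (0, 1, 0) (0, 0, 1) d)) != 0)
  && ~~ issq (res (Nm (yw (1, 0, 0) (0, 1, 0) (0, 0, 1) d))))]); last by move=> d; rewrite !inE yw_LT.
rewrite -(csize_Lin LT0 (sb_span sb) (sb_det sb) (P := fun a : F => ~~ issq a) (Q := fun A => ~ spl A)).
  by apply: csize_set => A; split=> [[lA sA]|[[lA sA] _]]; split=> //; exact: q2_two.
by move=> y By ny; rewrite (spl_ch LT0) //; split => /negP.
Qed.

Lemma res_Bf_nv y (x : F) :
  res (Bf y (nv (Some x))) = res y.2 + 2%:R * res y.1.2 * x - res y.1.1 * x ^+ 2.
Proof.
rewrite /Bf /= (_ : _ + _ = y.2 + 2%:R * y.1.2 * rlift x - y.1.1 * rlift x ^+ 2); last by ring.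
by rewrite rmorphB rmorphD !(rmorphM res) rmorph_nat /= !rliftK -?expr2.
Qed.

(** The Borel subalgebras containing y modulo pi are the zeros, on the projective line, of a binary
    quadratic form of discriminant 4 Nm y. *)
Lemma beta_Lin k A : Lin k.+1 A -> beta A = if `[< spl A >] then 2%N else 0%N.
Proof.
move=> lA; have [Ak rU llA] := lA; have [y [Ay ny]] := rU.
have iB i : inB i A <-> res (Bf y (nv i)) = 0.
  split=> [h|h x /(Line_gen llA Ay ny)[r [z ->]]]; first exact: h.
  by rewrite BfDl /hpi !BfZl rmorphD !rmorphM /= h mulr0 res_unif mul0r addr0.
have -> : `[< spl A >] = issq (res (Nm y)).
  apply/asboolP/idP; last first.
    move=> /existsP[s /eqP e]; exists y; split=> //; exists s => //.
    by apply: contra_neq ny => s0; rewrite e s0 expr0n.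
  move=> [x [/(Line_gen llA Ay ny)[r [z ->]] [s s0]]]; rewrite resNm_mod => e.
  have r0 : res r != 0.
    by apply: contra_neq s0 => r0; apply: sq0; rewrite -e r0 expr0n mul0r.
  by rewrite -(issq_mul _ r0) e; apply/existsP; exists s.
have -> : beta A = #|[pred i | res (Bf y (nv i)) == 0]|.
  by apply: eq_card => i; rewrite !inE; apply/asboolP/eqP => /iB.
have -> : #|[pred i | res (Bf y (nv i)) == 0]| = ((res (Bf y (nv None)) == 0%R) + #|[pred x | res (Bf y (nv (Some x))) == 0%R]|)%N.
  rewrite (cardD1 None) inE; congr addn.
  rewrite -[RHS]cardsE -(card_imset _ (@Some_inj _)); apply: eq_card => -[x|]; rewrite !inE /=.
    by apply/idP/imsetP => [h|[x' + [->]]]; [exists x; rewrite ?inE|rewrite inE].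
  by apply/esym/negbTE/negP => /imsetP[].
set a := res y.1.1; set b := res y.1.2; set c := res y.2.
have eN : res (Nm y) = a * c + b ^+ 2 by rewrite /Nm rmorphD rmorphM rmorphXn.
have -> : res (Bf y (nv None)) = a by rewrite /Bf /= /a; apply: congr1; ring.
have eS (x : F) : res (Bf y (nv (Some x))) = c + 2%:R * b * x - a * x ^+ 2 := res_Bf_nv y x.
have [a0|a0] := eqVneq a 0.
  have b0 : b != 0 by apply: contra_neq ny => b0; rewrite eN a0 b0 mul0r expr0n addr0.
  have -> : issq (res (Nm y)) by apply/existsP; exists b; rewrite eN a0 mul0r add0r.
  congr S; rewrite -(card1 (- c / (2%:R * b))); apply: eq_card => x; rewrite !inE eS a0 mul0r subr0.
  have bb : 2%:R * b != 0 by rewrite mulf_neq0 ?two_res.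
  rewrite addrC addr_eq0; apply/eqP/eqP => [<-|->]; first by rewrite mulrC mulKf.
  by rewrite mulrC divfK.
rewrite add0n; have nN : - res (Nm y) != 0 by rewrite oppr_eq0.
have := card_sqrt (two_res D) nN (oner_neq0 F); rewrite mulr1 opprK => <-.
pose f (x : F) := a * x - b; pose g (x : F) := (x + b) / a.
have fg : cancel f g by move=> x; rewrite /f /g subrK mulrC mulKf.
have gf : cancel g f by move=> x; rewrite /f /g mulrC divfK // addrK.
apply: (card_bij fg gf) => x; rewrite /f eS eN mul1r.
have -> : - (a * c + b ^+ 2) + (a * x - b) ^+ 2 = - a * (c + 2%:R * b * x - a * x ^+ 2) by ring.
by rewrite mulf_eq0 oppr_eq0 (negbTE a0).
Qed.

Lemma w_RU k m A : Alg k A -> RU A -> w m A = (q ^ minn k m)%N.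
Proof.
move=> Ak rU; have [v1 [v2 [v3 [s1 [s2 [s3 [o uu1 uu2 [u [uu e3]]]]]]]]] := RU_type Ak rU.
have [_ ->] := w_OB m o uu1 uu2 uu (a1 := 0%N) (a2 := 0%N) (esym (mulr1 s1)) (esym (mulr1 s2)) e3.
by rewrite !min0n.
Qed.

End Lines.


Lemma csize_eq0 (T : choiceType) (P : set T) x : fin P -> csize P = 0%N -> ~ P x.
Proof. by move=> fP /size0nil e /(enumSP fP); rewrite e. Qed.

(** * Algebras in [R1] whose parent is not in [R0] *)

Section NilpotentImage.
Variable D : dvr.
Local Notation pi := (unif D).
Local Notation F := (resF D).
Local Notation q := #|resF D|.
Local Notation res := (res D).
Local Notation L := (sl2 D).
Implicit Types (A M B : set L) (x y z v : L) (d : F * F * F).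

Lemma res_unit_pow (u : D) n : u \is a GRing.unit -> (res (u * pi ^+ n) == 0) = (n != 0)%N.
Proof.
rewrite unit_resE rmorphM rmorphXn /= res_unif => /negbTE u0.
by rewrite mulf_eq0 u0 expf_eq0 eqxx andbT lt0n.
Qed.

(** The first structure constant of the parent is divisible by pi; as the parent is not [R0], one of
    the other two is a unit. *)
Lemma R1a_valuations k A : R1a k.+1 A -> exists v1 v2 v3 s1 s2 s3 b c u2 u3,
  [/\ OB A (hpi v1) v2 v3 s1 (pi * s2) (pi * s3), OB (par A) v1 v2 v3 (pi * s1) s2 s3,
   [/\ s1 \is a GRing.unit, s2 = u2 * pi ^+ b, u2 \is a GRing.unit,
   s3 = u3 * pi ^+ c & u3 \is a GRing.unit], k = (b + c).+1
   & (b == 0)%N || (c == 0)%N].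
Proof.
move=> [rA nR]; have [v1 [v2 [v3 [s1 [s2 [s3 [b [c [u2 [u3 [o o' us ek _]]]]]]]]]]] := par_Alg rA.
exists v1, v2, v3, s1, s2, s3, b, c, u2, u3; split=> //.
apply/negPn/negP; rewrite negb_or => /andP[b0 c0]; apply: nR; case: us => _ e2 uu2 e3 uu3.
apply/(R0_OB o'); split; apply/eqP; rewrite ?e2 ?e3 ?res_unit_pow //.
by rewrite rmorphM /= res_unif mul0r.
Qed.

Lemma w_R1a k m A : R1a k.+1 A -> w m A = (q ^ (minn 1 m + minn k m))%N.
Proof.
move=> /R1a_valuations[v1 [v2 [v3 [s1 [s2 [s3 [b [c [u2 [u3 [o _ [uu1 e2 uu2 e3 uu3] -> bc]]]]]]]]]]].
have f2 : pi * s2 = u2 * pi ^+ b.+1 by rewrite e2 exprS mulrCA.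
have f3 : pi * s3 = u3 * pi ^+ c.+1 by rewrite e3 exprS mulrCA.
have [_ ->] := w_OB m o uu1 uu2 uu3 (a1 := 0%N) (esym (mulr1 s1)) f2 f3.
by rewrite min0n; case/orP: bc => /eqP ->; rewrite ?addn0 ?add0n // addnC.
Qed.

Lemma card_nv_nil y : res (Nm y) = 0 -> (exists i, res (Bf y (nv i)) != 0) ->
  #|[pred i : option F | res (Bf y (nv i)) == 0]| = 1%N.
Proof.
set a := res y.1.1; set b := res y.1.2; set c := res y.2.
have -> : res (Nm y) = a * c + b ^+ 2 by rewrite /Nm rmorphD rmorphM rmorphXn.
have eN : res (Bf y (nv None)) = a by rewrite /Bf /= /a; apply: congr1; ring.
have [a0|a0] := eqVneq a 0.
  rewrite a0 mul0r add0r => /sq0 b0 [i ni].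
  have c0 : c != 0.
    case: i ni => [x|]; last by rewrite eN a0 eqxx.
    by rewrite res_Bf_nv -/a -/b -/c a0 b0 mulr0 !mul0r addr0 subr0.
  rewrite -(card1 (None : option F)); apply: eq_card => -[x|]; rewrite !inE ?eN ?a0 ?eqxx //.
  by rewrite res_Bf_nv -/a -/b -/c a0 b0 mulr0 !mul0r addr0 subr0 (negbTE c0).
move=> N0 _; rewrite -(card1 (Some (b / a))); apply: eq_card => -[x|]; rewrite !inE; last by rewrite eN (negbTE a0).
rewrite res_Bf_nv -/a -/b -/c.
have e : - a * (c + 2%:R * b * x - a * x ^+ 2) = (a * x - b) ^+ 2 - (a * c + b ^+ 2) by ring.
rewrite N0 subr0 in e.
rewrite -[LHS](_ : (- a * (c + 2%:R * b * x - a * x ^+ 2) == 0) = _); last by rewrite mulf_eq0 oppr_eq0 (negbTE a0).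
rewrite e sqrf_eq0 subr_eq0; apply/eqP/eqP => [<-|[->]]; first by rewrite mulrC mulKf.
by rewrite mulrC divfK.
Qed.

(** Modulo pi, a submodule of nilpotent elements is totally isotropic, hence at most a line, and a
    nilpotent line lies in exactly one Borel subalgebra. *)
Lemma beta_nil A y : (forall x, A x -> res (Nm x) = 0) -> submod A -> A y ->
  (exists i, res (Bf y (nv i)) != 0) -> beta A = 1%N.
Proof.
move=> hN [_ AD _] Ay ny; rewrite -(card_nv_nil (hN _ Ay) ny).
apply: eq_card => i; rewrite !inE; apply/asboolP/eqP => [h|h x Ax]; first exact: h.
have g2 : res (gBi i y).2 = 0 by rewrite gBi_ga.
have g1 : res (gBi i y).1.2 = 0.
  by have := hN _ Ay; rewrite -(gBi_Nm i) /Nm rmorphD rmorphM /= g2 mulr0 add0r rmorphXn => /sq0.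
have g0 : res (gBi i y).1.1 != 0.
  case: ny => j; apply: contra_neq => g0.
  by rewrite -(gBi_Bf i) /Bf !rmorphD !rmorphM /= g0 g1 g2 !(mul0r, mulr0, addr0).
have B0 : res (Bf x y) = 0.
  by have := hN _ (AD _ _ Ax Ay); rewrite NmD (rmorphD _ (Nm x + Nm y)) (rmorphD _ (Nm x)) (hN _ Ax) (hN _ Ay) !add0r.
have e : res (gBi i y).1.1 * res (Bf x (nv i)) = 0.
  rewrite -[RHS]B0 -gBi_ga -(gBi_Bf i x) BfC /Bf !rmorphD !rmorphM /=.
  by rewrite g1 g2 !(mul0r, mulr0, addr0).
by move/eqP: e; rewrite mulf_eq0 (negbTE g0) /= => /eqP.
Qed.

Lemma res_Bf_nv_pi y : (forall i, res (Bf y (nv i)) = 0) -> exists z, y = hpi z.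
Proof.
move=> h; have h0 := h None; have h1 := h (Some 0); have h2 := h (Some 1).
have a0 : res y.1.1 = 0 by rewrite -h0 /Bf /=; apply: congr1; ring.
move: h1 h2; rewrite !res_Bf_nv a0 !(mul0r, mulr0, subr0, addr0, mulr1) => c0.
rewrite c0 add0r => /eqP; rewrite mulf_eq0 (negbTE (two_res D)) /= => /eqP b0.
have [z1 e1] := resZ a0; have [z2 e2] := resZ b0; have [z3 e3] := resZ c0.
exists (z1, z2, z3); apply: sl2P; rewrite /hpi; crd; cbn [fst snd]; by rewrite ?e1 ?e2 ?e3.
Qed.

(** What must be excluded is that A lies in pi L. Then pi^2 would divide all norms on A, but a unit
    [s2] or [s3] makes -4 times the norm of [v3] or [v2] have valuation 1. *)
Lemma beta_R1a k A : R1a k.+1 A -> beta A = 1%N.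
Proof.
move=> rA; have [[Ak _ nU] _] := rA; have sA : submod A by case: Ak.
have hN v : A v -> res (Nm v) = 0.
  by move=> Av; apply/eqP/negPn/negP => h; apply: nU; exists v.
have [v1 [v2 [v3 [s1 [s2 [s3 [b [c [u2 [u3 [o _ [uu1 e2 uu2 e3 uu3] _ bc]]]]]]]]]]] := R1a_valuations rA.
have [A1 A2 A3] := OB_mem o.
have [[y [Ay ny]]|no] := pselect (exists y, A y /\ exists i, res (Bf y (nv i)) != 0).
  exact: beta_nil Ay ny.
have hp v : A v -> pdvd 2 (Nm v).
  move=> Av; have [|z ->] := @res_Bf_nv_pi v; last by rewrite NmZ; apply/pdvdMr/pdvd_pow.
  by move=> i; apply/eqP/negPn/negP => h; apply: no; exists v; split=> //; exists i.
have h2 s v : A v -> s \is a GRing.unit -> pi * s * s1 = - (4%:R * Nm v) -> False.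
  move=> Av us e; have : pdvd 2 (pi * s * s1) by rewrite e; apply/pdvdN/pdvdM/hp.
  have -> : pi * s * s1 = s * s1 * pi ^+ 1 by ring.
  have uu' : s * s1 \is a GRing.unit by rewrite unitrM us.
  by move=> h; have := pdvd_unit uu' h.
case/orP: bc => /eqP z0; last first.
  by case: (h2 s3 v2) => //; [rewrite e3 z0 mulr1|rewrite (OB_Nm1 (OB_rot o))].
case: (h2 s2 v3) => //; first by rewrite e2 z0 mulr1.
by rewrite mulrC (OB_Nm1 (OB_rot (OB_rot o))).
Qed.

Lemma fin_R1a k : fin (@R1a D k).
Proof. by apply: (fin_sub (fin_R1 D k)) => A []. Qed.

Lemma R1a_ge2 k A : R1a k A -> (2 <= k)%N.
Proof.
case: k => [|[|k]] // rA; first by case: rA => -[/Alg0E -> _ /(_ (RU_LT D))].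
by have [v1 [v2 [v3 [s1 [s2 [s3 [b [c [u2 [u3 [_ _ _ ]]]]]]]]]]] := R1a_valuations rA.
Qed.

Lemma card_infinity : #|[pred d : F * F * F | d == (0, 0, 1)]| = 1%N.
Proof. exact: card1. Qed.

(** The radical condition leaves only d = (0, 0, 1), where d S d is a unit times s_3 modulo pi^2. It
    survives because s_3 has valuation 1, the index of B being q. *)
Lemma csize_children_RU1 B : Alg 1 B -> RU B -> csize (fun A => R1 2 A /\ par A = B) = 1%N.
Proof.
move=> Bk rB; have [v1 [v2 [v3 [s1 [s2 [s3 [o uu1 uu2 [u [uu e3]]]]]]]]] := RU_type Bk rB.
rewrite (csize_children Bk (OB_SB o)) /nchild; apply: etrans card_infinity; apply: eq_card => -[[d1 d2] d3].
rewrite unit_resE in uu1; rewrite unit_resE in uu2.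
rewrite !inE /israd /Qd /= rmorph0 !mul0r !addr0 add0r !mulf_eq0 (negbTE uu1) (negbTE uu2) /=.
have r3 : res s3 = 0 by rewrite e3 rmorphM rmorphXn /= res_unif mulr0.
rewrite r3 eqxx /= andbT /normd /= !xpair_eqE.
have [->|n1] := eqVneq d1 0; last by rewrite !andbF.
have [->|n2] := eqVneq d2 0; last by rewrite !andbF.
rewrite eq_sym (negbTE (oner_neq0 F)) /=; have [->|_] := eqVneq d3 1; rewrite ?andbF //.
have r0 : res (rlift (0 : F)) = 0 by rewrite rliftK.
have [z ez] := resZ r0; have r1 : res (rlift (1 : F)) = 1 by rewrite rliftK.
apply/asboolP => h; have : pdvd 2 (s3 * rlift 1 ^+ 2).
  have -> : s3 * rlift 1 ^+ 2 = (s1 * rlift 0 ^+ 2 + s2 * rlift 0 ^+ 2 + s3 * rlift 1 ^+ 2) - pi ^+ 2 * (s1 * z ^+ 2 + s2 * z ^+ 2) :> D by rewrite ez; ring.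
  apply: pdvdB; last by exists (s1 * z ^+ 2 + s2 * z ^+ 2).
  by move: h; rewrite mulr0 !mul0r addr0.
have -> : s3 * rlift 1 ^+ 2 = (u * rlift 1 ^+ 2) * pi ^+ 1 :> D by rewrite e3; ring.
have uu' : u * rlift 1 ^+ 2 \is a GRing.unit by rewrite unitrM uu unitrX // unit_resE r1 oner_eq0.
by move=> h2; have := pdvd_unit uu' h2.
Qed.

(** Here b = c = 0, so the parent is [RU] of index q, too small an index for a line. *)
Lemma par_R1a2 A : R1a 2 A -> Bo 1 (par A).
Proof.
move=> rA; have [v1 [v2 [v3 [s1 [s2 [s3 [b [c [u2 [u3 [_ o' [_ e2 uu2 e3 uu3] ek _]]]]]]]]]]] := R1a_valuations rA.
have [_ [_ [_ [_ [_ [_ [_ [_ [_ [_ [_ _ _ _ [pA _]]]]]]]]]]]] := par_Alg rA.1.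
have [b0 c0] : b = 0%N /\ c = 0%N by lia.
have rU : RU (par A).
  exists v1; have [? _ _] := OB_mem o'; split=> //; rewrite (OB_resN o') mulf_eq0 e2 e3.
  by rewrite !res_unit_pow // b0 c0.
split=> // lA; have l1 : Lin 1 (par A) by split.
by have := Lin_lt2 l1.
Qed.

Lemma csize_R1a2 : csize (@R1a D 2) = q.+1.
Proof.
have := @csize_fiber _ _ (@R1a D 2) (@Bo D 1) (@par D) (fun=> 1%N) (fin_R1a 2).
have fB : fin (@Bo D 1) by apply: (fin_sub (fin_Alg D 1)) => A [].
move=> /(_ fB par_R1a2) h; apply/eqP; rewrite -eqz_nat h; last first.
  move=> B [Bk rB _]; apply: etrans (csize_children_RU1 Bk rB); apply: csize_set => A.
  by split=> [[[rA _] e]|[rA e]]; split=> //; split=> //; rewrite e; apply: RU_nR0 Bk rB.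
by rewrite ssum_const mulr1 csize_Bo expn0 mul1n.
Qed.

(** As s1 is a unit, the radical condition says d_1 = 0, and d S d is then pi times a binary form in
    d_2, d_3 modulo pi^2. The points counted are those of a projective line where this form does not
    vanish. *)
Lemma csize_children_R1 k B v1 v2 v3 (s1 s2 s3 : D) : R1 k B ->
  OB B v1 v2 v3 s1 (pi * s2) (pi * s3) -> res s1 != 0 ->
  csize (fun A => R1 k.+1 A /\ par A = B) =
  (#|[pred c | (res s2 + res s3 * c ^+ 2 != 0)%R]| + (res s3 != 0%R))%N.
Proof.
move=> [Bk _ _] o r1; rewrite (csize_children Bk (OB_SB o)) /nchild.
pose P d := (d.1.1 == 0) && (res s2 * d.1.2 ^+ 2 + res s3 * d.2 ^+ 2 != 0).
transitivity #|[pred d | normd d && P d]|; last first.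
  rewrite card_normd /P /=; congr addn; last first.
    by rewrite eqxx expr0n expr1n mulr0 add0r mulr1.
  rewrite [X in (X + _)%N]eq_card0 => [|x]; last by rewrite !inE oner_eq0.
  by apply: eq_card => c; rewrite !inE eqxx expr1n mulr1.
apply: eq_card => -[[d1 d2] d3]; rewrite !inE /P /israd /Qd /=; congr andb.
rewrite rmorph0 !rmorphM /= res_unif !(mul0r, addr0, add0r) eqxx !andbT mulf_eq0 (negbTE r1) /=.
have [->|//] := eqVneq d1 0; rewrite /=; congr negb.
have r0 : res (rlift (0 : F)) = 0 by rewrite rliftK.
have [z ez] := resZ r0.
have e : s1 * rlift 0 ^+ 2 + pi * s2 * rlift d2 ^+ 2 + pi * s3 * rlift d3 ^+ 2 + 2 * 0 * rlift 0 * rlift d3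
  = pi ^+ 2 * (s1 * z ^+ 2) + pi ^+ 1 * (s2 * rlift d2 ^+ 2 + s3 * rlift d3 ^+ 2) :> D by rewrite ez; ring.
have -> : res s2 * d2 ^+ 2 + res s3 * d3 ^+ 2 = res (s2 * rlift d2 ^+ 2 + s3 * rlift d3 ^+ 2).
  by rewrite rmorphD !rmorphM /= !rliftK.
rewrite e; apply/asboolP/eqP => [h|/resP[t ->]].
  apply/resP; apply: (@pdvd_mulI D 1 1); rewrite -[X in pdvd _ X](addKr (pi ^+ 2 * (s1 * z ^+ 2))).
  by apply: pdvdD => //; apply/pdvdN; exists (s1 * z ^+ 2).
by apply: pdvdD; [exists (s1 * z ^+ 2)|exists t; ring].
Qed.

Lemma csize_children_R1b k B : R1b k.+1 B -> csize (fun A => R1 k.+2 A /\ par A = B) = 0%N.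
Proof.
move=> [rB r0]; have [v1 [v2 [v3 [s1 [s2 [s3 [b [c [u2 [u3 [o o' [uu1 _ _ _ _] _ _]]]]]]]]]]] := par_Alg rB.
have [_ e2 e3] := (R0_OB o').1 r0.
rewrite unit_resE in uu1; rewrite (csize_children_R1 rB o) // e2 e3 eqxx addn0.
by apply: eq_card0 => x; rewrite !inE mul0r addr0 eqxx.
Qed.

(** For k = 1 the binary form is nondegenerate, and it is split because the parent of B is a Borel
    subalgebra; 2 of the q + 1 points are lost. Otherwise the form is a multiple of a square and
    loses 1 point. *)
Lemma csize_children_R1a k B : R1a k.+1 B ->
  csize (fun A => R1 k.+2 A /\ par A = B) = if k == 1%N then q.-1 else q.
Proof.
move=> rB; have [v1 [v2 [v3 [s1 [s2 [s3 [b [c [u2 [u3 [o o' [uu1 e2 uu2 e3 uu3] ek bc]]]]]]]]]]] := R1a_valuations rB.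
rewrite unit_resE in uu1; rewrite (csize_children_R1 rB.1 o) //.
have z2 := res_unit_pow b uu2; have z3 := res_unit_pow c uu3; rewrite -e2 in z2; rewrite -e3 in z3.
have [b0|b0] := eqVneq b 0%N; have [c0|c0] := eqVneq c 0%N.
- rewrite ek b0 c0 /= in z2 z3 *; rewrite z3 card_nsqrt ?z2 ?z3 ?two_res //.
  have : spl (par B) by case: (@Bo_spl_beta D 0 (par B)) => //; apply: par_R1a2; move: rB; rewrite ek b0 c0.
  rewrite (spl_issq (OB_rot o')) ?z2 ?z3 // => [->|]; last by rewrite rmorphM /= res_unif mul0r.
  by have := q_gt1 D; rewrite /=; lia.
- rewrite ek b0 add0n eqSS (negbTE c0).
  move: z2 z3; rewrite b0 (negbTE c0) /= => z2 /eqP ->; rewrite eqxx addn0.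
  by apply: eq_card => x; rewrite !inE mul0r addr0 z2.
- rewrite ek c0 addn0 eqSS (negbTE b0).
  move: z2 z3; rewrite c0 (negbTE b0) /= => /eqP -> z3; rewrite z3 -(card_nz F); congr addn.
  by apply: eq_card => x; rewrite !inE add0r mulf_eq0 z3 /= sqrf_eq0.
by move: bc; rewrite (negbTE b0) (negbTE c0).
Qed.

(** As b + c > 0, all norms on the parent vanish modulo pi, so the parent is not [RU]. It is not in
    [R1b] either, since algebras there are nobody's parent. *)
Lemma par_R1a k A : R1a k.+3 A -> R1a k.+2 (par A).
Proof.
move=> rA; have [v1 [v2 [v3 [s1 [s2 [s3 [b [c [u2 [u3 [_ o' [_ e2 uu2 e3 uu3] ek _]]]]]]]]]]] := R1a_valuations rA.
have [_ [_ [_ [_ [_ [_ [_ [_ [_ [_ [_ _ _ _ [pA _]]]]]]]]]]]] := par_Alg rA.1.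
have z1 : res (pi * s1) = 0 by rewrite rmorphM /= res_unif mul0r.
have z23 : res s2 * res s3 = 0.
  by apply/eqP; rewrite mulf_eq0 e2 e3 !res_unit_pow //; lia.
have rpA : R1 k.+2 (par A).
  split=> //; first exact: rA.2.
  move=> [y [/(ob_span o')[a1 [a2 [a3 ->]]]]]; rewrite (OB_Nm _ _ _ o').
  have n1 := OB_resN o'; have n2 := OB_resN (OB_rot o'); have n3 := OB_resN (OB_rot (OB_rot o')).
  rewrite z23 eqxx in n1; rewrite z1 mulr0 eqxx in n2; rewrite z1 mul0r eqxx in n3.
  move: (Nm v1) (Nm v2) (Nm v3) n1 n2 n3 => N1 N2 N3 /eqP e1 /eqP e4 /eqP e5.
  by rewrite !rmorphD !rmorphM /= e1 e4 e5 !mulr0 !addr0 eqxx.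
split=> // r0; have fP : fin (fun A' => R1 k.+3 A' /\ par A' = par A).
  by apply: (fin_sub (fin_R1 D k.+3)) => A' [].
by apply: (csize_eq0 fP (csize_children_R1b (conj rpA r0)) (x := A)); split=> //; case: rA.
Qed.

Lemma csize_R1aS k : csize (@R1a D k.+3) = ((if k == 0%N then q.-1 else q) * csize (@R1a D k.+2))%N.
Proof.
have := @csize_fiber _ _ (@R1a D k.+3) (@R1a D k.+2) (@par D) (fun=> if k == 0%N then q.-1 else q) (fin_R1a _) (fin_R1a _) (@par_R1a k) => h.
apply/eqP; rewrite -eqz_nat h; first by rewrite ssum_const PoszM mulrC.
move=> B rB; rewrite -[k == 0%N]/(k.+1 == 1)%N -(csize_children_R1a rB); apply: csize_set => A.
by split=> [[[? _] ?]//|[rA e]]; split=> //; split=> //; rewrite e; case: rB => -[].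
Qed.

End NilpotentImage.


(** * Recurrences for the weighted sums *)

Lemma PoszX (a n : nat) : (a ^ n)%N%:Z = a%:Z ^+ n.
Proof. by elim: n => // n IH; rewrite expnS PoszM IH exprS. Qed.

Section WeightedSums.
Variable D : dvr.
Local Notation F := (resF D).
Local Notation q := #|resF D|.
Local Notation L := (sl2 D).
Implicit Types (A : set L).
Variables (g : nat -> int) (x : int).
(* Used for g b = q + 1 - b with x = q, and for g b = 2 - b with x = 1; the difference
   of these two weights is the constant q - 1. *)
Hypothesis gx : forall b : nat, g q.+1 + ((q.+1)%:Z - b%:Z) * g 1%N = x * g b.

Let wt (P : set (set L)) m := ssum P (fun A => g (beta A) * (w m A)%:Z).
Definition sumA k m := wt (@Alg D k) m.
Definition sumRU k m := wt (fun A => Alg k A /\ RU A) m.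
Definition sumRa k m := wt (@R1a D k) m.
Definition sumRb k m := wt (@R1b D k) m.
Definition sumNR k m := sumRU k m + (sumRa k m + sumRb k m).
Definition sumD k m := ssum (@Alg D k) (fun A => g (beta A) * (dnum k A * (w m A)%:Z)).
Definition RUweight k : int := if k is 0 then g 0%N else
  g 1%N * (csize (@Bo D k))%:Z + (g 2%N * (csize (@LinS D k))%:Z + g 0%N * (csize (@LinN D k))%:Z).
(** The part of [sumD] coming from [RU], up to the factor q^min(k, m): [dnum] is q^2 - q on Borel
    subalgebras and split lines, q^2 + q on nonsplit lines. *)
Definition Dweight k : int := if k is 0 then (q ^ 2)%:Z * g 0%N else
  (q%:Z ^+ 2 - q%:Z) * (g 1%N * (csize (@Bo D k))%:Z + g 2%N * (csize (@LinS D k))%:Z)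
  + (q%:Z ^+ 2 + q%:Z) * (g 0%N * (csize (@LinN D k))%:Z).

Lemma ssum_nR0 k (f : set L -> int) : ssum (@Alg D k) f =
  ssum (fun A => Alg k A /\ R0 A) f + (ssum (fun A => Alg k A /\ RU A) f +
    (ssum (@R1a D k) f + ssum (@R1b D k) f)).
Proof.
have fA := fin_Alg D k; rewrite (ssum_split (@R0 D)) //; congr (_ + _).
rewrite (ssum_split (@RU D)); last by apply: (fin_sub fA) => A [].
congr (_ + _).
  by apply: ssum_set => A; split=> [[[]]//|[Ak rU]]; split=> //; split=> //; apply: RU_nR0 Ak rU.
rewrite (ssum_split (fun A => R0 (par A))); last by apply: (fin_sub fA) => A [[]].
by rewrite addrC; congr (_ + _); apply: ssum_set => A; split=> [[[[? ?] ?] ?]|[[? ? ?] ?]].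
Qed.

Lemma sumA_lt3 k m : (k < 3)%N -> sumA k m = sumNR k m.
Proof.
move=> k3; rewrite /sumA /wt ssum_nR0 ssum0 ?add0r // => A [Ak /(R0_ge3 Ak)].
by rewrite leqNgt k3.
Qed.

(** The weight for m = 0 is identically 1, so the factor q^3 of [sumA_S] is absent. *)
Lemma sumA_0 k : sumA (k + 3) 0 = x * sumA k 0 + sumNR (k + 3) 0.
Proof.
rewrite {1}/sumA /wt ssum_nR0; congr (_ + _).
rewrite (@sum_R0 D k g (fun A => (w 0 A)%:Z) (fun=> 1)).
- rewrite -ssum_mull; apply: ssum_ext => A Ak.
  by rewrite gx (w0 Ak) !mulr1.
- by move=> A Ak; rewrite (w0 (im_Alg (sim_pi D) Ak)).
- by move=> A i Ak; rewrite (w0 (im_Alg (sim_theta i) Ak)).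
Qed.

Lemma sumA_S k m : sumA (k + 3) m.+1 = x * q%:Z ^+ 3 * sumA k m + sumNR (k + 3) m.+1.
Proof.
rewrite {1}/sumA /wt ssum_nR0; congr (_ + _).
rewrite (@sum_R0 D k g (fun A => (w m.+1 A)%:Z) (fun A => (q ^ 3 * w m A)%:Z)).
- rewrite -ssum_mull; apply: ssum_ext => A Ak.
  by rewrite gx PoszM PoszX; ring.
- by move=> A Ak; rewrite (w_im _ (sim_pi D) Ak).
- by move=> A i Ak; rewrite (w_im _ (sim_theta i) Ak).
Qed.

Lemma ssum_RU k (f : set L -> int) : ssum (fun A => Alg k A /\ RU A) f =
  ssum (@Bo D k) f + (ssum (@LinS D k) f + ssum (@LinN D k) f).
Proof.
have fA := fin_Alg D k; rewrite addrC (ssum_split (@Line D)); last by apply: (fin_sub fA) => A [].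
congr (_ + _); last by apply: ssum_set => A; split=> [[[]]|[]].
rewrite (ssum_split (@spl D)); last by apply: (fin_sub fA) => A [[]].
by congr (_ + _); apply: ssum_set => A; split=> [[[[? ?] ?] ?]|[[? ? ?] ?]].
Qed.

Lemma ssum_LT (f : set L -> int) : ssum (fun A => Alg 0 A /\ RU A) f = f (@LT D).
Proof.
rewrite (@ssum_seq _ _ [:: @LT D]) ?big_seq1 // => A; rewrite inE; split=> [/eqP ->|[/Alg0E -> _]] //.
by split; [exact/Alg0E|exact: RU_LT].
Qed.

Lemma beta_LT : beta (@LT D) = 0%N.
Proof.
apply: eq_card0 => i; rewrite !inE; apply/negbTE/negP => /asboolP h.
case: i h => [t|] h.
  have := h (0, 0, 1) I; rewrite /Bf /= !(mul0r, mulr0, addr0, add0r, mul1r) rmorph1.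
  by move/eqP; rewrite oner_eq0.
have := h (1, 0, 0) I; rewrite /Bf /= !(mul0r, mulr0, addr0, add0r, mul1r) rmorph1.
by move/eqP; rewrite oner_eq0.
Qed.

Lemma ssum_cst (P : set (set L)) (f : set L -> int) c : (forall A, P A -> f A = c) ->
  ssum P f = c * (csize P)%:Z.
Proof. by move=> e; rewrite (@ssum_ext _ _ _ (fun=> c)) // ssum_const mulrC. Qed.

Lemma sumRUE k m : sumRU k m = RUweight k * q%:Z ^+ minn k m.
Proof.
rewrite /sumRU /wt; case: k => [|k] /=.
  rewrite ssum_LT beta_LT (w_RU m (_ : Alg 0 (@LT D)) (RU_LT D)); last exact/Alg0E.
  by rewrite min0n.
rewrite ssum_RU (@ssum_cst _ _ (g 1%N * q%:Z ^+ minn k.+1 m)); last first.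
  by move=> A [Ak rU nl]; rewrite (Bo_spl_beta (And3 Ak rU nl)).2 (w_RU m Ak rU) PoszX.
rewrite (@ssum_cst _ _ (g 2%N * q%:Z ^+ minn k.+1 m)); last first.
  by move=> A [lA sA]; rewrite (beta_Lin lA) asboolT //; case: lA => Ak rU _; rewrite (w_RU m Ak rU) PoszX.
rewrite (@ssum_cst _ _ (g 0%N * q%:Z ^+ minn k.+1 m)); last first.
  by move=> A [lA sA]; rewrite (beta_Lin lA) asboolF //; case: lA => Ak rU _; rewrite (w_RU m Ak rU) PoszX.
ring.
Qed.

Lemma sumRaE k m : sumRa k.+1 m = g 1%N * (csize (@R1a D k.+1))%:Z * q%:Z ^+ (minn 1 m + minn k m).
Proof.
rewrite /sumRa /wt (@ssum_cst _ _ (g 1%N * q%:Z ^+ (minn 1 m + minn k m))); first ring.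
by move=> A rA; rewrite (beta_R1a rA) (w_R1a _ rA) PoszX.
Qed.

Lemma sumRa_lt2 k m : (k < 2)%N -> sumRa k m = 0.
Proof. by move=> k2; apply: ssum0 => A /R1a_ge2; rewrite leqNgt k2. Qed.

Lemma sumRb_lt4 k m : (k < 4)%N -> sumRb k m = 0.
Proof. by move=> k2; apply: ssum0 => A /R1b_ge4; rewrite leqNgt k2. Qed.

Lemma sumRbE k m : sumRb (k + 3).+1 m = x *
  (if m is m'.+2 then q%:Z ^+ 4 * sumD k m' else if m is 1 then q%:Z ^+ 2 * sumD k 0 else sumD k 0).
Proof.
rewrite /sumRb /wt sum_R1b.
case: m => [|[|m]] /=; rewrite /sumD -?ssum_mull; apply: ssum_ext => A Ak; rewrite gx.
- by rewrite (w0 Ak); ring.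
- by rewrite (w0 Ak) PoszX; ring.
by rewrite PoszM PoszX; ring.
Qed.

(** Together with [sumRbE], which lowers the index exponent by 4, this closes the recurrence for
    [sumRb]. *)
Lemma sumDE k m : sumD k m = Dweight k * q%:Z ^+ minn k m + q%:Z ^+ 2 * (sumRa k m + sumRb k m).
Proof.
rewrite /sumD ssum_nR0 (@ssum_ext _ _ _ (fun=> 0)) ?ssum_const ?mulr0 ?add0r; last first.
  by move=> A [Ak r0]; rewrite /dnum asboolT // mul0r mulr0.
congr (_ + _); last first.
  rewrite mulrDr; congr (_ + _); rewrite /sumRa /sumRb /wt -ssum_mull; apply: ssum_ext => A [[_ n0 nU] _];
  by rewrite /dnum asboolF // asboolF //= PoszX mulrCA.
case: k => [|k] /=.
  rewrite ssum_LT beta_LT (w_RU m (_ : Alg 0 (@LT D)) (RU_LT D)); last exact/Alg0E.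
  rewrite min0n /dnum asboolF; last by apply: (@RU_nR0 D 0); [exact/Alg0E|exact: RU_LT].
  by rewrite if_same; ring.
have dn A : Alg k.+1 A -> RU A -> dnum k.+1 A = if `[< spl A >] then q%:Z ^+ 2 - q%:Z else q%:Z ^+ 2 + q%:Z.
  by move=> Ak rU; rewrite /dnum (asboolF (RU_nR0 Ak rU)) (asboolT rU) /= PoszX.
rewrite ssum_RU (@ssum_cst _ _ (g 1%N * (q%:Z ^+ 2 - q%:Z) * q%:Z ^+ minn k.+1 m)); last first.
  move=> A bA; have [sA ->] := Bo_spl_beta bA; case: bA => Ak rU _.
  by rewrite dn // asboolT // (w_RU m Ak rU) PoszX mulrA.
rewrite (@ssum_cst _ _ (g 2%N * (q%:Z ^+ 2 - q%:Z) * q%:Z ^+ minn k.+1 m)); last first.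
  move=> A [lA sA]; rewrite (beta_Lin lA) asboolT //; case: lA => Ak rU _.
  by rewrite dn // asboolT // (w_RU m Ak rU) PoszX mulrA.
rewrite (@ssum_cst _ _ (g 0%N * (q%:Z ^+ 2 + q%:Z) * q%:Z ^+ minn k.+1 m)); last first.
  move=> A [lA sA]; rewrite (beta_Lin lA) asboolF //; case: lA => Ak rU _.
  by rewrite dn // asboolF // (w_RU m Ak rU) PoszX mulrA.
ring.
Qed.

End WeightedSums.


(** * Formal power series *)

Definition ser := nat -> int.

Section SeriesRing.
Implicit Types f g h : ser.

Definition sadd f g : ser := fun n => f n + g n.
Definition sopp f : ser := fun n => - f n.
Definition Cs (c : int) : ser := fun n => if n is 0 then c else 0.
Definition smul f g : ser := fun n => \sum_(i < n.+1) f i * g (n - i)%N.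
Definition tr N f : {poly int} := \poly_(i < N) f i.

(** A coefficient of the product involves only truncations, so associativity and commutativity are
    inherited from polynomials. *)
Lemma smulE f g n N : (n < N)%N -> smul f g n = (tr N f * tr N g)`_n.
Proof.
move=> nN; rewrite coefM; apply: eq_bigr => i _; rewrite !coef_poly.
by rewrite (leq_trans (ltn_ord i) nN) (leq_ltn_trans (leq_subr _ _) nN).
Qed.

Lemma saddA : associative sadd.
Proof. by move=> f g h; apply/funext => n; rewrite /sadd addrA. Qed.
Lemma saddC : commutative sadd.
Proof. by move=> f g; apply/funext => n; rewrite /sadd addrC. Qed.
Lemma sadd0 : left_id (Cs 0) sadd.
Proof. by move=> f; apply/funext => -[|n]; rewrite /sadd /= add0r. Qed.
Lemma saddN : left_inverse (Cs 0) sopp sadd.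
Proof. by move=> f; apply/funext => -[|n]; rewrite /sadd /sopp /= addNr. Qed.

HB.instance Definition _ := gen_eqMixin ser.
HB.instance Definition _ := gen_choiceMixin ser.
HB.instance Definition _ := GRing.isZmodule.Build ser saddA saddC sadd0 saddN.

Lemma smulA : associative smul.
Proof.
move=> f g h; apply/funext => n.
have e1 : smul f (smul g h) n = (tr n.+1 f * (tr n.+1 g * tr n.+1 h))`_n.
  rewrite coefM; apply: eq_bigr => i _; rewrite coef_poly ltn_ord.
  by rewrite (@smulE g h _ n.+1) // ltnS leq_subr.
rewrite e1 mulrA coefM; apply: eq_bigr => i _.
by rewrite [(tr _ h)`__]coef_poly ltnS leq_subr (@smulE f g _ n.+1).
Qed.
Lemma smulC : commutative smul.
Proof. by move=> f g; apply/funext => n; rewrite !(@smulE _ _ n n.+1) // mulrC. Qed.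
Lemma Cs_mul c f n : smul (Cs c) f n = c * f n.
Proof. by rewrite /smul big_ord_recl subn0 big1 ?addr0 // => i _; rewrite mul0r. Qed.
Lemma smul1 : left_id (Cs 1) smul.
Proof. by move=> f; apply/funext => n; rewrite Cs_mul mul1r. Qed.
Lemma smulDl : left_distributive smul sadd.
Proof.
move=> f g h; apply/funext => n; rewrite /smul /sadd -big_split.
by apply: eq_bigr => i _; rewrite mulrDl.
Qed.
Lemma sone_neq0 : Cs 1 != Cs 0.
Proof. by apply/eqP => /(congr1 (fun f : ser => f 0%N)). Qed.

HB.instance Definition _ :=
  GRing.Zmodule_isComNzRing.Build ser smulA smulC smul1 smulDl sone_neq0.

Lemma serE f g n : (f + g) n = f n + g n.
Proof. by []. Qed.
Lemma serN f n : (- f) n = - f n.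
Proof. by []. Qed.
Lemma serM f g n : (f * g) n = \sum_(i < n.+1) f i * g (n - i)%N.
Proof. by []. Qed.
Lemma serC c f n : (Cs c * f) n = c * f n.
Proof. exact: Cs_mul. Qed.
Lemma ser1 : (1 : ser) = Cs 1.
Proof. by []. Qed.

Definition sT : ser := fun n => (n == 1)%:R.

Lemma serT f n : (sT * f) n = if n is n'.+1 then f n' else 0.
Proof.
rewrite serM; case: n => [|n]; first by rewrite big_ord_recl big_ord0 mul0r addr0.
rewrite big_ord_recl mul0r add0r big_ord_recl mul1r subSS subn0 big1 ?addr0 // => i _.
by rewrite mul0r.
Qed.

Lemma CsM a b : Cs (a * b) = Cs a * Cs b.
Proof. by apply/funext => -[|n]; rewrite serC // mulr0. Qed.
Lemma CsD a b : Cs (a + b) = Cs a + Cs b.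
Proof. by apply/funext => -[|n]; rewrite serE // addr0. Qed.
Lemma CsN a : Cs (- a) = - Cs a.
Proof. by apply/funext => -[|n]; rewrite serN // oppr0. Qed.
Lemma CsX a n : Cs (a ^+ n) = Cs a ^+ n.
Proof. by elim: n => // n IH; rewrite !exprS CsM IH. Qed.
Lemma Cs_nat n : Cs n%:R = n%:R.
Proof. by elim: n => [|n IH] //; rewrite -addn1 !natrD CsD IH. Qed.

Lemma ser_shift f : f = Cs (f 0%N) + sT * (fun n => f n.+1).
Proof. by apply/funext => -[|n]; rewrite serE serT ?addr0 ?add0r. Qed.

(** The first factor has constant term 1, so the lowest nonzero coefficient of y would survive in
    the product. *)
Lemma ser_cancel f y : (1 - sT * f) * y = 0 -> y = 0.
Proof.
move=> e; suff h n m : (m < n)%N -> y m = 0.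
  by apply/funext => n; rewrite (h n.+1) //; case: n.
elim: n m => // n IH m; rewrite ltnS leq_eqVlt => /orP[/eqP ->|]; last exact: IH.
move: e => /(congr1 (fun g : ser => g n)); rewrite serM big_ord_recl subn0 /=.
rewrite serE serN serT oppr0 addr0 mul1r big1 ?addr0 => [->|i _]; first by case: n {IH}.
by rewrite IH ?mulr0 // ltn_subrL /= (leq_ltn_trans _ (ltn_ord i)).
Qed.

Lemma Cs_cancel c y : c != 0 -> Cs c * y = 0 -> y = 0.
Proof.
move=> c0 e; apply/funext => n; move: e => /(congr1 (fun g : ser => g n)).
rewrite serC => /eqP; case: n => [|n]; by rewrite mulf_eq0 (negbTE c0) => /eqP.
Qed.

Definition spoly (p : {poly int}) : ser := fun n => p`_n.

Lemma spolyD p r : spoly (p + r) = spoly p + spoly r.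
Proof. by apply/funext => n; rewrite /spoly coefD. Qed.
Lemma spolyN p : spoly (- p) = - spoly p.
Proof. by apply/funext => n; rewrite /spoly coefN. Qed.
Lemma spolyM p r : spoly (p * r) = spoly p * spoly r.
Proof. by apply/funext => n; rewrite /spoly coefM. Qed.
Lemma spoly1 : spoly 1 = 1.
Proof. by apply/funext => -[|n]; rewrite /spoly coef1. Qed.
Lemma spolyXn n : spoly 'X^n = sT ^+ n.
Proof.
elim: n => [|n IH]; first exact: spoly1.
rewrite exprS spolyM IH exprS; congr (_ * _).
by apply/funext => i; rewrite /spoly coefX.
Qed.
Lemma spoly_mono c a b X : spoly (mono c a b X) = Cs c * Cs X ^+ a * sT ^+ b.
Proof.
rewrite -spolyXn -CsX -CsM; apply/funext => n.
by rewrite serC /spoly coefZ.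
Qed.

End SeriesRing.

(** * Collapsing double sequences to one variable *)

Section DoubleSeries.
Variable q : int.
Implicit Types (a b : ser) (u v : nat -> nat -> int).

(* The series of all u k m T^(k + m). *)
Definition Fs u : ser := fun n => \sum_(m < n.+1) u (n - m)%N m.

Lemma eq_Fs u v : (forall k m, u k m = v k m) -> Fs u = Fs v.
Proof. by move=> e; apply/funext => n; apply: eq_bigr. Qed.
Lemma FsD u v : Fs (fun k m => u k m + v k m) = Fs u + Fs v.
Proof. by apply/funext => n; rewrite serE /Fs -big_split. Qed.
Lemma FsZ c u : Fs (fun k m => c * u k m) = Cs c * Fs u.
Proof. by apply/funext => n; rewrite serC /Fs mulr_sumr. Qed.

Lemma Fs_kshift u : Fs u = (u 0%N : ser) + sT * Fs (fun k m => u k.+1 m).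
Proof.
apply/funext => n; rewrite serE serT /Fs big_ord_recr /= subnn addrC; congr (_ + _).
case: n => [|n]; first by rewrite big_ord0.
by apply: eq_bigr => i _; rewrite /= subSn // -ltnS.
Qed.

Lemma Fs_kshift0 u : (forall m, u 0%N m = 0) -> Fs u = sT * Fs (fun k m => u k.+1 m).
Proof.
move=> u0; rewrite Fs_kshift (_ : (u 0%N : ser) = 0) ?add0r //.
by apply/funext => m; rewrite u0; case: m.
Qed.

Lemma Fs_mshift u : Fs u = ((fun n => u n 0%N) : ser) + sT * Fs (fun k m => u k m.+1).
Proof.
apply/funext => n; rewrite serE serT /Fs big_ord_recl /= subn0; congr (_ + _).
by case: n => [|n]; [rewrite big_ord0|apply: eq_bigr => i _].
Qed.

Definition sE : ser := fun=> 1.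
Definition sP : ser := fun n => q ^+ n.
Definition Fm a := Fs (fun k m => a k * q ^+ minn k m).

Lemma FmD a b : Fm (a + b) = Fm a + Fm b.
Proof. by rewrite -FsD; apply: eq_Fs => k m; rewrite mulrDl. Qed.
Lemma FmZ c a : Fm (Cs c * a) = Cs c * Fm a.
Proof. by rewrite -FsZ; apply: eq_Fs => k m; rewrite serC mulrA. Qed.

(** The row k = 0 and the column m = 0 are split off; on the rest min(k + 1, m + 1) = min(k, m) + 1,
    which produces the factor q T^2. *)
Lemma Fm_shift c b : Fm (Cs c + sT * b) = Cs c * sE + sT * b + Cs q * sT ^+ 2 * Fm b.
Proof.
rewrite /Fm Fs_kshift -addrA; congr (_ + _).
  by apply/funext => n; rewrite serC min0n mulr1 serE serT addr0 mulr1.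
rewrite Fs_mshift mulrDr; congr (_ + _).
  congr (_ * _); apply/funext => n; rewrite minn0 mulr1 serE serT.
  by rewrite add0r.
rewrite [X in sT * (sT * X)](_ : _ = Cs q * Fm b); first by rewrite -/(Fm b); ring.
rewrite -FsZ; apply: eq_Fs => k m; rewrite minnSS exprS serE serT add0r; ring.
Qed.

Lemma Fm_T b : Fm (sT * b) = sT * b + Cs q * sT ^+ 2 * Fm b.
Proof.
by have := Fm_shift 0 b; rewrite (_ : Cs 0 = 0) // mul0r !add0r.
Qed.

Lemma sE_eq : (1 - sT) * sE = 1.
Proof.
by apply/funext => -[|n]; rewrite mulrBl mul1r serE serN serT ?subr0 ?subrr.
Qed.

Lemma sP_shift : sP = Cs 1 + sT * (Cs q * sP).
Proof.
by apply/funext => -[|n]; rewrite serE serT ?addr0 // serC add0r /sP exprS.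
Qed.

End DoubleSeries.


(** * Subalgebras of gl_2 *)

Section GeneralLinear.
Variable D : dvr.
Local Notation pi := (unif D).
Local Notation q := #|resF D|.
Local Notation L := (sl2 D).
Local Notation G := ((D^o : lmodType D) * L)%type.
Implicit Types (A : set L) (U : set G).

Definition gsub k : set (set G) := fun U =>
  [/\ submod U, forall u v : G, U u -> U v -> U (0, br u.2 v.2) & relidx setT U (q ^ k)].

Lemma relidx_components U n : submod U -> relidx setT U n -> exists m j,
  [/\ forall z : D^o, psub1 U z <-> pdvd m (z : D), submod (pproj2 U),
      relidx setT (pproj2 U) (q ^ j) & n = (q ^ (m + j))%N].
Proof.
move=> sU iU; have hU := relidx_pow sU iU.
have [m hm] : exists k, forall x, psub1 U x <-> pdvd k (x : D).
  apply: (@ideal_class D _ n); first exact: psub1_submod.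
  by have := hU (1 : D^o, 0 : L); rewrite /psub1; congr U; congr pair; rewrite ?scaler0 //; apply: mulr1.
have sA : submod (pproj2 U) by exact: pproj2_submod.
have [|j [x1 [x2 [x3 [iA _ _]]]]] := @triangular_basis_pow D _ n sA.
  by move=> x; exists 0; have := hU (0 : D^o, x); congr U; congr pair; rewrite scaler0.
exists m, j; split=> //; apply: (relidx_uniq sU iU); rewrite expnD; apply: relidx_prod => //.
have -> : psub1 U = (pdvd m : set D^o) by apply/funext => x; apply/propext.
exact: relidx_idl.
Qed.

Lemma fin_gsub k : fin (gsub k).
Proof.
have fr : finreps ((D^o : lmodType D) * sl2 D)%type.
  have f1 := finreps_regular D.
  exact: finreps_prod f1 (finreps_prod (finreps_prod f1 f1) f1).
by apply: (fin_sub (fin_relidx (q ^ k) fr)) => U [].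
Qed.

Lemma gsub_lifts k m A U : (m <= k)%N -> Alg (k - m) A ->
  (gsub k U /\ psub1 U = (pdvd m : set D^o)) /\ pproj2 U = A <-> lifts m A U.
Proof.
move=> mk [sA cA iA]; split=> [[[[sU bU iU] e1] e2]|[sU e2 e1 bU]].
  split=> // [x|z|x y]; rewrite ?e2 ?e1 // => Ax Ay.
  have [a Ua] : pproj2 U x by rewrite e2.
  have [b Ub] : pproj2 U y by rewrite e2.
  exact: bU Ua Ub.
have p1 : psub1 U = (pdvd m : set D^o) by apply/funext => x; apply/propext.
have p2 : pproj2 U = A by apply/funext => x; apply/propext.
split=> //; split=> //; split=> //.
  by move=> [a x] [b y] Ux Uy; apply: bU; apply/e2; [exists a|exists b].
rewrite -(subnKC mk) expnD; apply: relidx_prod => //; first by rewrite p1; exact: relidx_idl.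
by rewrite p2.
Qed.

(** Subalgebras are sorted by the exponent m of their intersection with the centre and then by their
    projection to sl_2. *)
Lemma csize_gsub k : (csize (gsub k))%:Z =
  \sum_(m < k.+1) ssum (@Alg D (k - m)) (fun A => (w m A)%:Z).
Proof.
rewrite csizeE.
rewrite (@ssum_ext _ _ _ (fun U => \sum_(m < k.+1) if `[< psub1 U = (pdvd m : set D^o) >] then 1 else 0)).
  rewrite ssum_sum; apply: eq_bigr => m _.
  have mk : (m <= k)%N by rewrite -ltnS.
  rewrite -ssum_mkcond; last exact: fin_gsub.
  rewrite -csizeE (@csize_fiber _ _ _ (@Alg D (k - m)) (@pproj2 _ _ _) (w m)) //.
  - by apply: (fin_sub (fin_gsub k)) => U [].
  - exact: fin_Alg.
  - move=> U [[sU bU iU] e1]; have [m' [j [hm sA iA /powq_inj ek]]] := relidx_components sU iU.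
    have mm : m' = m.
      apply/eqP; rewrite eqn_leq; have u1 := unitr1 D; apply/andP; split.
        apply: (pdvd_unit u1); rewrite mul1r; apply/hm; rewrite e1; exact: pdvd_pow.
      apply: (pdvd_unit u1); rewrite mul1r; have : psub1 U (pi ^+ m') by apply/hm; exact: pdvd_pow.
      by rewrite e1.
    split=> //; last by have -> : (k - m = j)%N by rewrite -mm; clear -ek; lia.
    by move=> x y [a Ua] [b Ub]; exists 0; apply: bU Ua Ub.
  - by move=> A Ak; apply: csize_set => U; apply: gsub_lifts.
move=> U [sU bU iU]; have [m [j [hm _ _ /powq_inj ek]]] := relidx_components sU iU.
have mk : (m < k.+1)%N by lia.
have p1 : psub1 U = (pdvd m : set D^o) by apply/funext => x; apply/propext.
rewrite (bigD1 (Ordinal mk)) //= asboolT // big1 ?addr0 // => i ne; rewrite asboolF // p1 => e.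
case/eqP: ne; apply: val_inj => /=; apply/eqP; rewrite eqn_leq.
have h1 : pdvd i (pi ^+ m) by rewrite -[pdvd i]e; exact: pdvd_pow.
have h2 : pdvd m (pi ^+ i) by rewrite [pdvd m]e; exact: pdvd_pow.
have u1 := unitr1 D; apply/andP; split; apply: (pdvd_unit u1); by rewrite mul1r.
Qed.

Lemma ssum_w_beta k m : 2 * (q%:Z - 1) * ssum (@Alg D k) (fun A => (w m A)%:Z) =
  sumA D (fun b => 2 * ((q.+1)%:Z - b%:Z)) k m - sumA D (fun b => 2 * (2 - b%:Z)) k m :> int.
Proof.
rewrite /sumA -ssum_mull; apply/eqP; rewrite eq_sym subr_eq -ssumD; apply/eqP.
by apply: ssum_ext => A _; rewrite (_ : (q.+1)%:Z = q%:Z + 1); [ring|rewrite -addn1].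
Qed.

End GeneralLinear.


(** * Solving the linear equations for the generating functions *)

Section RationalForm.
Variable K : comNzRingType.
Variables Q T E P Sg SE sl sn FP fl fn : K.

(* [S...] is the series at m = 0 and [F...] the one in k + m. [g0], [g1], [g2] are the
   weights of beta = 0, 1, 2; they are doubled, because the numbers of split and of
   nonsplit lines involve Sg = (q - 1) / 2. *)
Definition weight_eqs (g0 g1 g2 x SRb FRb SA FA : K) : Prop :=
  let ra := (Q + 1) + T * ((Q + 1) * (Q - 1) * P) in
  let Fra := (Q + 1) * E + T * ((Q + 1) * (Q - 1) * P) + Q * T ^+ 2 * ((Q + 1) * (Q - 1) * FP) in
  let bs := g1 * ((Q + 1) * P) + g2 * (T * sl) in
  let Fbs := g1 * ((Q + 1) * FP) + g2 * (T * sl + Q * T ^+ 2 * fl) in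
  let nn := g0 * (T * sn) in
  let Fnn := g0 * (T * sn + Q * T ^+ 2 * fn) in
  let SU := g0 + T * (bs + nn) in
  let FU := g0 * E + T * (bs + nn) + Q * T ^+ 2 * (Fbs + Fnn) in
  let y := (Q ^+ 2 - Q) * bs + (Q ^+ 2 + Q) * nn in
  let Fy := (Q ^+ 2 - Q) * Fbs + (Q ^+ 2 + Q) * Fnn in
  let dd := Q ^+ 2 * g0 + T * y in
  let Fd := Q ^+ 2 * g0 * E + T * y + Q * T ^+ 2 * Fy in
  let SRa := g1 * (T ^+ 2 * ra) in
  let FRa := g1 * (T ^+ 2 * (ra + Q ^+ 2 * T * Fra)) in
  let SD := dd + Q ^+ 2 * (SRa + SRb) in
  let FD := Fd + Q ^+ 2 * (FRa + FRb) in
  [/\ SRb = x * T ^+ 4 * SD,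
      FRb = x * T ^+ 4 * (SD + Q ^+ 2 * T * SD + Q ^+ 4 * T ^+ 2 * FD),
      SA = SU + (SRa + SRb) + x * T ^+ 3 * SA
    & FA = FU + (FRa + FRb) + x * T ^+ 3 * (SA + Q ^+ 3 * T * FA)].

(** Cancellation replaces division: every denominator that occurs is a product of such factors. *)
Hypothesis cf : forall a b (y : K), (1 - Q ^+ a * T ^+ b.+1) * y = 0 -> y = 0.
Hypothesis z_Sg : 2 * Sg + 1 = Q.
Hypothesis z_E : (1 - T) * E = 1.
Hypothesis z_SE : SE = Sg * E.
Hypothesis z_P : (1 - Q * T) * P = 1.
Hypothesis z_sl : sl = Q * (Sg + 1) + Q ^+ 2 * T * ((Q + 1) * P + T * sl).
Hypothesis z_sn : sn = Q * Sg + Q ^+ 2 * T * (T * sn).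
Hypothesis z_FP : FP = E + T * (Q * P) + Q * T ^+ 2 * (Q * FP).
Hypothesis z_fl : fl = Q * (SE + E) + T * (Q ^+ 2 * ((Q + 1) * P + T * sl)) + Q * T ^+ 2 * (Q ^+ 2 * ((Q + 1) * FP + (T * sl + Q * T ^+ 2 * fl))).
Hypothesis z_fn : fn = Q * SE + T * (Q ^+ 2 * (T * sn)) + Q * T ^+ 2 * (Q ^+ 2 * (T * sn + Q * T ^+ 2 * fn)).

Lemma sub0 (a b : K) : a = b -> a - b = 0.
Proof. by move=> ->; rewrite subrr. Qed.

(* The multipliers passed to [lc] below come from computer algebra: they express the
   claim, times the denominators cancelled by [cf], through relations already known. *)
Lemma lc (p a b : K) : a = 0 -> b = 0 -> p * a + b = 0.
Proof. by move=> -> ->; rewrite mulr0 addr0. Qed.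

Lemma c_Sg : 1 * (2 * Sg) - (- 1 + Q) = 0.
Proof. by rewrite -z_Sg; ring. Qed.

Lemma c_E : (1 - T) * E - 1 = 0.
Proof. exact: sub0. Qed.

Lemma c_SE : (1 - T) * (2 * SE) - (- 1 + Q) = 0.
Proof. by rewrite -[RHS](lc (2 * Sg) c_E erefl) z_SE -z_Sg; ring. Qed.

Lemma c_P : (1 - Q * T) * P - 1 = 0.
Proof. exact: sub0. Qed.

Lemma c_sl : (1 - Q * T) ^+ 2 * (2 * sl) - (Q + Q ^+ 2) = 0.
Proof.
apply: (@cf 2 1); rewrite -[RHS](lc ((1 - Q * T) ^+ 2 * (2)) (sub0 z_sl)
    (lc (Q * (1 - Q * T) ^+ 2) c_Sg
    (lc (Q ^+ 2 * T * (1 - Q * T) * (2 + 2 * Q)) c_P erefl))).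
ring.
Qed.

Lemma c_sn : (1 - Q ^+ 2 * T ^+ 2) * (2 * sn) - (- Q + Q ^+ 2) = 0.
Proof.
apply: (@cf 2 1); rewrite -[RHS](lc ((1 - Q ^+ 2 * T ^+ 2) * (2)) (sub0 z_sn)
    (lc (Q * (1 - Q ^+ 2 * T ^+ 2)) c_Sg erefl)).
ring.
Qed.

Lemma c_FP : (1 - T) * (1 - Q * T) * (1 - Q ^+ 2 * T ^+ 2) * FP - (1 + (- Q) * T ^+ 2) = 0.
Proof.
apply: (@cf 2 1); rewrite -[RHS](lc ((1 - T) * (1 - Q * T) * (1 - Q ^+ 2 * T ^+ 2)) (sub0 z_FP)
    (lc ((1 - Q * T) * (1 - Q ^+ 2 * T ^+ 2)) c_E
    (lc (Q * T * (1 - T) * (1 - Q ^+ 2 * T ^+ 2)) c_P erefl))).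
ring.
Qed.

Lemma c_fl : (1 - T) * (1 - Q * T) * (1 - Q ^+ 2 * T ^+ 2) ^+ 2 * (2 * fl) - (Q + Q ^+ 2 + (Q ^+ 2 + Q ^+ 3) * T + (- 2 * Q ^+ 2 - Q ^+ 3 + Q ^+ 4) * T ^+ 2 + (- Q ^+ 3 - Q ^+ 4) * T ^+ 3) = 0.
Proof.
apply: (@cf 4 3); rewrite -[RHS](lc ((1 - T) * (1 - Q * T) * (1 - Q ^+ 2 * T ^+ 2) ^+ 2 * (2)) (sub0 z_fl)
    (lc (Q * (1 - Q * T) * (1 - Q ^+ 2 * T ^+ 2) ^+ 2) c_SE
    (lc (Q * (1 - Q * T) * (1 - Q ^+ 2 * T ^+ 2) ^+ 2 * (2)) c_E
    (lc (Q ^+ 2 * T * (1 - T) * (1 - Q ^+ 2 * T ^+ 2) ^+ 2 * (2 + 2 * Q)) c_P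
    (lc (Q ^+ 2 * T ^+ 2 * (1 - T) * (1 - Q ^+ 2 * T ^+ 2) * (1 + (2 * Q) * T + (Q ^+ 2) * T ^+ 2)) c_sl
    (lc (Q ^+ 3 * T ^+ 2 * (1 - Q ^+ 2 * T ^+ 2) * (2 + 2 * Q)) c_FP erefl)))))).
ring.
Qed.

Lemma c_fn : (1 - T) * (1 - Q * T) * (1 - Q ^+ 4 * T ^+ 4) * (2 * fn) - (- Q + Q ^+ 2 + (Q ^+ 2 - Q ^+ 3) * T + (- Q ^+ 3 + Q ^+ 4) * T ^+ 2 + (Q ^+ 3 - Q ^+ 4) * T ^+ 3) = 0.
Proof.
apply: (@cf 4 3); rewrite -[RHS](lc ((1 - T) * (1 - Q * T) * (1 - Q ^+ 4 * T ^+ 4) * (2)) (sub0 z_fn)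
    (lc (Q * (1 - Q * T) * (1 - Q ^+ 4 * T ^+ 4)) c_SE
    (lc (Q ^+ 2 * T ^+ 2 * (1 - T) * (1 - Q ^+ 4 * T ^+ 4)) c_sn erefl))).
ring.
Qed.

(** The weight 2 (q + 1 - beta), of eigenvalue q. *)
Lemma closed_X1 SRb FRb SA FA : weight_eqs (2 * (Q + 1)) (2 * Q) (2 * (Q - 1)) Q SRb FRb SA FA ->
  (1 - T) * (1 - Q * T) * (1 - Q ^+ 2 * T ^+ 2) * (1 - Q ^+ 4 * T ^+ 4) * (1 - Q ^+ 7 * T ^+ 6) * FA - (2 + 2 * Q + (- 2 * Q + 2 * Q ^+ 3) * T ^+ 2 + (- 4 * Q ^+ 2 + 4 * Q ^+ 4) * T ^+ 3 + (2 * Q ^+ 2 - 4 * Q ^+ 3 - 4 * Q ^+ 4 + 2 * Q ^+ 5) * T ^+ 4 + (2 * Q ^+ 3 - 2 * Q ^+ 4 - 2 * Q ^+ 5 + 2 * Q ^+ 6) * T ^+ 5 + (2 * Q ^+ 4 - 4 * Q ^+ 5 - 4 * Q ^+ 6 + 2 * Q ^+ 7) * T ^+ 6 + (4 * Q ^+ 5 - 4 * Q ^+ 7) * T ^+ 7 + (2 * Q ^+ 6 - 2 * Q ^+ 8) * T ^+ 8 + (2 * Q ^+ 8 + 2 * Q ^+ 9) * T ^+ 10) = 0.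
Proof.
move=> [z_SRb z_FRb z_SA z_FA].
have c_SRb : (1 - Q * T) * (1 - Q ^+ 2 * T ^+ 2) * SRb - ((2 * Q ^+ 3 + 2 * Q ^+ 4) * T ^+ 4 + (- 2 * Q ^+ 3 - 2 * Q ^+ 4) * T ^+ 5) = 0.
  apply: (@cf 3 3); rewrite -[RHS](lc ((1 - Q * T) * (1 - Q ^+ 2 * T ^+ 2)) (sub0 z_SRb)
    (lc (Q ^+ 3 * T ^+ 5 * (1 - Q ^+ 2 * T ^+ 2) * (- 2 + 2 * Q ^+ 2 + (- 2 * Q + 2 * Q ^+ 3) * T ^+ 2)) c_P
    (lc (Q ^+ 2 * T ^+ 6 * (1 - 2 * Q + Q ^+ 2 + (Q - 2 * Q ^+ 2 + Q ^+ 3) * T)) c_sl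
    (lc (Q ^+ 2 * T ^+ 6 * (1 - Q * T) * (1 + 2 * Q + Q ^+ 2)) c_sn erefl)))).
  ring.
have c_FRb : (1 - T) * (1 - Q * T) * (1 - Q ^+ 2 * T ^+ 2) * (1 - Q ^+ 4 * T ^+ 4) * (1 - Q ^+ 7 * T ^+ 6) * FRb - ((2 * Q ^+ 3 + 2 * Q ^+ 4) * T ^+ 4 + (- 4 * Q ^+ 3 - 4 * Q ^+ 4 + 2 * Q ^+ 5 + 2 * Q ^+ 6) * T ^+ 5 + (2 * Q ^+ 3 + 2 * Q ^+ 4 - 4 * Q ^+ 5 - 4 * Q ^+ 6 + 2 * Q ^+ 7 + 2 * Q ^+ 8) * T ^+ 6 + (2 * Q ^+ 5 + 2 * Q ^+ 6 - 2 * Q ^+ 7 - 2 * Q ^+ 8) * T ^+ 7 + (- 4 * Q ^+ 8 - 2 * Q ^+ 9 + 2 * Q ^+ 10) * T ^+ 8 + (4 * Q ^+ 7 + 4 * Q ^+ 8 - 6 * Q ^+ 9 - 2 * Q ^+ 10 + 4 * Q ^+ 11) * T ^+ 9 + (- 2 * Q ^+ 7 - 2 * Q ^+ 8 + 10 * Q ^+ 9 - 10 * Q ^+ 11) * T ^+ 10 + (- 4 * Q ^+ 9 + 6 * Q ^+ 10 + 6 * Q ^+ 11 - 4 * Q ^+ 12) * T ^+ 11 + (- 4 * Q ^+ 10 + 4 * Q ^+ 12) * T ^+ 12 + (2 * Q ^+ 12 + 2 * Q ^+ 13 - 2 * Q ^+ 14 - 2 * Q ^+ 15) * T ^+ 13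 + (- 2 * Q ^+ 12 - 2 * Q ^+ 13 + 4 * Q ^+ 14 + 4 * Q ^+ 15) * T ^+ 14 + (- 6 * Q ^+ 14 - 2 * Q ^+ 15 + 4 * Q ^+ 16) * T ^+ 15 + (2 * Q ^+ 14 + 2 * Q ^+ 15 - 2 * Q ^+ 16 - 2 * Q ^+ 17) * T ^+ 16) = 0.
  apply: (@cf 7 5); rewrite -[RHS](lc ((1 - T) * (1 - Q * T) * (1 - Q ^+ 2 * T ^+ 2) * (1 - Q ^+ 4 * T ^+ 4) * (1 - Q ^+ 7 * T ^+ 6)) (sub0 z_FRb)
    (lc (Q ^+ 3 * T ^+ 5 * (1 - T) * (1 - Q ^+ 2 * T ^+ 2) * (1 - Q ^+ 4 * T ^+ 4) * (1 - Q ^+ 7 * T ^+ 6) * (- 2 + 2 * Q ^+ 2 + (- 2 * Q ^+ 2 + 2 * Q ^+ 4) * T + (- 2 * Q + 2 * Q ^+ 3 - 2 * Q ^+ 4 + 2 * Q ^+ 6) * T ^+ 2 + (- 2 * Q ^+ 3 + 2 * Q ^+ 5) * T ^+ 3 + (- 2 * Q ^+ 5 + 2 * Q ^+ 7) * T ^+ 4 + (- 2 * Q ^+ 7 + 2 * Q ^+ 9) * T ^+ 5)) c_P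
    (lc (Q ^+ 2 * T ^+ 6 * (1 - T) * (1 - Q ^+ 4 * T ^+ 4) * (1 - Q ^+ 7 * T ^+ 6) * (1 - 2 * Q + Q ^+ 2 + (Q - Q ^+ 2 - Q ^+ 3 + Q ^+ 4) * T + (Q ^+ 3 - Q ^+ 4 - Q ^+ 5 + Q ^+ 6) * T ^+ 2 + (2 * Q ^+ 5 - 4 * Q ^+ 6 + 2 * Q ^+ 7) * T ^+ 3 + (Q ^+ 6 - 2 * Q ^+ 7 + Q ^+ 8) * T ^+ 4)) c_sl
    (lc (Q ^+ 2 * T ^+ 6 * (1 - T) * (1 - Q * T) * (1 - Q ^+ 4 * T ^+ 4) * (1 - Q ^+ 7 * T ^+ 6) * (1 + 2 * Q + Q ^+ 2 + (Q ^+ 2 + 2 * Q ^+ 3 + Q ^+ 4) * T + (Q ^+ 4 + 2 * Q ^+ 5 + Q ^+ 6) * T ^+ 2 + (Q ^+ 5 + 2 * Q ^+ 6 + Q ^+ 7) * T ^+ 3)) c_sn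
    (lc (Q ^+ 3 * T ^+ 4 * (1 - T) * (1 - Q ^+ 4 * T ^+ 4) * (1 - Q ^+ 7 * T ^+ 6) * (1 + (Q ^+ 2) * T)) c_SRb
    (lc (Q ^+ 7 * T ^+ 6 * (1 - Q ^+ 2 * T ^+ 2) ^+ 2 * (1 - Q ^+ 4 * T ^+ 4) * (1 - Q ^+ 7 * T ^+ 6) * (2 + 2 * Q + (- 2 * Q - 2 * Q ^+ 2) * T + (2 * Q ^+ 2 + 2 * Q ^+ 3) * T ^+ 2)) c_E
    (lc (Q ^+ 8 * T ^+ 8 * (1 - Q ^+ 4 * T ^+ 4) * (1 - Q ^+ 7 * T ^+ 6) * (- 2 + 2 * Q ^+ 2 + (- 2 * Q ^+ 3 + 2 * Q ^+ 5) * T ^+ 3)) c_FP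
    (lc (Q ^+ 8 * T ^+ 10 * (1 - Q ^+ 7 * T ^+ 6) * (1 - 2 * Q + Q ^+ 2 + (Q ^+ 2 - 2 * Q ^+ 3 + Q ^+ 4) * T ^+ 2)) c_fl
    (lc (Q ^+ 8 * T ^+ 10 * (1 - Q ^+ 2 * T ^+ 2) * (1 - Q ^+ 7 * T ^+ 6) * (1 + 2 * Q + Q ^+ 2)) c_fn erefl))))))))).
  ring.
have c_SA : (1 - Q * T) * (1 - Q ^+ 2 * T ^+ 2) * SA - (2 + 2 * Q) = 0.
  apply: (@cf 1 2); rewrite -[RHS](lc ((1 - Q * T) * (1 - Q ^+ 2 * T ^+ 2)) (sub0 z_SA)
    (lc (Q * T * (1 - Q ^+ 2 * T ^+ 2) * (2 + 2 * Q + (- 2 + 2 * Q ^+ 2) * T ^+ 2)) c_P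
    (lc (T ^+ 2 * (- 1 + Q + (- Q + Q ^+ 2) * T)) c_sl
    (lc (T ^+ 2 * (1 - Q * T) * (1 + Q)) c_sn
    (lc (1) c_SRb erefl))))).
  ring.
have c_FA : (1 - T) * (1 - Q * T) * (1 - Q ^+ 2 * T ^+ 2) * (1 - Q ^+ 4 * T ^+ 4) * (1 - Q ^+ 7 * T ^+ 6) * FA - (2 + 2 * Q + (- 2 * Q + 2 * Q ^+ 3) * T ^+ 2 + (- 4 * Q ^+ 2 + 4 * Q ^+ 4) * T ^+ 3 + (2 * Q ^+ 2 - 4 * Q ^+ 3 - 4 * Q ^+ 4 + 2 * Q ^+ 5) * T ^+ 4 + (2 * Q ^+ 3 - 2 * Q ^+ 4 - 2 * Q ^+ 5 + 2 * Q ^+ 6) * T ^+ 5 + (2 * Q ^+ 4 - 4 * Q ^+ 5 - 4 * Q ^+ 6 + 2 * Q ^+ 7) * T ^+ 6 + (4 * Q ^+ 5 - 4 * Q ^+ 7) * T ^+ 7 + (2 * Q ^+ 6 - 2 * Q ^+ 8) * T ^+ 8 + (2 * Q ^+ 8 + 2 * Q ^+ 9) * T ^+ 10) = 0.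
  apply: (@cf 4 3); rewrite -[RHS](lc ((1 - T) * (1 - Q * T) * (1 - Q ^+ 2 * T ^+ 2) * (1 - Q ^+ 4 * T ^+ 4) * (1 - Q ^+ 7 * T ^+ 6)) (sub0 z_FA)
    (lc ((1 - Q ^+ 2 * T ^+ 2) ^+ 2 * (1 - Q ^+ 4 * T ^+ 4) * (1 - Q ^+ 7 * T ^+ 6) * (2 + 2 * Q + (- 2 * Q - 2 * Q ^+ 2) * T + (2 * Q ^+ 2 + 2 * Q ^+ 3) * T ^+ 2)) c_E
    (lc (Q * T * (1 - T) * (1 - Q ^+ 2 * T ^+ 2) * (1 - Q ^+ 4 * T ^+ 4) * (1 - Q ^+ 7 * T ^+ 6) * (2 + 2 * Q + (- 2 + 2 * Q ^+ 2) * T ^+ 2 + (- 2 * Q ^+ 2 + 2 * Q ^+ 4) * T ^+ 3)) c_P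
    (lc (T ^+ 2 * (1 - T) * (1 - Q ^+ 4 * T ^+ 4) * (1 - Q ^+ 7 * T ^+ 6) * (- 1 + Q + (- 2 * Q + 2 * Q ^+ 2) * T + (- Q ^+ 2 + Q ^+ 3) * T ^+ 2)) c_sl
    (lc (T ^+ 2 * (1 - T) * (1 - Q ^+ 2 * T ^+ 2) * (1 - Q ^+ 4 * T ^+ 4) * (1 - Q ^+ 7 * T ^+ 6) * (1 + Q)) c_sn
    (lc (Q ^+ 2 * T ^+ 2 * (1 - Q ^+ 4 * T ^+ 4) * (1 - Q ^+ 7 * T ^+ 6) * (2 + 2 * Q + (- 2 * Q ^+ 2 + 2 * Q ^+ 4) * T ^+ 3)) c_FP
    (lc (Q ^+ 2 * T ^+ 4 * (1 - Q ^+ 7 * T ^+ 6) * (- 1 + Q + (- Q ^+ 2 + Q ^+ 3) * T ^+ 2)) c_fl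
    (lc (Q ^+ 2 * T ^+ 4 * (1 - Q ^+ 2 * T ^+ 2) * (1 - Q ^+ 7 * T ^+ 6) * (1 + Q)) c_fn
    (lc (1) c_FRb
    (lc (Q * T ^+ 3 * (1 - T) * (1 - Q ^+ 4 * T ^+ 4) * (1 - Q ^+ 7 * T ^+ 6)) c_SA erefl)))))))))).
  ring.
by [].
Qed.

(** The weight 2 (2 - beta), of eigenvalue 1; it vanishes on split lines, for which beta = 2. *)
Lemma closed_X0 SRb FRb SA FA : weight_eqs 4 2 0 1 SRb FRb SA FA ->
  (1 - T) * (1 - Q * T) * (1 - Q ^+ 4 * T ^+ 4) * (1 - Q ^+ 6 * T ^+ 6) * FA - (4 + (2 - 2 * Q) * T + (4 * Q ^+ 2) * T ^+ 2 + (- 2 * Q + 2 * Q ^+ 3) * T ^+ 3 + (- 2 * Q ^+ 3 + 2 * Q ^+ 5) * T ^+ 5 + (- 4 * Q ^+ 4) * T ^+ 6 + (2 * Q ^+ 5 - 2 * Q ^+ 6) * T ^+ 7 + (- 4 * Q ^+ 6) * T ^+ 8) = 0.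
Proof.
move=> [z_SRb z_FRb z_SA z_FA].
have c_SRb : (1 - Q * T ^+ 2) * (1 - Q ^+ 2 * T ^+ 2) * SRb - ((4 * Q ^+ 2) * T ^+ 4 + (- 2 * Q + 2 * Q ^+ 3) * T ^+ 5 + (- 2 * Q ^+ 2 - 2 * Q ^+ 3) * T ^+ 6) = 0.
  apply: (@cf 2 3); rewrite -[RHS](lc ((1 - Q * T ^+ 2) * (1 - Q ^+ 2 * T ^+ 2)) (sub0 z_SRb)
    (lc (Q * T ^+ 5 * (1 - Q * T ^+ 2) * (- 2 + 2 * Q ^+ 2 + (- 2 * Q + 2 * Q ^+ 3) * T + (- 2 * Q + 2 * Q ^+ 3) * T ^+ 2 + (- 2 * Q ^+ 2 + 2 * Q ^+ 4) * T ^+ 3)) c_P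
    (lc (Q * T ^+ 6 * (1 - Q * T ^+ 2) * (2 + 2 * Q)) c_sn erefl))).
  ring.
have c_FRb : (1 - T) * (1 - Q * T) * (1 - Q * T ^+ 2) * (1 - Q ^+ 4 * T ^+ 4) * (1 - Q ^+ 6 * T ^+ 6) * FRb - ((4 * Q ^+ 2) * T ^+ 4 + (- 2 * Q - 4 * Q ^+ 2 - 2 * Q ^+ 3 + 4 * Q ^+ 4) * T ^+ 5 + (2 * Q - 2 * Q ^+ 3 - 2 * Q ^+ 4 - 2 * Q ^+ 5 + 4 * Q ^+ 6) * T ^+ 6 + (4 * Q ^+ 3 - 4 * Q ^+ 5 + 2 * Q ^+ 6 - 2 * Q ^+ 7) * T ^+ 7 + (- 2 * Q ^+ 4 + 4 * Q ^+ 5 - 4 * Q ^+ 6 - 6 * Q ^+ 7 + 4 * Q ^+ 8) * T ^+ 8 + (4 * Q ^+ 5 + 2 * Q ^+ 6 - 4 * Q ^+ 7 + 2 * Q ^+ 9) * T ^+ 9 + (- 2 * Q ^+ 5 - 2 * Q ^+ 6 + 10 * Q ^+ 7 - 2 * Q ^+ 8 - 8 * Q ^+ 9) * T ^+ 10 + (4 * Q ^+ 8 + 2 * Q ^+ 9 - 4 * Q ^+ 10 + 2 * Q ^+ 11) * T ^+ 11 + (- 2 * Q ^+ 7 - 4 * Q ^+ 8 + 6 * Q ^+ 9 + 2 * Q ^+ 10 - 2 * Q ^+ 11) * T ^+ 12 + (- 2 * Q ^+ 9 + 4 * Q ^+ 10 + 4 * Q ^+ 11 - 6 * Q ^+ 12)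 * T ^+ 13 + (- 2 * Q ^+ 10 + 4 * Q ^+ 12 + 2 * Q ^+ 13) * T ^+ 14 + (- 6 * Q ^+ 11 - 2 * Q ^+ 12 + 4 * Q ^+ 13) * T ^+ 15 + (2 * Q ^+ 11 + 2 * Q ^+ 12 - 2 * Q ^+ 13 - 2 * Q ^+ 14) * T ^+ 16) = 0.
  apply: (@cf 6 5); rewrite -[RHS](lc ((1 - T) * (1 - Q * T) * (1 - Q * T ^+ 2) * (1 - Q ^+ 4 * T ^+ 4) * (1 - Q ^+ 6 * T ^+ 6)) (sub0 z_FRb)
    (lc (Q * T ^+ 5 * (1 - T) * (1 - Q * T ^+ 2) * (1 - Q ^+ 4 * T ^+ 4) * (1 - Q ^+ 6 * T ^+ 6) * (- 2 + 2 * Q ^+ 2 + (- 2 * Q ^+ 2 + 2 * Q ^+ 4) * T + (- 2 * Q + 2 * Q ^+ 3 - 2 * Q ^+ 4 + 2 * Q ^+ 6) * T ^+ 2 + (- 2 * Q ^+ 3 + 2 * Q ^+ 5) * T ^+ 3 + (- 2 * Q ^+ 5 + 2 * Q ^+ 7) * T ^+ 4 + (- 2 * Q ^+ 7 + 2 * Q ^+ 9) * T ^+ 5)) c_P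
    (lc (Q * T ^+ 6 * (1 - T) * (1 - Q * T) * (1 - Q * T ^+ 2) * (1 - Q ^+ 6 * T ^+ 6) * (2 + 2 * Q + (2 * Q ^+ 2 + 2 * Q ^+ 3) * T + (2 * Q ^+ 2 + 2 * Q ^+ 3 + 2 * Q ^+ 4 + 2 * Q ^+ 5) * T ^+ 2 + (2 * Q ^+ 4 + 4 * Q ^+ 5 + 2 * Q ^+ 6) * T ^+ 3 + (2 * Q ^+ 6 + 2 * Q ^+ 7) * T ^+ 4 + (2 * Q ^+ 7 + 2 * Q ^+ 8) * T ^+ 5)) c_sn
    (lc (Q ^+ 2 * T ^+ 4 * (1 - T) * (1 - Q * T) * (1 - Q ^+ 6 * T ^+ 6) * (1 + (Q ^+ 2) * T + (Q ^+ 2) * T ^+ 2 + (Q ^+ 4) * T ^+ 3)) c_SRb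
    (lc (Q ^+ 6 * T ^+ 6 * (1 - Q * T) * (1 - Q * T ^+ 2) * (1 - Q ^+ 4 * T ^+ 4) * (1 - Q ^+ 6 * T ^+ 6) * (4 + (2 * Q ^+ 2 + 2 * Q ^+ 3) * T ^+ 3)) c_E
    (lc (Q ^+ 6 * T ^+ 8 * (1 - Q * T ^+ 2) * (1 - Q ^+ 6 * T ^+ 6) * (- 2 + 2 * Q ^+ 2 + (- 2 * Q ^+ 2 + 2 * Q ^+ 4) * T ^+ 2 + (- 2 * Q ^+ 3 + 2 * Q ^+ 5) * T ^+ 3 + (- 2 * Q ^+ 5 + 2 * Q ^+ 7) * T ^+ 5)) c_FP
    (lc (Q ^+ 7 * T ^+ 10 * (1 - Q * T ^+ 2) * (1 - Q ^+ 6 * T ^+ 6) * (2 + 2 * Q)) c_fn erefl))))))).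
  ring.
have c_SA : (1 - T ^+ 3) * (1 - Q * T ^+ 2) * (1 - Q ^+ 2 * T ^+ 2) * SA - (4 + (2 + 2 * Q) * T + (2 - 2 * Q) * T ^+ 2 + (- 2 - 2 * Q) * T ^+ 3 + (- 4 * Q) * T ^+ 4) = 0.
  apply: (@cf 0 2); rewrite -[RHS](lc ((1 - T ^+ 3) * (1 - Q * T ^+ 2) * (1 - Q ^+ 2 * T ^+ 2)) (sub0 z_SA)
    (lc (T * (1 - T ^+ 3) * (1 - Q * T ^+ 2) * (2 + 2 * Q + (2 * Q + 2 * Q ^+ 2) * T + (- 2 + 2 * Q ^+ 2) * T ^+ 2 + (- 2 * Q + 2 * Q ^+ 3) * T ^+ 3)) c_P
    (lc (T ^+ 2 * (1 - T ^+ 3) * (1 - Q * T ^+ 2) * (2)) c_sn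
    (lc ((1 - T ^+ 3)) c_SRb erefl)))).
  ring.
have c_FA : (1 - T) * (1 - Q * T) * (1 - Q ^+ 4 * T ^+ 4) * (1 - Q ^+ 6 * T ^+ 6) * FA - (4 + (2 - 2 * Q) * T + (4 * Q ^+ 2) * T ^+ 2 + (- 2 * Q + 2 * Q ^+ 3) * T ^+ 3 + (- 2 * Q ^+ 3 + 2 * Q ^+ 5) * T ^+ 5 + (- 4 * Q ^+ 4) * T ^+ 6 + (2 * Q ^+ 5 - 2 * Q ^+ 6) * T ^+ 7 + (- 4 * Q ^+ 6) * T ^+ 8) = 0.
  (* The factor 1 - Q^3 T^4 belongs to the equation for [FA] itself; 1 - Q T^2 and 1 - T^3 are
     denominators of [SA] that drop out of the closed form. *)
  apply: (@cf 1 1); apply: (@cf 0 2); apply: (@cf 3 3); rewrite -[RHS](lc ((1 - T) * (1 - T ^+ 3) * (1 - Q * T) * (1 - Q * T ^+ 2) * (1 - Q ^+ 4 * T ^+ 4) * (1 - Q ^+ 6 * T ^+ 6)) (sub0 z_FA)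
    (lc ((1 - T ^+ 3) * (1 - Q * T) * (1 - Q * T ^+ 2) * (1 - Q ^+ 4 * T ^+ 4) * (1 - Q ^+ 6 * T ^+ 6) * (4 + (2 * Q ^+ 2 + 2 * Q ^+ 3) * T ^+ 3)) c_E
    (lc (T * (1 - T) * (1 - T ^+ 3) * (1 - Q * T ^+ 2) * (1 - Q ^+ 4 * T ^+ 4) * (1 - Q ^+ 6 * T ^+ 6) * (2 + 2 * Q + (- 2 + 2 * Q ^+ 2) * T ^+ 2 + (- 2 * Q ^+ 2 + 2 * Q ^+ 4) * T ^+ 3)) c_P
    (lc (T ^+ 2 * (1 - T) * (1 - T ^+ 3) * (1 - Q * T ^+ 2) * (1 - Q ^+ 4 * T ^+ 4) * (1 - Q ^+ 6 * T ^+ 6) * (2)) c_sn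
    (lc (Q * T ^+ 2 * (1 - T ^+ 3) * (1 - Q * T ^+ 2) * (1 - Q ^+ 6 * T ^+ 6) * (2 + 2 * Q + (2 * Q ^+ 2 + 2 * Q ^+ 3) * T ^+ 2 + (- 2 * Q ^+ 2 + 2 * Q ^+ 4) * T ^+ 3 + (- 2 * Q ^+ 4 + 2 * Q ^+ 6) * T ^+ 5)) c_FP
    (lc (Q ^+ 2 * T ^+ 4 * (1 - T ^+ 3) * (1 - Q * T ^+ 2) * (1 - Q ^+ 6 * T ^+ 6) * (2)) c_fn
    (lc ((1 - T ^+ 3)) c_FRb
    (lc (T ^+ 3 * (1 - T) * (1 - Q * T) * (1 - Q ^+ 6 * T ^+ 6) * (1 + (Q ^+ 2) * T ^+ 2)) c_SA erefl)))))))).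
  ring.
by [].
Qed.

Lemma rational_form S1 F1 B1 A1 S0 F0 B0 A0 Z : weight_eqs (2 * (Q + 1)) (2 * Q) (2 * (Q - 1)) Q S1 F1 B1 A1 ->
  weight_eqs 4 2 0 1 S0 F0 B0 A0 -> Z = A1 - A0 ->
  (1 - T) * (1 - Q ^+ 2 * T ^+ 2) ^+ 2 * (1 - Q ^+ 3 * T ^+ 3) * (1 - Q ^+ 7 * T ^+ 6) * Z = - 2 + 2 * Q + (- 2 + 2 * Q ^+ 2) * T + (- 4 * Q + 2 * Q ^+ 2 + 2 * Q ^+ 3) * T ^+ 2 + (2 * Q - 4 * Q ^+ 2 - 2 * Q ^+ 3 + 4 * Q ^+ 4) * T ^+ 3 + (4 * Q ^+ 2 - 4 * Q ^+ 3 - 6 * Q ^+ 4 + 6 * Q ^+ 5) * T ^+ 4 + (4 * Q ^+ 3 - 4 * Q ^+ 4 - 4 * Q ^+ 5 + 4 * Q ^+ 6) * T ^+ 5 + (6 * Q ^+ 4 - 6 * Q ^+ 5 - 4 * Q ^+ 6 + 4 * Q ^+ 7) * T ^+ 6 + (4 * Q ^+ 5 - 2 * Q ^+ 6 - 4 * Q ^+ 7 + 2 * Q ^+ 8) * T ^+ 7 + (2 * Q ^+ 6 + 2 * Q ^+ 7 - 4 * Q ^+ 8) * T ^+ 8 + (2 * Q ^+ 7 - 2 * Q ^+ 9) * T ^+ 9 + (2 * Q ^+ 8 - 2 * Q ^+ 9) * T ^+ 10.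
Proof.
move=> /closed_X1 c_A1 /closed_X0 c_A0 z_Z.
have c_Z : (1 - T) * (1 - Q * T) * (1 - Q ^+ 2 * T ^+ 2) * (1 - Q ^+ 6 * T ^+ 6) * (1 - Q ^+ 7 * T ^+ 6) * Z - (- 2 + 2 * Q + (- 2 + 2 * Q) * T + (- 2 * Q + 2 * Q ^+ 3) * T ^+ 2 + (2 * Q - 2 * Q ^+ 2 - 4 * Q ^+ 3 + 4 * Q ^+ 4) * T ^+ 3 + (2 * Q ^+ 2 - 4 * Q ^+ 3 - 2 * Q ^+ 4 + 4 * Q ^+ 5) * T ^+ 4 + (2 * Q ^+ 3 - 4 * Q ^+ 4 + 2 * Q ^+ 6) * T ^+ 5 + (6 * Q ^+ 4 - 6 * Q ^+ 5 - 6 * Q ^+ 6 + 6 * Q ^+ 7) * T ^+ 6 + (2 * Q ^+ 5 - 4 * Q ^+ 7 + 2 * Q ^+ 8) * T ^+ 7 + (4 * Q ^+ 6 - 2 * Q ^+ 7 - 4 * Q ^+ 8 + 2 * Q ^+ 9) * T ^+ 8 + (4 * Q ^+ 7 - 4 * Q ^+ 8 - 2 * Q ^+ 9 + 2 * Q ^+ 10) * T ^+ 9 + (2 * Q ^+ 8 - 2 * Q ^+ 10) * T ^+ 10 + (2 * Q ^+ 10 - 2 * Q ^+ 11) * T ^+ 11 + (2 * Q ^+ 10 - 2 * Q ^+ 11) * T ^+ 12) = 0.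
  apply: (@cf 4 3); rewrite -[RHS](lc ((1 - T) * (1 - Q * T) * (1 - Q ^+ 2 * T ^+ 2) * (1 - Q ^+ 4 * T ^+ 4) * (1 - Q ^+ 6 * T ^+ 6) * (1 - Q ^+ 7 * T ^+ 6)) (sub0 z_Z)
    (lc ((1 - Q ^+ 6 * T ^+ 6)) c_A1
    (lc ((1 - Q ^+ 2 * T ^+ 2) * (1 - Q ^+ 7 * T ^+ 6) * (- 1)) c_A0 erefl))).
  ring.
suff: (1 - T) * (1 - Q ^+ 2 * T ^+ 2) ^+ 2 * (1 - Q ^+ 3 * T ^+ 3) * (1 - Q ^+ 7 * T ^+ 6) * Z - (- 2 + 2 * Q + (- 2 + 2 * Q ^+ 2) * T + (- 4 * Q + 2 * Q ^+ 2 + 2 * Q ^+ 3) * T ^+ 2 + (2 * Q - 4 * Q ^+ 2 - 2 * Q ^+ 3 + 4 * Q ^+ 4) * T ^+ 3 + (4 * Q ^+ 2 - 4 * Q ^+ 3 - 6 * Q ^+ 4 + 6 * Q ^+ 5) * T ^+ 4 + (4 * Q ^+ 3 - 4 * Q ^+ 4 - 4 * Q ^+ 5 + 4 * Q ^+ 6) * T ^+ 5 + (6 * Q ^+ 4 - 6 * Q ^+ 5 - 4 * Q ^+ 6 + 4 * Q ^+ 7) * T ^+ 6 + (4 * Q ^+ 5 - 2 * Q ^+ 6 - 4 * Q ^+ 7 + 2 * Q ^+ 8) * T ^+ 7 + (2 * Q ^+ 6 + 2 * Q ^+ 7 - 4 * Q ^+ 8) * T ^+ 8 + (2 * Q ^+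 7 - 2 * Q ^+ 9) * T ^+ 9 + (2 * Q ^+ 8 - 2 * Q ^+ 9) * T ^+ 10) = 0 by move/eqP; rewrite subr_eq0 => /eqP ->.
  (* Multiplying [c_Z] by (1 - Q^3 T^3)(1 + Q T) turns 1 - Q T into 1 - Q^2 T^2 and supplies 1 - Q^3
     T^3; the factor 1 - Q^6 T^6 is then cancelled. *)
  apply: (@cf 6 5).
rewrite -[RHS](lc ((1 - Q ^+ 3 * T ^+ 3) * (1 + (Q) * T)) c_Z erefl).
ring.
Qed.

End RationalForm.


(** * The generating functions of the counts *)

Section CountingSeries.
Variable D : dvr.
Local Notation q := #|resF D|.
Local Notation T := sT.
Local Notation Q := (Cs q%:Z).
Local Notation E := sE.
Local Notation P := (sP q%:Z).
Local Notation Fm := (Fm q%:Z).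

(** The offsets are the least index exponents that occur: 2 for lines and for [R1a], 1 for Borel
    subalgebras. *)
Definition linS : ser := fun n => (csize (@LinS D n.+2))%:Z.
Definition linN : ser := fun n => (csize (@LinN D n.+2))%:Z.
Definition borel : ser := fun n => (csize (@Bo D n.+1))%:Z.
Definition nilp : ser := fun n => (csize (@R1a D n.+2))%:Z.

Lemma Q1 : Cs (q.+1)%:Z = Q + 1.
Proof. by rewrite -addn1 PoszD CsD. Qed.

Lemma borelE : borel = (Q + 1) * P.
Proof. by apply/funext => n; rewrite -Q1 serC /borel csize_Bo PoszM PoszX mulrC. Qed.

Lemma linS1 : (fun n => (csize (@LinS D n.+1))%:Z) = T * linS :> ser.
Proof.
by apply/funext => -[|n]; rewrite serT // csize0 // => A [/Lin_lt2].
Qed.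

Lemma linN1 : (fun n => (csize (@LinN D n.+1))%:Z) = T * linN :> ser.
Proof.
by apply/funext => -[|n]; rewrite serT // csize0 // => A [/Lin_lt2].
Qed.

Lemma csize_RUS k : (csize (@RUS D k.+1))%:Z = borel k + (T * linS) k.
Proof.
rewrite -linS1 !csizeE (ssum_split (@Line D)); last exact: fin_RUS.
rewrite addrC /borel !csizeE; congr (_ + _); apply: ssum_set => A.
  by split=> [[[? ? _] ?]|bA] //; have [sA _] := Bo_spl_beta bA; case: bA.
by split=> [[[? ? ?] ?]|[[? ? ?] ?]].
Qed.

Lemma csize_RUN k : (csize (@RUN D k.+1))%:Z = (T * linN) k.
Proof.
rewrite -linN1 /=; congr Posz; apply: csize_set => A; split=> [[Ak rU ns]|[[? ? _] ?]] //.
by split=> //; split=> //; apply: contrapT => nl; have [] := Bo_spl_beta (And3 Ak rU nl).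
Qed.

(** Over each split [RU] algebra of positive index, a Borel subalgebra or a smaller split line, lie
    q^2 split lines. The constant term counts those over the full algebra. *)
Lemma linSE : linS = Q * (Cs (sigma (resF D))%:Z + 1) + T * (Q ^+ 2 * ((Q + 1) * P + T * linS)).
Proof.
rewrite {1}[linS]ser_shift; congr (_ + _ * _).
  by rewrite /linS csize_LinS2 PoszD PoszM CsD CsM mulrDr mulr1.
by apply/funext => n; rewrite -CsX serC serE -borelE -csize_RUS -PoszX -PoszM -csize_LinS addn2.
Qed.

Lemma linNE : linN = Q * Cs (sigma (resF D))%:Z + T * (Q ^+ 2 * (T * linN)).
Proof.
rewrite {1}[linN]ser_shift; congr (_ + _ * _).
  by rewrite /linN csize_LinN2 PoszM CsM.
by apply/funext => n; rewrite -CsX serC -csize_RUN -PoszX -PoszM -csize_LinN addn2.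
Qed.

Lemma nilpE : nilp = (Q + 1) + T * ((Q + 1) * (Q - 1) * P).
Proof.
rewrite {1}[nilp]ser_shift /nilp csize_R1a2 Q1; congr (_ + _ * _).
have -> : (Q + 1) * (Q - 1) = Cs ((q.+1)%:Z * (q%:Z - 1)) by rewrite CsM CsD CsN Q1.
apply/funext; elim=> [|n IH]; rewrite serC /sP csize_R1aS /=.
  rewrite csize_R1a2; move: #|_| (q_gt1 D) => [|n] // _; rewrite expr0 mulr1 PoszM mulrC.
  by congr (_ * _); lia.
by rewrite PoszM IH serC /sP exprS; ring.
Qed.

Lemma eq_ser (f h : ser) : (forall n, f n = h n) -> f = h.
Proof. by move=> e; apply/funext. Qed.

Local Notation FP := (Fm P).
Local Notation Fl := (Fm linS).
Local Notation Fn := (Fm linN).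

Lemma Fm_borel : Fm borel = (Q + 1) * FP.
Proof. by rewrite borelE -Q1 FmZ. Qed.

Lemma FPE : FP = E + T * (Q * P) + Q * T ^+ 2 * (Q * FP).
Proof. by rewrite {1}sP_shift Fm_shift FmZ mul1r. Qed.

Lemma FlE : Fl = Q * (Cs (sigma (resF D))%:Z * E + E) + T * (Q ^+ 2 * ((Q + 1) * P + T * linS))
  + Q * T ^+ 2 * (Q ^+ 2 * ((Q + 1) * FP + (T * linS + Q * T ^+ 2 * Fl))).
Proof.
have eb : Fm (Q ^+ 2 * ((Q + 1) * P + T * linS)) = Q ^+ 2 * ((Q + 1) * FP + (T * linS + Q * T ^+ 2 * Fl)).
  by rewrite -CsX FmZ FmD -borelE Fm_borel Fm_T.
have e : Q * (Cs (sigma (resF D))%:Z + 1) = Cs (q%:Z * ((sigma (resF D))%:Z + 1)) by rewrite CsM CsD.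
by rewrite {1}linSE e Fm_shift eb -e; ring.
Qed.

Lemma FnE : Fn = Q * (Cs (sigma (resF D))%:Z * E) + T * (Q ^+ 2 * (T * linN))
  + Q * T ^+ 2 * (Q ^+ 2 * (T * linN + Q * T ^+ 2 * Fn)).
Proof.
have eb : Fm (Q ^+ 2 * (T * linN)) = Q ^+ 2 * (T * linN + Q * T ^+ 2 * Fn) by rewrite -CsX FmZ Fm_T.
by rewrite {1}linNE -CsM Fm_shift eb CsM; ring.
Qed.

Lemma Fm_nilp : Fm nilp = (Q + 1) * E + T * ((Q + 1) * (Q - 1) * P) + Q * T ^+ 2 * ((Q + 1) * (Q - 1) * FP).
Proof.
have e : (Q + 1) * (Q - 1) = Cs ((q.+1)%:Z * (q%:Z - 1)) by rewrite CsM CsD CsN Q1.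
by rewrite {1}nilpE e -Q1 Fm_shift FmZ.
Qed.

Section Weights.
Variables (g : nat -> int) (x : int).
Hypothesis gx : forall b : nat, g q.+1 + ((q.+1)%:Z - b%:Z) * g 1%N = x * g b.
Local Notation g0 := (Cs (g 0%N)).
Local Notation g1 := (Cs (g 1%N)).
Local Notation g2 := (Cs (g 2%N)).

Lemma RUweightE : RUweight D g = g0 + T * (g1 * borel + g2 * (T * linS) + g0 * (T * linN)) :> ser.
Proof.
rewrite [LHS]ser_shift; congr (_ + _ * _); apply: eq_ser => n.
by rewrite !serE !serC -linS1 -linN1 -[RHS]addrA.
Qed.

Lemma DweightE : Dweight D g = Q ^+ 2 * g0 + T * ((Q ^+ 2 - Q) * (g1 * borel + g2 * (T * linS))
  + (Q ^+ 2 + Q) * (g0 * (T * linN))) :> ser.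
Proof.
rewrite -CsX -CsM -CsN -!CsD [LHS]ser_shift /= PoszX; congr (_ + _ * _); apply: eq_ser => n.
by rewrite !serE !serC !serE !serC -linS1 -linN1.
Qed.

Lemma Fm_RU : Fm (RUweight D g) = g0 * E + T * (g1 * borel + g2 * (T * linS) + g0 * (T * linN))
  + Q * T ^+ 2 * ((g1 * ((Q + 1) * FP) + g2 * (T * linS + Q * T ^+ 2 * Fl)) + g0 * (T * linN + Q * T ^+ 2 * Fn)).
Proof. by rewrite RUweightE Fm_shift !FmD !FmZ Fm_borel !Fm_T. Qed.

Lemma Fm_D : Fm (Dweight D g) = Q ^+ 2 * g0 * E + T * ((Q ^+ 2 - Q) * (g1 * borel + g2 * (T * linS))
  + (Q ^+ 2 + Q) * (g0 * (T * linN)))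
  + Q * T ^+ 2 * ((Q ^+ 2 - Q) * (g1 * ((Q + 1) * FP) + g2 * (T * linS + Q * T ^+ 2 * Fl))
  + (Q ^+ 2 + Q) * (g0 * (T * linN + Q * T ^+ 2 * Fn))).
Proof.
have a1 : Q ^+ 2 - Q = Cs (q%:Z ^+ 2 - q%:Z) by rewrite CsD CsN CsX.
have a2 : Q ^+ 2 + Q = Cs (q%:Z ^+ 2 + q%:Z) by rewrite CsD CsX.
have a3 : Q ^+ 2 * g0 = Cs (q%:Z ^+ 2 * g 0%N) by rewrite CsM CsX.
by rewrite DweightE a1 a2 a3 Fm_shift !(FmD, FmZ) Fm_borel !Fm_T.
Qed.

Lemma sumRa0 : (fun n => sumRa D g n 0) = g1 * (T ^+ 2 * nilp) :> ser.
Proof.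
rewrite expr2 -mulrA; apply: eq_ser => -[|[|n]]; rewrite serC !serT ?mulr0; try exact: sumRa_lt2.
by rewrite sumRaE !minn0 mulr1.
Qed.

Lemma Fs_Ra : Fs (sumRa D g) = g1 * (T ^+ 2 * (nilp + Q ^+ 2 * T * Fm nilp)).
Proof.
rewrite Fs_kshift0; last by move=> m; apply: sumRa_lt2.
rewrite Fs_kshift0; last by move=> m; apply: sumRa_lt2.
rewrite Fs_mshift.
rewrite [X in X + _](_ : _ = g1 * nilp); last first.
  by apply: eq_ser => n; rewrite sumRaE !minn0 mulr1 serC.
rewrite [Fs _](_ : _ = Q ^+ 2 * g1 * Fm nilp); first by ring.
rewrite -CsX -CsM -FsZ; apply: eq_Fs => k m.
by rewrite sumRaE !minnSS min0n add1n !exprS expr0 /nilp; ring.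
Qed.

Lemma sumD0 : (fun n => sumD D g n 0) = (Dweight D g : ser) + Q ^+ 2 * (((fun n => sumRa D g n 0) : ser) + ((fun n => sumRb D g n 0) : ser)) :> ser.
Proof.
by apply: eq_ser => n; rewrite -CsX !serE serC serE sumDE minn0 expr0 mulr1.
Qed.

Lemma Fs_D : Fs (sumD D g) = Fm (Dweight D g) + Q ^+ 2 * (Fs (sumRa D g) + Fs (sumRb D g)).
Proof. by rewrite -CsX -FsD -FsZ -FsD; apply: eq_Fs => k m; rewrite sumDE. Qed.

Lemma Fs_kshift4 u : (forall k m, (k < 4)%N -> u k m = 0) -> Fs u = T ^+ 4 * Fs (fun k m => u (k + 3).+1 m).
Proof.
move=> u0; do 4![rewrite Fs_kshift0; last by move=> m; apply: u0].
rewrite !exprS expr0 mulr1 -!mulrA.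
by do 4![congr (_ * _)]; apply: eq_Fs => k m; rewrite addn3.
Qed.

Lemma sumRb0 : (fun n => sumRb D g n 0) = Cs x * T ^+ 4 * (fun n => sumD D g n 0) :> ser.
Proof.
rewrite !exprS expr0 mulr1 -!mulrA; apply: eq_ser => -[|[|[|[|n]]]]; rewrite serC !serT ?mulr0; try exact: sumRb_lt4.
by rewrite -addn3 (sumRbE gx).
Qed.

(** The rows m = 0 and m = 1, exceptional in [sumRbE], are split off; both are multiples of the row
    m = 0 of [sumD]. *)
Lemma Fs_Rb : let S := (fun n => sumD D g n 0) : ser in
  Fs (sumRb D g) = Cs x * T ^+ 4 * (S + Q ^+ 2 * T * S + Q ^+ 4 * T ^+ 2 * Fs (sumD D g)).
Proof.
move=> S; rewrite Fs_kshift4; last by move=> k m; apply: sumRb_lt4.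
rewrite Fs_mshift Fs_mshift.
rewrite [X in X + _](_ : _ = Cs x * S); last by apply: eq_ser => n; rewrite (sumRbE gx) serC.
rewrite [X in _ + T * (X + _)](_ : _ = Cs x * Q ^+ 2 * S); last first.
  by apply: eq_ser => n; rewrite (sumRbE gx) -CsX -CsM serC mulrA.
rewrite [Fs _](_ : _ = Cs x * Q ^+ 4 * Fs (sumD D g)); first by ring.
by rewrite -CsX -CsM -FsZ; apply: eq_Fs => k m; rewrite (sumRbE gx) mulrA.
Qed.

Lemma Fs_kshift3 u : (forall k m, (k < 3)%N -> u k m = 0) -> Fs u = T ^+ 3 * Fs (fun k m => u (k + 3)%N m).
Proof.
move=> u0; do 3![rewrite Fs_kshift0; last by move=> m; apply: u0].
rewrite !exprS expr0 mulr1 -!mulrA.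
by do 3![congr (_ * _)]; apply: eq_Fs => k m; rewrite addn3.
Qed.

Lemma Fs_NR : Fs (sumNR D g) = Fm (RUweight D g) + (Fs (sumRa D g) + Fs (sumRb D g)).
Proof. by rewrite -!FsD; apply: eq_Fs => k m; rewrite /sumNR sumRUE. Qed.

Lemma sumNR0 : (fun n => sumNR D g n 0) =
  (RUweight D g : ser) + (((fun n => sumRa D g n 0) : ser) + ((fun n => sumRb D g n 0) : ser)) :> ser.
Proof. by apply: eq_ser => n; rewrite !serE /sumNR sumRUE minn0 expr0 mulr1. Qed.

Lemma sumA0 : (fun n => sumA D g n 0) =
  ((fun n => sumNR D g n 0) : ser) + Cs x * T ^+ 3 * (fun n => sumA D g n 0) :> ser.
Proof.
rewrite !exprS expr0 mulr1 -!mulrA; apply: eq_ser => -[|[|[|n]]];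
  rewrite serE serC !serT ?mulr0 ?addr0; try exact: sumA_lt3.
by rewrite -addn3 (sumA_0 gx) addrC.
Qed.

Lemma Fs_A : let S := (fun n => sumA D g n 0) : ser in
  Fs (sumA D g) = Fs (sumNR D g) + Cs x * T ^+ 3 * (S + Q ^+ 3 * T * Fs (sumA D g)).
Proof.
(* r is the contribution of [R0]: it vanishes for k < 3 and obeys the descent from k + 3 to k. *)
move=> S; pose r k m := sumA D g k m - sumNR D g k m.
have eA : Fs (sumA D g) = Fs (sumNR D g) + Fs r.
  by rewrite -FsD; apply: eq_Fs => k m; rewrite /r addrC subrK.
rewrite {1}eA; congr (_ + _); rewrite Fs_kshift3; last by move=> k m k3; rewrite /r sumA_lt3 ?subrr.
rewrite Fs_mshift [X in _ * (X + _)](_ : _ = Cs x * S); last first.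
  by apply: eq_ser => n; rewrite serC /r (sumA_0 gx) addrK.
rewrite [Fs _](_ : _ = Cs x * Q ^+ 3 * Fs (sumA D g)); first by ring.
by rewrite -CsX -CsM -FsZ; apply: eq_Fs => k m; rewrite /r (sumA_S gx) addrK.
Qed.

Lemma weight_eqsP : weight_eqs Q T E P linS linN FP Fl Fn g0 g1 g2 (Cs x)
  (fun n => sumRb D g n 0) (Fs (sumRb D g)) (fun n => sumA D g n 0) (Fs (sumA D g)).
Proof.
split.
- by rewrite {1}sumRb0 sumD0 DweightE sumRa0 nilpE borelE; ring.
- by rewrite {1}Fs_Rb sumD0 Fs_D Fm_D Fs_Ra Fm_nilp DweightE sumRa0 nilpE borelE; ring.
- by rewrite {1}sumA0 sumNR0 RUweightE sumRa0 nilpE borelE; ring.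
by rewrite {1}Fs_A Fs_NR Fm_RU Fs_Ra Fm_nilp nilpE borelE; ring.
Qed.

End Weights.

Definition zeta : ser := fun k => (csize (@gsub D k))%:Z.

Lemma zetaE : Cs (2 * (q%:Z - 1)) * zeta =
  Fs (sumA D (fun b => 2 * ((q.+1)%:Z - b%:Z))) - Fs (sumA D (fun b => 2 * (2 - b%:Z))).
Proof.
apply: eq_ser => n; rewrite serC serE serN /zeta csize_gsub /Fs mulr_sumr -sumrB.
by apply: eq_bigr => i _; rewrite ssum_w_beta.
Qed.

Lemma spolyX : spoly 'X = T.
Proof. by rewrite -['X]expr1 spolyXn expr1. Qed.

Lemma zeta_rational : spoly (W_den q%:Z) * zeta = spoly (W_num q%:Z).
Proof.
have cf a b (y : ser) : (1 - Q ^+ a * T ^+ b.+1) * y = 0 -> y = 0.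
  by rewrite exprS mulrCA; apply: ser_cancel.
(* The linear equations determine 2 (q - 1) times the zeta series; this constant is cancelled
   coefficientwise. *)
have q1 : 2 * (q%:Z - 1) != 0 :> int by have := q_gt1 D; lia.
apply/eqP; rewrite -subr_eq0; apply/eqP; apply: (Cs_cancel q1).
have zS : 2%:R * Cs (sigma (resF D))%:Z + 1 = Q.
  by rewrite -(sigmaE (two_res D)) PoszD PoszM CsD CsM -[2%:Z]/(2%:R : int) Cs_nat.
have zP : (1 - Q * T) * P = 1 by rewrite mulrBl mul1r {1}sP_shift -ser1; ring.
have zl : linS = Q * (Cs (sigma (resF D))%:Z + 1) + Q ^+ 2 * T * ((Q + 1) * P + T * linS).
  by rewrite {1}linSE; ring.
have zn : linN = Q * Cs (sigma (resF D))%:Z + Q ^+ 2 * T * (T * linN) by rewrite {1}linNE; ring.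
have gx1 b : 2 * ((q.+1)%:Z - (q.+1)%:Z) + ((q.+1)%:Z - b%:Z) * (2 * ((q.+1)%:Z - 1%:Z)) =
  q%:Z * (2 * ((q.+1)%:Z - b%:Z)) :> int by lia.
have gx0 b : 2 * (2 - (q.+1)%:Z) + ((q.+1)%:Z - b%:Z) * (2 * (2 - 1%:Z)) = 1 * (2 * (2 - b%:Z)) :> int by lia.
have w1 := weight_eqsP gx1; have w0 := weight_eqsP gx0.
have c1 : Cs (2 * ((q.+1)%:Z - 0%:Z)) = 2 * (Q + 1) by rewrite subr0 CsM Q1 Cs_nat.
have c2 : Cs (2 * ((q.+1)%:Z - 1%:Z)) = 2 * Q by rewrite (_ : (q.+1)%:Z - 1%:Z = q%:Z); [rewrite CsM Cs_nat|lia].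
have c3 : Cs (2 * ((q.+1)%:Z - 2%:Z)) = 2 * (Q - 1).
  by rewrite (_ : (q.+1)%:Z - 2%:Z = q%:Z - 1); [rewrite CsM CsD CsN !Cs_nat|lia].
have d1 : Cs (2 * (2 - 0%:Z)) = 4 by rewrite subr0 -natrM Cs_nat.
have d2 : Cs (2 * (2 - 1%:Z)) = 2 by rewrite (_ : 2 - 1%:Z = 1) // mulr1 Cs_nat.
have d3 : Cs (2 * (2 - 2%:Z)) = 0 by rewrite subrr mulr0.
rewrite c1 c2 c3 in w1; rewrite d1 d2 d3 in w0.
have := rational_form cf zS sE_eq erefl zP zl zn FPE FlE FnE w1 w0 zetaE.
move/eqP; rewrite -subr_eq0 => /eqP h.
have cq : Cs (2 * (q%:Z - 1)) = 2 * (Q - 1) by rewrite CsM CsD CsN Cs_nat.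
rewrite -[RHS]h cq /W_den /W_num !(spolyM, spolyD, spolyN, spoly1, spoly_mono, spolyX).
by rewrite !CsN !Cs_nat -ser1; ring.
Qed.

End CountingSeries.


(** * The residue field *)

(* The proofs are parameters of the type so that the field structure can be attached to it. *)
Definition residue (R : idomainType) (pi : R) (q : nat) (rc : residue_card pi q)
  (piN : pi \isn't a GRing.unit)
  (dv : forall x : R, x != 0 -> exists (u : R) n, u \is a GRing.unit /\ x = u * pi ^+ n) : Type :=
  'I_q.

Section ResidueField.
Variables (R : idomainType) (pi : R) (q : nat).
Hypothesis rc : residue_card pi q.
Hypothesis piN : pi \isn't a GRing.unit.
Hypothesis dv : forall x : R, x != 0 -> exists (u : R) n, u \is a GRing.unit /\ x = u * pi ^+ n.
Local Notation K := (residue rc piN dv).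

HB.instance Definition _ := Finite.copy K 'I_q.

Definition rrep : K -> R := sval (cid rc).
Definition rcl (x : R) : K := sval (cid ((svalP (cid rc)).1 x)).

Lemma rcl_spec z : exists r, z - rrep (rcl z) = pi * r.
Proof. exact: (svalP (cid ((svalP (cid rc)).1 z))). Qed.

Lemma rclP x y : rcl x = rcl y <-> exists r, x - y = pi * r.
Proof.
have [rx ex] := rcl_spec x; have [ry ey] := rcl_spec y; split=> [e|[r e]].
  by exists (rx - ry); rewrite mulrBr -ex -ey e; ring.
apply: (svalP (cid rc)).2; exists (r - rx + ry).
by rewrite mulrDr mulrBr -e -ex -ey /rrep; ring.
Qed.

Lemma rrepK : cancel rrep rcl.
Proof.
move=> i; apply: (svalP (cid rc)).2; have [r e] := rcl_spec (rrep i).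
by exists (- r); rewrite mulrN -e opprB.
Qed.

Lemma rrep_cl x : exists r, rrep (rcl x) = x + pi * r.
Proof. by have [|r e] := (rclP (rrep (rcl x)) x).1; [exact: rrepK|exists r; rewrite -e; ring]. Qed.

Definition radd (a b : K) : K := rcl (rrep a + rrep b).
Definition ropp (a : K) : K := rcl (- rrep a).
Definition rmul (a b : K) : K := rcl (rrep a * rrep b).

Lemma rclD x y : radd (rcl x) (rcl y) = rcl (x + y).
Proof.
have [r er] := rrep_cl x; have [s es] := rrep_cl y.
by apply/rclP; exists (r + s); rewrite er es; ring.
Qed.
Lemma rclN x : ropp (rcl x) = rcl (- x).
Proof. by have [r er] := rrep_cl x; apply/rclP; exists (- r); rewrite er; ring. Qed.
Lemma rclM x y : rmul (rcl x) (rcl y) = rcl (x * y).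
Proof.
have [r er] := rrep_cl x; have [s es] := rrep_cl y.
by apply/rclP; exists (r * y + x * s + pi * r * s); rewrite er es; ring.
Qed.

Lemma raddA : associative radd.
Proof. by move=> a b c; rewrite -(rrepK a) -(rrepK b) -(rrepK c) !rclD addrA. Qed.
Lemma raddC : commutative radd.
Proof. by move=> a b; rewrite /radd addrC. Qed.
Lemma radd0 : left_id (rcl 0) radd.
Proof. by move=> a; rewrite -(rrepK a) rclD add0r. Qed.
Lemma raddN : left_inverse (rcl 0) ropp radd.
Proof. by move=> a; rewrite -(rrepK a) rclN rclD addNr. Qed.

HB.instance Definition _ := GRing.isZmodule.Build K raddA raddC radd0 raddN.

Lemma rmulA : associative rmul.
Proof. by move=> a b c; rewrite -(rrepK a) -(rrepK b) -(rrepK c) !rclM mulrA. Qed.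
Lemma rmulC : commutative rmul.
Proof. by move=> a b; rewrite /rmul mulrC. Qed.
Lemma rmul1 : left_id (rcl 1) rmul.
Proof. by move=> a; rewrite -(rrepK a) rclM mul1r. Qed.
Lemma rmulDl : left_distributive rmul radd.
Proof. by move=> a b c; rewrite -(rrepK a) -(rrepK b) -(rrepK c) !(rclD, rclM) mulrDl. Qed.

Lemma pi_ndvd1 r : 1 <> pi * r.
Proof. by move=> e; move/negP: piN; apply; apply/unitrPr; exists r. Qed.

Lemma rone_neq0 : rcl 1 != rcl 0.
Proof. by apply/eqP => /rclP[r]; rewrite subr0 => /pi_ndvd1. Qed.

HB.instance Definition _ :=
  GRing.Zmodule_isComNzRing.Build K rmulA rmulC rmul1 rmulDl rone_neq0.

Definition rinv (a : K) : K := if a == 0 then 0 else rcl (rrep a)^-1.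

(** A representative of a nonzero class is a unit times pi^n with n = 0, hence invertible in R. *)
Lemma rmulVf (a : K) : a != 0 -> rinv a * a = 1.
Proof.
move=> a0; rewrite /rinv (negbTE a0); apply: etrans (_ : rmul _ _ = _) _; first by [].
rewrite -{2}(rrepK a) rclM mulVr //.
have a1 : rrep a != 0 by apply: contra_neq a0 => e; rewrite -(rrepK a) e.
have [u [[|n] [uu e]]] := dv a1; first by rewrite e mulr1.
by case/eqP: a0; rewrite -(rrepK a); apply/rclP; exists (u * pi ^+ n); rewrite subr0 e exprS mulrCA.
Qed.

Lemma rinv0 : rinv 0 = 0.
Proof. by rewrite /rinv eqxx. Qed.

HB.instance Definition _ := GRing.ComNzRing_isField.Build K rmulVf rinv0.

Lemma rcl_zmod : zmod_morphism rcl.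
Proof. by move=> x y; rewrite -rclD -rclN. Qed.
Lemma rcl_monoid : monoid_morphism rcl.
Proof. by split=> // x y; rewrite -rclM. Qed.

HB.instance Definition _ := GRing.isZmodMorphism.Build R K rcl rcl_zmod.
HB.instance Definition _ := GRing.isMonoidMorphism.Build R K rcl rcl_monoid.

Hypothesis pi0 : pi != 0.
Hypothesis two : ~ exists r, 2 = pi * r.

Lemma rcl_eq0 x : rcl x = 0 <-> exists r, x = pi * r.
Proof.
by split=> [/rclP[r]|[r e]]; [rewrite subr0; exists r|apply/rclP; exists r; rewrite subr0].
Qed.

Lemma rcl2 : (2%:R : K) != 0.
Proof. by apply/eqP; rewrite -(rmorph_nat rcl 2) => /rcl_eq0. Qed.

Definition residue_dvr : dvr := @Dvr R pi K rcl rrep rrepK rcl_eq0 pi0 dv rcl2.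

Lemma card_residue : #|resF residue_dvr| = q.
Proof. exact: card_ord. Qed.

End ResidueField.


(** * Matrices as pairs of a scalar and a traceless part *)

Section Matrices.
Variable D : dvr.
Local Notation q := #|resF D|.
Local Notation L := (sl2 D).
Local Notation G := ((D^o : lmodType D) * L)%type.
Local Notation M := 'M[D]_2.
Implicit Types (X Y : M) (U : M -> Prop) (u v : G).

(** The scalar part is half the trace; this is where the decomposition of gl_2 divides by 2. *)
Definition of_mx X : G :=
  ((X 0 0 + X 1 1) / 2%:R, (X 0 1, (X 0 0 - X 1 1) / 2%:R, X 1 0)).
Definition to_mx (u : G) : M :=
  \matrix_(i, j) if val i == 0%N then (if val j == 0%N then u.1 + u.2.1.2 else u.2.1.1)
                 else (if val j == 0%N then u.2.2 else u.1 - u.2.1.2).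

Lemma to_mxK : cancel to_mx of_mx.
Proof.
move=> [z [[al be] ga]]; have h2 := two_unit D; rewrite /of_mx !mxE /=.
by congr (_, (_, _, _)); apply: (mulIr h2); rewrite mulrVK //; ring.
Qed.

Lemma of_mxK : cancel of_mx to_mx.
Proof.
move=> X; have h2 := two_unit D.
have e0 (H : (0 < 2)%N) : Ordinal H = 0 by apply: val_inj.
have e1 (H : (1 < 2)%N) : Ordinal H = 1 by apply: val_inj.
apply/matrixP => -[[|[|//]] Hi] [[|[|//]] Hj]; rewrite !mxE /= ?e0 ?e1 //;
by apply: (mulIr h2); rewrite mulrDl ?mulNr !mulrVK //; ring.
Qed.

Lemma to_mxB u v : to_mx (u - v) = to_mx u - to_mx v.
Proof. by apply/matrixP => -[[|[|//]] Hi] [[|[|//]] Hj]; rewrite !mxE /=; ring. Qed.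
Lemma to_mxD u v : to_mx (u + v) = to_mx u + to_mx v.
Proof. by apply/matrixP => -[[|[|//]] Hi] [[|[|//]] Hj]; rewrite !mxE /=; ring. Qed.
Lemma to_mxZ (r : D) u : to_mx (r *: u) = r *: to_mx u.
Proof.
apply/matrixP => -[[|[|//]] Hi] [[|[|//]] Hj]; rewrite !mxE //=;
  by rewrite ?mulrDr ?mulrN.
Qed.
Lemma to_mx0 : to_mx 0 = 0.
Proof. by apply/matrixP => -[[|[|//]] Hi] [[|[|//]] Hj]; rewrite !mxE /=; ring. Qed.

Lemma to_mx_br u v : to_mx (0, br u.2 v.2) = lie_bracket (to_mx u) (to_mx v).
Proof.
apply/matrixP => -[[|[|//]] Hi] [[|[|//]] Hj];
rewrite !mxE !big_ord_recl !big_ord0 !mxE /= /br; ring.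
Qed.

Lemma has_indexE U n : has_index U n <-> relidx setT (fun u => U (to_mx u)) n.
Proof.
split=> [[f [fs fi]]|[f [_ fs fi]]].
  exists (fun i => of_mx (f i)); split=> // [u _|i j].
    by have [i Ui] := fs (to_mx u); exists i; rewrite to_mxB of_mxK.
  by rewrite to_mxB !of_mxK; apply: fi.
exists (fun i => to_mx (f i)); split=> [X|i j].
  by have [i Ui] := fs (of_mx X) I; exists i; rewrite -[X]of_mxK -to_mxB.
by rewrite -to_mxB; apply: fi.
Qed.

Lemma gl2_subalgebraE U : gl2_subalgebra U <->
  submod (fun u => U (to_mx u)) /\ forall u v, U (to_mx u) -> U (to_mx v) -> U (to_mx (0, br u.2 v.2)).
Proof.
split=> [[U0 UD UZ Ub]|[[U0 UD UZ] Ub]].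
  split; last by move=> u v Uu Uv; rewrite to_mx_br; apply: Ub.
  by split=> [|u v Uu Uv|r u Uu]; rewrite ?to_mx0 ?to_mxD ?to_mxZ //; [apply: UD|apply: UZ].
split; first by rewrite -to_mx0.
- by move=> X Y; rewrite -(of_mxK X) -(of_mxK Y) -to_mxD; apply: UD.
- by move=> r X; rewrite -(of_mxK X) -to_mxZ; apply: UZ.
- by move=> X Y; rewrite -(of_mxK X) -(of_mxK Y) -to_mx_br; apply: Ub.
Qed.

Lemma gl2_index U n : gl2_subalgebra U -> has_index U n -> exists k, n = (q ^ k)%N.
Proof.
move=> /gl2_subalgebraE[sU _] /has_indexE iU.
by have [m [j [_ _ _ ->]]] := relidx_components sU iU; exists (m + j)%N.
Qed.

Lemma gsubE k U : gl2_subalgebra U /\ has_index U (q ^ k) <-> gsub k (fun u => U (to_mx u)).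
Proof.
by split=> [[/gl2_subalgebraE[? ?] /has_indexE ?]|[? ? ?]] //; split;
  [apply/gl2_subalgebraE|apply/has_indexE].
Qed.

Lemma card_gl2 k : card_sets (fun U => gl2_subalgebra U /\ has_index U (q ^ k)) (csize (@gsub D k)).
Proof.
set s := enumS (@gsub D k); have sP := enumSP (fin_gsub D k); rewrite -/s in sP.
pose f (i : 'I_(size s)) X := nth setT s i (of_mx X).
have fE i : (fun u => f i (to_mx u)) = nth setT s i by apply/funext => u; rewrite /f to_mxK.
exists f; split.
- by move=> i; apply/gsubE; rewrite fE; apply/sP/mem_nth.
- move=> i j e; apply: val_inj; apply/eqP; rewrite -(nth_uniq setT (ltn_ord i) (ltn_ord j) (enumS_uniq _)).
  apply/eqP; rewrite -!fE; apply/funext => u; apply/propext; exact: e.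
move=> U /gsubE /sP Us; have is_ : (index (fun u : G => U (to_mx u)) s < size s)%N by rewrite index_mem.
by exists (Ordinal is_) => X; rewrite /f /= nth_index // of_mxK.
Qed.

End Matrices.
(* zeta(s) = sum_k c_k q^{-ks}, and zeta(s) = W(q, q^{-s}) as Dirichlet series
   in T = q^{-s}, i.e. W_den(q,T) * sum_k c_k T^k = W_num(q,T) as formal
   power series. *)
Theorem mainTheorem9 :
  exists p0 : nat, forall p : nat, prime p -> (p0 < p)%N ->
  forall (R : idomainType) (pi : R) (q : nat),
    padic_int_ring p pi -> residue_card pi q ->
    (forall (U : 'M[R]_2 -> Prop) (n : nat),
        gl2_subalgebra U -> has_index U n -> exists k : nat, n = (q ^ k)%N) /\
    exists c : nat -> nat,
      (forall k : nat,
         card_sets (fun U : 'M[R]_2 -> Prop =>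
                      gl2_subalgebra U /\ has_index U (q ^ k)%N) (c k)) /\
      (forall k : nat,
         \sum_(i < k.+1) (W_den (q%:Z))`_i * (c (k - i)%N)%:Z
           = (W_num (q%:Z))`_k).
Proof.
exists 2%N => p pp p2 R pi q [[pi0 piN] dv _ [r er] _] rc.
(* As p is odd and divisible by pi, a pi dividing 2 would also divide 1 = p - 2 (p - 1)/2. *)
have two : ~ exists s, 2 = pi * s.
  move=> [s es]; have op : odd p by case: (even_prime pp) p2 => // ->.
  apply: (pi_ndvd1 piN (r := r - p./2%:R * s)).
  have ep : p%:R = 1 + p./2%:R * 2 :> R by rewrite -{1}(odd_double_half p) op natrD -muln2 natrM.
  by rewrite mulrBr -er ep mulrCA -es addrK.
pose D := residue_dvr rc piN dv pi0 two.
have qE : #|resF D| = q := card_residue rc piN dv pi0 two.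
split=> [U n sU iU|].
  by have [k ->] := @gl2_index D U n sU iU; exists k; rewrite qE.
exists (fun k => csize (@gsub D k)); split=> k.
  by have := card_gl2 D k; rewrite qE.
by have /(congr1 (fun f : ser => f k)) := zeta_rational D; rewrite qE serM.
Qed.
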